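(* Let $Y_V$ be a causal MCAR$(p)$ process with $\Sigma_L>0$ (positive definite), and let $a,b\in V$ with $a\neq b$. Then: (a) $Y_a\not\to Y_b\mid Y_V$ if and only if $[\mathbf{C}\mathbf{A}^\alpha\mathbf{E}_j]_{ba}=[\mathbf{A}^\alpha]_{b,\,k(j-1)+a}=0$ for all $\alpha=1,\ldots,kp-1$ and $j=1,\ldots,p$. (b) $Y_a\not\sim Y_b\mid Y_V$ if and only if $[\mathbf{C}\mathbf{A}^\alpha\mathbf{B}\Sigma_L\mathbf{B}^\top(\mathbf{A}^\top)^\beta\mathbf{C}^\top]_{ab}=0$ for all $\alpha,\beta=0,\ldots,kp-1$.
   Context: $V=\{1,\ldots,k\}$. $L^2$ is the Hilbert space of square-integrable complex random variables with $\langle X,Y\rangle=\mathbb{E}[X\overline{Y}]$; $P_{\mathcal L}$ is orthogonal projection onto a closed subspace. $\mathcal{L}_{Y_A}(s,t)$ is the closed linear span of $\{Y_a(u):a\in A,u\in[s,t]\cap\mathbb{R}\}$ and $\mathcal{L}_{Y_A}(t)=\mathcal{L}_{Y_A}(-\infty,t)$. $\mathcal{L}_1\perp\mathcal{L}_2\mid\mathcal{L}_3$ means $\mathbb{E}[(X-P_{\mathcal{L}_3}X)\overline{(Y-P_{\mathcal{L}_3}Y)}]=0$ for all $X\in\mathcal{L}_1,Y\in\mathcal{L}_2$. $Y_a\not\to Y_b\mid Y_V$ (Granger non-causality): $\mathcal{L}_{Y_b}(t,t+1)\perp\mathcal{L}_{Y_a}(t)\mid\mathcal{L}_{Y_{V\setminus\{a\}}}(t)$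 for all $t\in\mathbb{R}$. $Y_a\not\sim Y_b\mid Y_V$ (contemporaneously uncorrelated): $\mathcal{L}_{Y_a}(t,t+1)\perp\mathcal{L}_{Y_b}(t,t+1)\mid\mathcal{L}_{Y_V}(t)$ for all $t\in\mathbb{R}$. Lévy process: $L$ is a two-sided $k$-dimensional Lévy process, i.e. $L(t)=L_1(t)$ for $t\ge0$ and $L(t)=-\lim_{s\nearrow-t}L_2(s)$ for $t<0$ with independent copies $L_1,L_2$ of a one-sided Lévy process, with $\mathbb{E}L(1)=0$, $\mathbb{E}\|L(1)\|^2<\infty$, $\Sigma_L=\mathbb{E}[L(1)L(1)^\top]$. Causal MCAR$(p)$ process, $p\ge1$: let $A_1,\ldots,A_p\in\mathbb{R}^{k\times k}$ and let $\mathbf{A}\in\mathbb{R}^{kp\times kp}$ be the block companion matrix whose $i$-th block row, $i=1,\ldots,p-1$, has $I_k$ in block column $i+1$ and zeros otherwise, and whose last block row is $(-A_p,\ldots,-A_1)$; all eigenvalues of $\mathbf{A}$ have strictly negative real part. Let $\mathbf{B}^\top=(0_k,\ldots,0_k,I_k)$, $\mathbf{C}=(I_k,0_k,\ldots,0_k)\in\mathbb{R}^{k\times kp}$, and $\mathbf{E}_j^\top=(0_{k\times k(j-1)},I_k,0_{k\times k(p-j)})\in\mathbb{R}^{k\times kp}$. Then $Y_V(t)=\mathbf{C}X(t)$ with $X(t)=\int_{-\infty}^te^{\mathbf{A}(t-u)}\mathbf{B}\,dL(u)$, the unique stationary solution of $dX(t)=\mathbf{A}X(t)dt+\mathbf{B}dL(t)$.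 *)

(* Defs.v *)
From HB Require Import structures.
From mathcomp Require Import all_boot all_order all_algebra complex.
From mathcomp Require Import all_classical all_reals all_analysis.

Set Implicit Arguments.
Unset Strict Implicit.
Unset Printing Implicit Defensive.

Import Order.TTheory GRing.Theory Num.Theory numFieldNormedType.Exports.

Local Open Scope classical_set_scope.
Local Open Scope ring_scope.
Local Open Scope complex_scope.

(* Elements of L^2 are represented by functions [T -> R[i]]; closed subspaces are
   sets of such functions that are stable under almost-sure equality. *)

Definition csqnorm d (T : measurableType d) (R : realType)
    (P : probability T R) (X : T -> R[i]) : \bar R :=
  (\int[P]_w (complex.Re (X w) ^+ 2 + complex.Im (X w) ^+ 2)%R%:E)%E.

Definition L2C d (T : measurableType d) (R : realType)
    (P : probability T R) : set (T -> R[i]) :=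
  [set X | [/\ measurable_fun [set: T] (fun w => complex.Re (X w)),
               measurable_fun [set: T] (fun w => complex.Im (X w)) &
               (csqnorm P X < +oo)%E]].

Definition cexpectation d (T : measurableType d) (R : realType)
    (P : probability T R) (X : T -> R[i]) : R[i] :=
  (\int[P]_w complex.Re (X w)) +i* (\int[P]_w complex.Im (X w)).

Definition inner d (T : measurableType d) (R : realType)
    (P : probability T R) (X Y : T -> R[i]) : R[i] :=
  cexpectation P (fun w => X w * conjc (Y w)).

Definition linear_span (T : Type) (R : realType) (G : set (T -> R[i])) :
    set (T -> R[i]) :=
  [set X | exists (n : nat) (c : 'I_n -> R[i]) (g : 'I_n -> T -> R[i]),
     (forall i, G (g i)) /\ X = (fun w => \sum_(i < n) c i * g i w)].

Definition closed_span d (T : measurableType d) (R : realType)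
    (P : probability T R) (G : set (T -> R[i])) : set (T -> R[i]) :=
  [set X | L2C P X /\
     forall e : R, 0 < e -> exists2 Z, linear_span G Z &
       (csqnorm P (fun w => (X w - Z w)%R) < e%:E)%E].

Definition is_orth_proj d (T : measurableType d) (R : realType)
    (P : probability T R) (S : set (T -> R[i])) (X Z : T -> R[i]) : Prop :=
  S Z /\ forall W, S W -> inner P (fun w => X w - Z w) W = 0.

(* A version of the projection of [X] onto [S] (it is unique up to
   almost-sure equality). *)
Definition orth_proj d (T : measurableType d) (R : realType)
    (P : probability T R) (S : set (T -> R[i])) (X : T -> R[i]) : T -> R[i] :=
  xget (fun=> 0) [set Z | is_orth_proj P S X Z].

Definition cond_orth d (T : measurableType d) (R : realType)
    (P : probability T R) (S1 S2 S3 : set (T -> R[i])) : Prop :=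
  forall X Y, S1 X -> S2 Y ->
    inner P (fun w => X w - orth_proj P S3 X w)
            (fun w => Y w - orth_proj P S3 Y w) = 0.

(* A real [k]-dimensional process is a map [R -> 'I_k -> T -> R]
   (time, coordinate, outcome); the vertex set V is ['I_k]. *)

Definition process_span d (T : measurableType d) (R : realType)
    (P : probability T R) (k : nat) (Y : R -> 'I_k -> T -> R)
    (A : {set 'I_k}) (s t : \bar R) : set (T -> R[i]) :=
  closed_span P [set X | exists a u, [/\ a \in A, (s <= u%:E <= t)%E &
                           X = (fun w => (Y u a w)%:C)]].

Definition granger_noncausal d (T : measurableType d) (R : realType)
    (P : probability T R) (k : nat) (Y : R -> 'I_k -> T -> R)
    (a b : 'I_k) : Prop :=
  forall t : R,
    cond_orth P (process_span P Y [set b]%SET t%:E (t + 1)%R%:E)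
                (process_span P Y [set a]%SET -oo%E t%:E)
                (process_span P Y [set~ a]%SET -oo%E t%:E).

Definition contemp_uncorrelated d (T : measurableType d) (R : realType)
    (P : probability T R) (k : nat) (Y : R -> 'I_k -> T -> R)
    (a b : 'I_k) : Prop :=
  forall t : R,
    cond_orth P (process_span P Y [set a]%SET t%:E (t + 1)%R%:E)
                (process_span P Y [set b]%SET t%:E (t + 1)%R%:E)
                (process_span P Y [set: 'I_k]%SET -oo%E t%:E).

Definition cylinders (R : realType) (I : Type) (D : set I) :
    set (set (I -> R)) :=
  [set C | exists i, D i /\
     exists2 B : set R, measurable B & C = [set x : I -> R | B (x i)]].

Definition same_law d (T : measurableType d) (R : realType)
    (P : probability T R) (I : Type) (D : set I) (X Y : I -> T -> R) : Prop :=
  forall A, <<s cylinders D >> A ->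
    P [set w | A (fun i => X i w)] = P [set w | A (fun i => Y i w)].

Definition sigma_family d (T : measurableType d) (R : realType)
    (I : Type) (D : set I) (X : I -> T -> R) : set (set T) :=
  <<s [set E | exists i, D i /\
         exists2 B : set R, measurable B & E = X i @^-1` B] >>.

Definition increment (T : Type) (R : realType) (k : nat)
    (L : R -> 'I_k -> T -> R) (s t : R) : 'I_k -> T -> R :=
  fun i w => L t i w - L s i w.

Definition cadlag (R : realType) (x : R -> R) : Prop :=
  (forall t, 0 <= t -> x s @[s --> t^'+] --> x t) /\
  (forall t, 0 < t -> cvg (x s @[s --> t^'-])).

(* A one-sided process: only the values at times [t >= 0] are constrained. *)
Definition is_levy d (T : measurableType d) (R : realType)
    (P : probability T R) (k : nat) (L : R -> 'I_k -> T -> R) : Prop :=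
  [/\ (forall t i, 0 <= t -> measurable_fun [set: T] (L t i)) /\
      {ae P, forall w, forall i, L 0 i w = 0},
      forall (n : nat) (t : nat -> R) (E : nat -> set T),
        0 <= t 0%N -> (forall m, t m < t m.+1) ->
        (forall m, (m < n)%N ->
          sigma_family [set: 'I_k] (increment L (t m) (t m.+1)) (E m)) ->
        P (\bigcap_(m in `I_n) E m) = (\prod_(m < n) P (E m))%E,
      forall s h : R, 0 <= s -> 0 <= h ->
        same_law P [set: 'I_k] (increment L s (s + h)) (increment L 0 h),
      forall t e : R, 0 <= t -> 0 < e ->
        P [set w | e < Num.sqrt (\sum_(i < k) (L s i w - L t i w) ^+ 2)]
          @[s --> within [set s : R | 0 <= s] (nbhs t)] --> 0%E &
      {ae P, forall w, forall i, cadlag (fun t => L t i w)}].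

Definition nonneg_times (R : realType) (k : nat) : set (R * 'I_k) :=
  [set ti | 0 <= ti.1].

Definition is_two_sided_levy d (T : measurableType d) (R : realType)
    (P : probability T R) (k : nat) (L : R -> 'I_k -> T -> R) : Prop :=
  (forall t i, measurable_fun [set: T] (L t i)) /\
  exists L1 L2 : R -> 'I_k -> T -> R,
  [/\ is_levy P L1 /\ is_levy P L2,
      same_law P (@nonneg_times R k)
        (fun ti => L1 ti.1 ti.2) (fun ti => L2 ti.1 ti.2),
      forall E1 E2,
        sigma_family (@nonneg_times R k) (fun ti => L1 ti.1 ti.2) E1 ->
        sigma_family (@nonneg_times R k) (fun ti => L2 ti.1 ti.2) E2 ->
        P (E1 `&` E2) = (P E1 * P E2)%E &
      {ae P, forall w, forall i,
        (forall t, 0 <= t -> L t i w = L1 t i w) /\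
        (forall t, t < 0 -> L2 s i w @[s --> (- t)^'-] --> - L t i w)}].

Definition centered_sq_integrable d (T : measurableType d) (R : realType)
    (P : probability T R) (k : nat) (L : R -> 'I_k -> T -> R) : Prop :=
  (forall i, 'E_P[L 1%R i] = 0)%E /\
  (\int[P]_w (\sum_(i < k) L 1 i w ^+ 2)%R%:E < +oo)%E.

Definition SigmaL d (T : measurableType d) (R : realType)
    (P : probability T R) (k : nat) (L : R -> 'I_k -> T -> R) : 'M[R]_k :=
  \matrix_(i, j) \int[P]_w (L 1 i w * L 1 j w).

Definition posdef (R : realType) (n : nat) (M : 'M[R]_n) : Prop :=
  M^T = M /\ forall v : 'cV[R]_n, v != 0 -> 0 < (v^T *m M *m v) ord0 ord0.

(* A step function with values in row vectors is a sequence of triples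
   [((s, s'), c)] standing for the sum of the [c 1_(s, s']]. *)

Definition step_fun (R : realType) (k : nat) := seq (R * R * 'rV[R]_k).

Definition step_wf (R : realType) (k : nat) (phi : step_fun R k) : bool :=
  all (fun x => x.1.1 <= x.1.2) phi.

Definition step_eval (R : realType) (k : nat) (phi : step_fun R k) (u : R) :
    'rV[R]_k :=
  \sum_(x <- phi) (x.1.1 < u <= x.1.2)%R%:R *: x.2.

Definition step_integral (T : Type) (R : realType) (k : nat)
    (L : R -> 'I_k -> T -> R) (phi : step_fun R k) (w : T) : R :=
  \sum_(x <- phi) \sum_(j < k) x.2 ord0 j * increment L x.1.1 x.1.2 j w.

(* [X] is (a version of) the integral of [F u dL(u)] over [u <= t]: the limit
   in L^2(P) of integrals of step functions that converge to [F 1_(-oo, t]] in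
   L^2(du).  By the isometry property, it does not depend on the sequence. *)
Definition is_integral_upto d (T : measurableType d) (R : realType)
    (P : probability T R) (k : nat) (L : R -> 'I_k -> T -> R)
    (F : R -> 'rV[R]_k) (t : R) (X : T -> R) : Prop :=
  measurable_fun [set: T] X /\
  exists phi : nat -> step_fun R k,
  [/\ forall n, step_wf (phi n),
      forall j, (\int[@lebesgue_measure R]_u
                  (((u <= t)%R%:R * F u ord0 j
                    - step_eval (phi n) u ord0 j) ^+ 2)%R%:E)%E
                @[n --> \oo] --> 0%E &
      (\int[P]_w ((X w - step_integral L (phi n) w) ^+ 2)%R%:E)%E
        @[n --> \oo] --> 0%E].

Definition expmx (R : realType) (n : nat) (M : 'M[R]_n) : 'M[R]_n :=
  \matrix_(i, j) limn (series (fun m => (m`!%:R^-1 *: M ^+ m) i j)).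

(* A [kp x kp] matrix is a [p x p] block matrix with [k x k] blocks, of size
   [\sum_(i < p) k].  [Ac i] is the coefficient A_{i+1}. *)

Definition blk (k p : nat) (j : 'I_p) (a : 'I_k) : 'I_(\sum_(i < p) k) :=
  tagnat.Rank (p_ := fun=> k) j a.

Lemma blkE (k p : nat) (j : 'I_p) (a : 'I_k) : blk j a = (k * j + a)%N :> nat.
Proof.
rewrite /blk tagnat.RankEsum; congr (_ + _)%N.
by rewrite (big_ord_narrow (ltnW (ltn_ord j))) sum_nat_const card_ord mulnC.
Qed.

Definition mcarA (R : realType) (k p : nat) (Ac : 'I_p -> 'M[R]_k) :
    'M[R]_(\sum_(i < p) k) :=
  \mxblock_(i < p, j < p)
    (if (i.+1 < p)%N then (if j == i.+1 :> nat then 1%:M else 0)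
     else - Ac (rev_ord j)).

Definition mcarE (R : realType) (k p : nat) (j : 'I_p) :
    'M[R]_(\sum_(i < p) k, k) :=
  \mxcol_(i < p) (if i == j then 1%:M else 0 : 'M[R]_k).

Definition mcarB (R : realType) (k p : nat) : 'M[R]_(\sum_(i < p) k, k) :=
  \mxcol_(i < p) (if i.+1 == p :> nat then 1%:M else 0 : 'M[R]_k).

Definition mcarC (R : realType) (k p : nat) : 'M[R]_(k, \sum_(i < p) k) :=
  \mxrow_(j < p) (if j == 0%N :> nat then 1%:M else 0 : 'M[R]_k).

Definition stable (R : realType) (n : nat) (M : 'M[R]_n) : Prop :=
  forall z : R[i],
    eigenvalue (map_mx (fun x : R => x%:C) M) z -> complex.Re z < 0.

Definition causal_mcar d (T : measurableType d) (R : realType)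
    (P : probability T R) (k p : nat) (Ac : 'I_p -> 'M[R]_k)
    (L Y : R -> 'I_k -> T -> R) : Prop :=
  [/\ is_two_sided_levy P L,
      centered_sq_integrable P L,
      stable (mcarA Ac) &
      exists X : R -> 'I_(\sum_(i < p) k) -> T -> R,
        (forall t r, is_integral_upto P L
           (fun u => row r (expmx ((t - u) *: mcarA Ac) *m mcarB R k p))
           t (X t r)) /\
        (forall t a w, Y t a w = \sum_r mcarC R k p a r * X t r w)].

(* Main.v *)
Require Import Defs.
From HB Require Import structures.
From mathcomp Require Import all_boot all_order all_algebra complex.
From mathcomp Require Import all_classical all_reals all_analysis.
From mathcomp Require Import measurable_realfun.
From mathcomp Require Import ring lra zify.

Set Implicit Arguments.
Unset Strict Implicit.
Unset Printing Implicit Defensive.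

Import Order.TTheory GRing.Theory Num.Theory numFieldNormedType.Exports.

Local Open Scope classical_set_scope.
Local Open Scope ring_scope.

(** Write X for the state process, S for the covariance matrix of L(1), and X_(j,i) for
    coordinate i of the j-th block of X, with j counted from 0; thus Y_i = X_(0,i).

    Real reduction. All spaces are closed spans of real random variables, so projections act on
    real and imaginary parts separately and both conditions say that x - z is orthogonal
    to y in real L2, for x and y among the generators of the first two spaces and z the
    projection of x on the third ([cond_orth_complexified]).

    Isometry. A Levy process with square-integrable, centred L(1) has square-integrable,
    centred values whose covariances are linear in time ([two_sided_second_order]). So the
    inner product of two stochastic integrals is that of the integrands in
    L2(R; R^k), weighted by S ([levy_isometry]), and questions about X become
    questions about the kernels e^{A(t-v)} B on v <= t.

    Prediction. X(u) - e^{A(u-t)} X(t) is an integral over (t,u], hence orthogonal to the past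
    before t. Block j+1 of X is the mean square derivative of block j, so
    all X_(j,i)(t) belong to the closed span of the past of Y_i alone ([state_past]). The
    best prediction of Y_b(u) from the full past is therefore row b of e^{A(u-t)} X(t).

    Independence. Conversely, a nonzero combination of the X_(j,a)(t), with a fixed, is never in
    the closed span of the past of the other coordinates ([rspan_past_indep]). For
    s < u <= t, the weighted inner product of the kernel of X(u) with the function S^{-1} w
    supported in (s,t] is the state reached at time u by the control system
    x' = A x + B w started from 0 at time s. The companion form lets w be chosen so that x
    moves along coordinate a only, with x_(j,a)(v) = (v-s)^(p-j) / (p-j)!. Pairing with this
    function is then a continuous functional on integrals that vanishes on the past of the
    other coordinates, and its value at the sum of c_j X_(j,a)(t) is a polynomial in t - s with
    coefficients c_j / (p-j)!, which is zero for all s < t only if c = 0. This is where S must be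
    invertible.

    Part (a). Non-causality means that the projection of Y_b(u) on the past without a is also its
    projection on the full past, that is, that the prediction of Y_b(u) does not involve
    the X_(j,a)(t): the entries of e^{A(u-t)} in row b and columns (j,a) vanish for
    t <= u <= t + 1. Taking derivatives at u = t, this holds exactly when the same entries
    of all powers of A vanish. The zeroth power has them zero because a <> b, and
    the powers from kp on are combinations of the smaller ones by Cayley-Hamilton.

    Part (b). The residuals on the full past are the innovations, and for u <= u' the innovations
    of Y_a(u) and Y_b(u') have as covariance the integral over v in (t,u] of
    [C e^{A(u-v)} B S B^T e^{A^T(u'-v)} C^T]_ab. Varying t with u and u' fixed shows that the
    integrand vanishes, and derivatives at 0 with respect to u - v and u' - v give the
    products of powers in the statement; the converse is Cayley-Hamilton in each factor. *)

(** * Square-integrable real functions *)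

Definition square_integrable d (T : measurableType d) (R : realType)
    (mu : {measure set T -> \bar R}) (f : T -> R) : Prop :=
  measurable_fun [set: T] f /\ (\int[mu]_x ((f x) ^+ 2)%:E < +oo)%E.

Definition l2ip d (T : measurableType d) (R : realType)
    (mu : {measure set T -> \bar R}) (f g : T -> R) : R :=
  \int[mu]_x (f x * g x).

Section L2.
Context d (T : measurableType d) (R : realType) (mu : {measure set T -> \bar R}).
Implicit Types f g h : T -> R.
Notation sqi := (square_integrable mu).
Notation ip := (l2ip mu).

Lemma sqi_integrable_sqr f : sqi f -> mu.-integrable setT (EFin \o (fun x => f x ^+ 2)).
Proof.
move=> [mf lf]; apply/integrableP; split.
  by apply/measurable_EFinP; exact: measurable_funX.
rewrite (eq_integral (fun x => (f x ^+ 2)%:E)) // => x _ /=.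
by rewrite ger0_norm // sqr_ge0.
Qed.

Lemma sqi_mul f g : sqi f -> sqi g -> mu.-integrable setT (EFin \o (fun x => f x * g x)).
Proof.
move=> sf sg.
have Hd : mu.-integrable setT ((EFin \o (fun x => (f x ^+ 2)%R)) \+ (EFin \o (fun x => (g x ^+ 2)%R)))%E.
  by apply: integrableD => //; exact: sqi_integrable_sqr.
apply: le_integrable Hd => //.
  by apply/measurable_EFinP; apply: measurable_funM; [case: sf | case: sg].
move=> x _ /=; rewrite lee_fin (ger0_norm (addr_ge0 (sqr_ge0 _) (sqr_ge0 _))).
rewrite ler_norml; nra.
Qed.

Lemma sqi0 : sqi (fun=> 0).
Proof.
split; first exact: measurable_cst.
by rewrite integral0_eq // => x _; rewrite expr0n.
Qed.

Lemma sqiZ a f : sqi f -> sqi (fun x => a * f x).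
Proof.
move=> sf; split; first by apply: measurable_funM => //; case: sf.
have := integrableZl measurableT (a ^+ 2) (sqi_integrable_sqr sf).
move=> /integrable_lty; under eq_integral do rewrite /= -EFinM -exprMn; exact.
Qed.

Lemma sqiD f g : sqi f -> sqi g -> sqi (fun x => f x + g x).
Proof.
move=> sf sg; split; first by apply: measurable_funD; [case: sf | case: sg].
have H1 := integrableD measurableT (sqi_integrable_sqr sf) (sqi_integrable_sqr sg).
have H2 := integrableD measurableT H1 (integrableZl measurableT 2 (sqi_mul sf sg)).
have := integrable_lty measurableT H2.
under eq_integral do rewrite /= -EFinM -!EFinD.
by apply: le_lt_trans; rewrite le_eqVlt; apply/orP; left; apply/eqP;
  apply: eq_integral => x _ /=; congr EFin; ring.
Qed.

Lemma sqiN f : sqi f -> sqi (fun x => - f x).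
Proof. by move=> /(sqiZ (-1)); under eq_fun do rewrite mulN1r. Qed.

Lemma sqiB f g : sqi f -> sqi g -> sqi (fun x => f x - g x).
Proof. by move=> sf /sqiN sg; exact: sqiD. Qed.

Lemma sqi_sum I (s : seq I) (F : I -> T -> R) :
  (forall i, sqi (F i)) -> sqi (fun x => \sum_(i <- s) F i x).
Proof.
move=> sF; elim: s => [|i s ih].
  by under eq_fun do rewrite big_nil; exact: sqi0.
by under eq_fun do rewrite big_cons; exact: sqiD.
Qed.

Lemma ipC f g : ip f g = ip g f.
Proof. by apply: eq_Rintegral => x _; rewrite mulrC. Qed.

Lemma ipDl f g h : sqi f -> sqi g -> sqi h ->
  ip (fun x => f x + g x) h = ip f h + ip g h.
Proof.
move=> sf sg sh; rewrite /l2ip -RintegralD ?sqi_mul//.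
by apply: eq_Rintegral => x _; rewrite mulrDl.
Qed.

Lemma ipZl a f g : sqi f -> sqi g -> ip (fun x => a * f x) g = a * ip f g.
Proof.
move=> sf sg; rewrite /l2ip -RintegralZl ?sqi_mul//.
by apply: eq_Rintegral => x _; rewrite mulrA.
Qed.

Lemma ip0l g : ip (fun=> 0) g = 0.
Proof.
rewrite /l2ip (@eq_Rintegral _ _ _ _ _ (fun=> 0)); last by move=> x _; rewrite mul0r.
by rewrite Rintegral_cst // mul0r.
Qed.

Lemma ipNl f g : sqi f -> sqi g -> ip (fun x => - f x) g = - ip f g.
Proof.
move=> sf sg; rewrite -mulN1r -ipZl //.
by congr ip; apply/funext => x; rewrite mulN1r.
Qed.

Lemma ipBl f g h : sqi f -> sqi g -> sqi h ->
  ip (fun x => f x - g x) h = ip f h - ip g h.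
Proof. by move=> sf sg sh; rewrite ipDl ?ipNl //; exact: sqiN. Qed.

Lemma ip_suml I (s : seq I) (F : I -> T -> R) g :
  (forall i, sqi (F i)) -> sqi g ->
  ip (fun x => \sum_(i <- s) F i x) g = \sum_(i <- s) ip (F i) g.
Proof.
move=> sF sg; elim: s => [|i s ih].
  by under eq_fun do rewrite big_nil; rewrite big_nil ip0l.
under eq_fun do rewrite big_cons.
by rewrite big_cons ipDl ?ih //; exact: sqi_sum.
Qed.

Lemma ipDr f g h : sqi f -> sqi g -> sqi h ->
  ip h (fun x => f x + g x) = ip h f + ip h g.
Proof. by move=> sf sg sh; rewrite ipC ipDl // !(ipC h). Qed.

Lemma ipZr a f g : sqi f -> sqi g -> ip g (fun x => a * f x) = a * ip g f.
Proof. by move=> sf sg; rewrite ipC ipZl // (ipC g). Qed.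

Lemma ipBr f g h : sqi f -> sqi g -> sqi h ->
  ip h (fun x => f x - g x) = ip h f - ip h g.
Proof. by move=> sf sg sh; rewrite ipC ipBl // !(ipC h). Qed.

Lemma ip_sumr I (s : seq I) (F : I -> T -> R) g :
  (forall i, sqi (F i)) -> sqi g ->
  ip g (fun x => \sum_(i <- s) F i x) = \sum_(i <- s) ip g (F i).
Proof. by move=> sF sg; rewrite ipC ip_suml //; apply: eq_bigr => i _; rewrite ipC. Qed.

Lemma ip_ge0 f : 0 <= ip f f.
Proof. by apply: Rintegral_ge0 => x _; rewrite -expr2 sqr_ge0. Qed.

Lemma sqi_fin f : sqi f -> (\int[mu]_x ((f x) ^+ 2)%:E)%E = (ip f f)%:E.
Proof.
move=> sf; rewrite /l2ip /Rintegral fineK; last first.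
  by rewrite integrable_fin_num // sqi_mul.
by apply: eq_integral => x _; rewrite expr2.
Qed.

Lemma cauchy_schwarz f g : sqi f -> sqi g -> (ip f g) ^+ 2 <= ip f f * ip g g.
Proof.
move=> sf sg.
have H a b : 0 <= a ^+ 2 * ip f f + 2 * (a * b) * ip f g + b ^+ 2 * ip g g.
  have := ip_ge0 (fun x => a * f x + b * g x).
  rewrite ipDl ?ipDr ?ipZl ?ipZr //; try by [exact: sqiZ| apply: sqiD; exact: sqiZ].
  by rewrite (ipC g f); nra.
have [g0|g0] := eqVneq (ip g g) 0.
  have := H (ip f g) (- (ip f f + 1)); have := ip_ge0 f; rewrite g0 mulr0 => fp h.
  by have := sqr_ge0 (ip f g); nra.
have gp : 0 < ip g g by rewrite lt_neqAle eq_sym g0 ip_ge0.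
have := H (ip g g) (- ip f g); rewrite sqrrN => h.
rewrite -subr_ge0 -(pmulr_rge0 _ gp); nra.
Qed.

End L2.

(** * Completeness of L2 *)

Section complete.
Context d (T : measurableType d) (R : realType).
Implicit Types f g h : T -> R.

Lemma fatou_sqr (mu : {measure set T -> \bar R}) (v : nat -> T -> R) f (e : R) :
  measurable_fun setT f -> (forall n, measurable_fun setT (v n)) ->
  {ae mu, forall w, v n w @[n --> \oo] --> f w} ->
  (forall n, (\int[mu]_w (v n w ^+ 2)%:E <= e%:E)%E) ->
  (\int[mu]_w (f w ^+ 2)%:E <= e%:E)%E.
Proof.
move=> mf mv vf ve.
pose V n w := (v n w ^+ 2)%:E.
have mV n : measurable_fun setT (V n).
  by apply/measurable_EFinP; exact: measurable_funX.
have V0 n w : setT w -> (0 <= V n w)%E by rewrite lee_fin sqr_ge0.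
apply: (@le_trans _ _ (\int[mu]_w limn_einf (V^~ w))%E).
  apply: ae_ge0_le_integral => //.
  - by move=> w _; rewrite lee_fin sqr_ge0.
  - by apply/measurable_EFinP; exact: measurable_funX.
  - move=> w _; rewrite limn_einf_lim; apply: lime_ge; first exact: is_cvg_einfs.
    by apply: nearW => n; apply: le_ereal_inf_tmp => _ [m _ <-]; exact: V0.
  - rewrite /limn_einf; apply: measurableT_comp => //.
    apply: measurable_fun_limn_esup => n; exact: measurableT_comp.
  - apply: filterS vf => w vf _.
    have /cvg_limn_einf_sup[-> _] : V n w @[n --> \oo] --> (f w ^+ 2)%:E.
      by apply: cvg_EFin; [exact: nearW|rewrite /comp/= expr2; under eq_fun do rewrite expr2; exact: cvgM].
    exact: lexx.
apply: (le_trans (fatou _ measurableT mV V0)).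
rewrite limn_einf_lim; apply: lime_le; first exact: is_cvg_einfs.
apply: nearW => n; apply: le_trans (ve n).
by apply: ereal_inf_lbound; exists n => //=.
Qed.

Lemma cvg_series_fin_abs (h : nat -> R) :
  (\sum_(0 <= n <oo) `|h n|%:E < +oo)%E -> cvgn (series h).
Proof.
move=> hoo; apply: normed_cvg; apply: nondecreasing_is_cvgn.
  apply/nondecreasing_seqP => n; by rewrite /normed_series_of /series /= !big_mkord big_ord_recr //= lerDl.
exists (fine (\sum_(0 <= n <oo) `|h n|%:E)%E) => _ [n _ <-] /=.
rewrite -lee_fin fineK; last first.
  by rewrite ge0_fin_numE // nneseries_ge0 // => k _ _; rewrite lee_fin.
by rewrite /normed_series_of /series /= -sumEFin; apply: nneseries_lim_ge => k _ _; rewrite lee_fin.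
Qed.

(** Riesz-Fischer: a subsequence whose successive distances decay geometrically has
    almost surely summable increments, and Fatou transfers the Cauchy bound to the
    almost sure limit. *)
Lemma sqi_complete (P : probability T R) (u : nat -> T -> R) :
  (forall n, square_integrable P (u n)) ->
  (forall e : R, 0 < e -> exists N, forall m n, (N <= m)%N -> (N <= n)%N ->
     l2ip P (fun w => u m w - u n w) (fun w => u m w - u n w) <= e) ->
  exists2 f, square_integrable P f &
    forall e : R, 0 < e -> exists N, forall n, (N <= n)%N ->
     l2ip P (fun w => f w - u n w) (fun w => f w - u n w) <= e.
Proof.
move=> su cu.
have /choice[N hN] : forall k : nat, exists N, forall m n, (N <= m)%N -> (N <= n)%N ->
    l2ip P (fun w => u m w - u n w) (fun w => u m w - u n w) <= ((4 : R)^-1) ^+ k.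
  by move=> k; apply: cu; rewrite exprn_gt0 // invr_gt0.
(* Any index map that dominates each [N k] from [k] on gives a fast subsequence; this sum
   avoids building an increasing one by recursion. *)
pose s k := (k + \sum_(i < k.+1) N i)%N.
have sN k m : (k <= m)%N -> (N k <= s m)%N.
  move=> km; rewrite /s (bigD1 (Ordinal (km : (k < m.+1)%N))) //=; lia.
pose v k := u (s k).
pose h k w := v k.+1 w - v k w.
have sv k : square_integrable P (v k) by exact: su.
have sh k : square_integrable P (h k) by exact: sqiB.
(* |h| <= c h^2 + 1/c with c = 2^k turns the L2 bound 4^-k into the L1 bound 2 * 2^-k
   without an L1-L2 comparison inequality. *)
have ih k : (\int[P]_w `|h k w|%:E <= (2 * (2^-1 : R) ^+ k)%:E)%E.
  have Hk : l2ip P (h k) (h k) <= (4^-1) ^+ k by apply: hN; apply: sN.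
  pose c : R := 2 ^+ k.
  have c0 : 0 < c by rewrite exprn_gt0.
  have mh : measurable_fun setT (h k) by case: (sh k).
  have m1 : measurable_fun setT (fun w => (c * h k w ^+ 2)%:E).
    apply/measurable_EFinP; apply: measurable_funM => //.
    exact: measurable_funX.
  apply: (@le_trans _ _ (\int[P]_w ((c * h k w ^+ 2)%:E + (c^-1)%:E))%E).
    apply: ge0_le_integral => //=.
    - by apply/measurable_EFinP; exact: measurableT_comp.
    - by apply: emeasurable_funD.
    - move=> w _; rewrite -EFinD lee_fin -(ler_pM2r c0) mulrDl mulVf ?gt_eqF //.
      set x := h k w; have := sqr_ge0 (c * `|x| - 1).
      rewrite -[x ^+ 2]real_normK ?num_real //; nra.
  rewrite ge0_integralD //=; [|by move=> w _; rewrite lee_fin mulr_ge0 ?sqr_ge0 // ltW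
    |by move=> w _; rewrite lee_fin invr_ge0 ltW].
  under eq_integral do rewrite EFinM.
  rewrite ge0_integralZl_EFin //=; [|by move=> w _; rewrite lee_fin sqr_ge0
    |by apply/measurable_EFinP; exact: measurable_funX|exact: ltW].
  rewrite sqi_fin // integral_cst //.
  have -> : ((P : {measure set T -> \bar R}) [set: T] = 1)%E by exact: probability_setT.
  rewrite mule1 -EFinM -EFinD lee_fin.
  rewrite mulr_natl mulr2n exprVn -/c lerD // -ler_pdivlMl //.
  by apply: (le_trans Hk); rewrite /c -exprVn -exprMn -invfM -natrM.
have hoo : {ae P, forall w, (\sum_(0 <= n <oo) `|h n w|%:E < +oo)%E}.
  pose F w := (\sum_(0 <= n <oo) `|h n w|%:E)%E.
  have mh n : measurable_fun setT (fun w => `|h n w|%:E).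
    by apply/measurable_EFinP; apply: measurableT_comp => //; case: (sh n).
  have F0 w : (0 <= F w)%E by apply: nneseries_ge0 => n _ _; rewrite lee_fin.
  have iF : P.-integrable setT F.
    apply/integrableP; split.
      by apply: ge0_emeasurable_sum => //.
    under eq_integral do rewrite gee0_abs ?F0 //.
    rewrite /F integral_nneseries //.
    apply: (@le_lt_trans _ _ (\sum_(0 <= n <oo) (2 * (2^-1 : R) ^+ n)%:E)%E).
      apply: lee_nneseries => [n _ _|n _]; [exact: integral_ge0|exact: ih].
    have -> : (\sum_(0 <= n <oo) (2 * (2^-1 : R) ^+ n)%:E)%E = (2 / (1 - 2^-1))%:E.
      apply/cvg_lim => //; rewrite (_ : (fun n => _) = EFin \o series (geometric 2 2^-1)); last first.
        by apply/funext => n; rewrite /= /series /= sumEFin.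
      apply: cvg_EFin; first exact: nearW.
      by apply: cvg_geometric_series; rewrite ger0_norm; lra.
    exact: ltry.
  have := integrable_ae measurableT iF; apply: filterS => w /(_ I).
  by rewrite ge0_fin_numE.
(* A limsup is measurable on the whole space, also off the convergence set. *)
pose f w := fine (limn_esup (fun n => (v n w)%:E)).
have mv n : measurable_fun setT (v n) by case: (sv n).
have mf : measurable_fun setT f.
  apply: measurableT_comp => //; apply: measurable_fun_limn_esup => n.
  exact/measurable_EFinP.
have vf : {ae P, forall w, v n w @[n --> \oo] --> f w}.
  apply: filterS hoo => w /cvg_series_fin_abs /cvg_ex[/= l hl].
  have vl : v n w @[n --> \oo] --> v 0%N w + l.
    rewrite (_ : (fun n => v n w) = (fun n => v 0%N w + series (h ^~ w) n)).
      by apply: cvgD => //; exact: cvg_cst.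
    apply/funext => n; rewrite /series /= /h telescope_sumr //; lra.
  rewrite /f; have /cvg_limn_einf_sup[_ ->] : (v n w)%:E @[n --> \oo] --> (v 0%N w + l)%:E.
    by apply: cvg_EFin => //; exact: nearW.
  exact: vl.
have fe (e : R) : 0 < e -> exists N, forall n, (N <= n)%N ->
    (\int[P]_w ((f w - u n w) ^+ 2)%:E <= e%:E)%E.
  move=> e0; have [M hM] := cu e e0; exists M => n Mn.
  apply: (@fatou_sqr _ (fun k w => v (k + M)%N w - u n w)).
  - by apply: measurable_funB => //; case: (su n).
  - by move=> k; apply: measurable_funB => //; case: (su n).
  - apply: filterS vf => w vf; apply: cvgB; last exact: cvg_cst.
    by have := vf; rewrite -(@cvg_shiftn M R^o (v ^~ w)).
  - move=> k; rewrite sqi_fin ?lee_fin; last exact: sqiB.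
    by apply: hM => //; rewrite /s; lia.
have sf : square_integrable P f.
  have [M hM] := fe 1 ltr01.
  have -> : f = (fun w => (f w - u M w) + u M w) by apply/funext => w; rewrite subrK.
  apply: sqiD => //; split; first by apply: measurable_funB => //; case: (su M).
  by apply: le_lt_trans (hM M _) _ => //; exact: ltry.
exists f => // e /fe[M hM]; exists M => n /hM.
by rewrite sqi_fin ?lee_fin //; exact: sqiB.
Qed.

End complete.

(** * Real closed spans and orthogonal projections *)

Section norms.
Context d (T : measurableType d) (R : realType) (mu : {measure set T -> \bar R}).
Implicit Types f g h : T -> R.
Notation sqi := (square_integrable mu).
Notation ip := (l2ip mu).

Lemma ip_sqrD f g : sqi f -> sqi g ->
  ip (fun x => f x + g x) (fun x => f x + g x) = ip f f + 2 * ip f g + ip g g.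
Proof.
move=> sf sg; rewrite ipDl ?ipDr //; try exact: sqiD.
by rewrite (ipC mu g f); ring.
Qed.

Lemma ip_sqrB f g : sqi f -> sqi g ->
  ip (fun x => f x - g x) (fun x => f x - g x) = ip f f - 2 * ip f g + ip g g.
Proof.
move=> sf sg; rewrite ipBl ?ipBr //; try exact: sqiB.
by rewrite (ipC mu g f); ring.
Qed.

Lemma ip_sqrZ a f : sqi f -> ip (fun x => a * f x) (fun x => a * f x) = a ^+ 2 * ip f f.
Proof. by move=> sf; rewrite ipZl ?ipZr //; [ring|exact: sqiZ]. Qed.

Lemma ip_sqrD_le f g : sqi f -> sqi g ->
  ip (fun x => f x + g x) (fun x => f x + g x) <= 2 * ip f f + 2 * ip g g.
Proof.
move=> sf sg; have := ip_ge0 mu (fun x => f x - g x).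
by rewrite ip_sqrB // ip_sqrD //; lra.
Qed.

Lemma ip_sqr_triangle f g h : sqi f -> sqi g -> sqi h ->
  ip (fun x => f x - h x) (fun x => f x - h x) <=
  2 * ip (fun x => f x - g x) (fun x => f x - g x) +
  2 * ip (fun x => g x - h x) (fun x => g x - h x).
Proof.
move=> sf sg sh; have := ip_sqrD_le (sqiB sf sg) (sqiB sg sh).
by under [X in ip X X <= _ -> _]eq_fun do rewrite subrKA.
Qed.

Lemma ip_sqrBC f g : ip (fun x => f x - g x) (fun x => f x - g x) =
  ip (fun x => g x - f x) (fun x => g x - f x).
Proof. by apply: eq_Rintegral => x _; ring. Qed.

Lemma ip_null f g : sqi f -> sqi g -> ip f f = 0 -> ip f g = 0.
Proof.
move=> sf sg f0; apply/eqP; rewrite -sqrf_eq0 eq_le sqr_ge0 andbT.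
by have := cauchy_schwarz sf sg; rewrite f0 mul0r.
Qed.

End norms.

Lemma small_natSinv (R : realType) (e : R) : 0 < e ->
  exists M : nat, forall n : nat, (M <= n)%N -> n.+1%:R^-1 <= e.
Proof.
move=> e0; have [M _ hM] := near_infty_natSinv_lt (PosNum e0).
by exists M => n Mn; apply: ltW; exact: hM.
Qed.

Inductive lspan (T : Type) (R : realType) (G : set (T -> R)) : (T -> R) -> Prop :=
| lspan0 : lspan G (fun=> 0)
| lspanS c g X : G g -> lspan G X -> lspan G (fun w => c * g w + X w).

(** Membership does not distinguish functions that are equal almost surely, so these sets
    behave as closed subspaces of L2. *)
Definition rspan d (T : measurableType d) (R : realType) (P : probability T R)
    (G : set (T -> R)) (X : T -> R) : Prop :=
  square_integrable P X /\
  forall e : R, 0 < e -> exists2 Z, lspan G Z &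
    l2ip P (fun w => X w - Z w) (fun w => X w - Z w) < e.

(** Projection is a relation, because a projection is determined only up to a null set. *)
Definition rproj d (T : measurableType d) (R : realType) (P : probability T R)
    (G : set (T -> R)) (x z : T -> R) : Prop :=
  rspan P G z /\ forall W, rspan P G W -> l2ip P (fun w => x w - z w) W = 0.

Section hilbert.
Context d (T : measurableType d) (R : realType) (P : probability T R).
Implicit Types (f g h x y z X Y Z W : T -> R) (G : set (T -> R)).
Notation sqi := (square_integrable P).
Notation ip := (l2ip P).
Notation rspan := (rspan P).

Lemma lspan_sqi G X : G `<=` sqi -> lspan G X -> sqi X.
Proof.
move=> sG; elim=> [|c g {}X Gg _ sX]; first exact: sqi0.
by apply: sqiD => //; apply: sqiZ; exact: sG.
Qed.

Lemma lspanD G X Y : lspan G X -> lspan G Y -> lspan G (fun w => X w + Y w).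
Proof.
move=> GX GY; elim: GX => [|c g {}X Gg _ ih].
  by under eq_fun do rewrite add0r.
by under eq_fun do rewrite -addrA; exact: lspanS.
Qed.

Lemma lspanZ G a X : lspan G X -> lspan G (fun w => a * X w).
Proof.
elim=> [|c g {}X Gg _ ih].
  by under eq_fun do rewrite mulr0; exact: lspan0.
by under eq_fun do rewrite mulrDr mulrA; exact: lspanS.
Qed.

Lemma lspan_gen G g : G g -> lspan G g.
Proof.
move=> Gg; rewrite (_ : g = fun w => 1 * g w + 0); last first.
  by apply/funext => w; rewrite mul1r addr0.
by apply: lspanS => //; exact: lspan0.
Qed.

Lemma lspan_mono G G' X : G `<=` G' -> lspan G X -> lspan G' X.
Proof.
move=> GG'; elim=> [|c g {}X Gg _ ih]; first exact: lspan0.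
by apply: lspanS => //; exact: GG'.
Qed.

Lemma ip_sqrBB f : ip (fun w => f w - f w) (fun w => f w - f w) = 0.
Proof. by under eq_fun do rewrite subrr; rewrite ip0l. Qed.

Lemma rspan_lspan G X : G `<=` sqi -> lspan G X -> rspan G X.
Proof.
move=> sG GX; split; first exact: lspan_sqi GX.
by move=> e e0; exists X => //; rewrite ip_sqrBB.
Qed.

Lemma rspan_gen G g : G `<=` sqi -> G g -> rspan G g.
Proof. by move=> sG Gg; apply: rspan_lspan => //; exact: lspan_gen. Qed.

Lemma rspan0 G : rspan G (fun=> 0).
Proof.
split; first exact: sqi0.
by move=> e e0; exists (fun=> 0); [exact: lspan0 | rewrite (ip_sqrBB (fun=> 0))].
Qed.

Lemma rspan_mono G G' X : G `<=` G' -> rspan G X -> rspan G' X.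
Proof.
move=> GG' [sX hX]; split => // e /hX[Z GZ Ze]; exists Z => //.
exact: lspan_mono GZ.
Qed.

Lemma rspan_closed G X : G `<=` sqi -> sqi X ->
  (forall e : R, 0 < e -> exists2 Z, rspan G Z &
    ip (fun w => X w - Z w) (fun w => X w - Z w) < e) -> rspan G X.
Proof.
move=> sG sX hX; split => // e e0.
have e4 : 0 < e / 4 by rewrite divr_gt0.
have [Z [sZ hZ] XZ] := hX _ e4; have [W GW ZW] := hZ _ e4; exists W => //.
by have := ip_sqr_triangle sX sZ (lspan_sqi sG GW); lra.
Qed.

Lemma rspanD G X Y : G `<=` sqi -> rspan G X -> rspan G Y ->
  rspan G (fun w => X w + Y w).
Proof.
move=> sG [sX hX] [sY hY]; split => [|e e0]; first exact: sqiD.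
have e4 : 0 < e / 4 by rewrite divr_gt0.
have [Z GZ XZ] := hX _ e4; have [W GW YW] := hY _ e4.
exists (fun w => Z w + W w); first exact: lspanD.
have := ip_sqrD_le (sqiB sX (lspan_sqi sG GZ)) (sqiB sY (lspan_sqi sG GW)).
under [X in ip X X <= _ -> _]eq_fun do rewrite addrACA -opprD.
by move=> h; apply: (le_lt_trans h); lra.
Qed.

Lemma rspanZ G a X : G `<=` sqi -> rspan G X -> rspan G (fun w => a * X w).
Proof.
move=> sG [sX hX]; split => [|e e0]; first exact: sqiZ.
have a0 : 0 < a ^+ 2 + 1 by rewrite ltr_wpDl ?sqr_ge0.
have [Z GZ XZ] := hX _ (divr_gt0 e0 a0); exists (fun w => a * Z w); first exact: lspanZ.
under [X in ip X X]eq_fun do rewrite -mulrBr.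
rewrite ip_sqrZ; last by apply: sqiB => //; exact: lspan_sqi GZ.
have := ip_ge0 P (fun w => X w - Z w); move: XZ; rewrite ltr_pdivlMr //; nra.
Qed.

Lemma rspanB G X Y : G `<=` sqi -> rspan G X -> rspan G Y ->
  rspan G (fun w => X w - Y w).
Proof.
move=> sG GX GY; have := rspanD sG GX (rspanZ (-1) sG GY).
by under eq_fun do rewrite mulN1r.
Qed.

Lemma rspan_sum G I (s : seq I) (F : I -> T -> R) : G `<=` sqi ->
  (forall i, rspan G (F i)) -> rspan G (fun w => \sum_(i <- s) F i w).
Proof.
move=> sG GF; elim: s => [|i s ih].
  by under eq_fun do rewrite big_nil; exact: rspan0.
by under eq_fun do rewrite big_cons; exact: rspanD.
Qed.

(** Orthogonality passes from generators to the closed span: the inner product with a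
    fixed vector is linear and, by Cauchy-Schwarz, continuous. *)
Lemma rspan_orth G V X : G `<=` sqi -> sqi V -> (forall g, G g -> ip V g = 0) ->
  rspan G X -> ip V X = 0.
Proof.
move=> sG sV VG [sX hX].
have VZ Z : lspan G Z -> ip V Z = 0.
  elim=> [|c g {}Z Gg GZ ih]; first by rewrite ipC ip0l.
  have sg := sG _ Gg; have sZ := lspan_sqi sG GZ.
  by rewrite ipDr // ?ipZr ?(VG _ Gg) ?ih ?mulr0 ?addr0 //; exact: sqiZ.
apply/eqP; rewrite -sqrf_eq0 eq_le sqr_ge0 andbT; apply/ler_addgt0Pl => e e0.
have v0 : 0 < ip V V + 1 by rewrite ltr_wpDl ?ip_ge0.
have [Z GZ XZ] := hX _ (divr_gt0 e0 v0); have sZ := lspan_sqi sG GZ.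
have -> : ip V X = ip V (fun w => X w - Z w) by rewrite ipBr // (VZ Z) // subr0.
have := cauchy_schwarz sV (sqiB sX sZ).
have := ip_ge0 P V; have := ip_ge0 P (fun w => X w - Z w).
by move: XZ; rewrite ltr_pdivlMr //; nra.
Qed.

(** A sequence in the span whose distances to [x] approach the infimum is Cauchy by the
    parallelogram law; its limit is at minimal distance, and moving it along [W] cannot
    bring it closer, which forces orthogonality. *)
Lemma rproj_exists G x : G `<=` sqi -> sqi x -> exists z, rproj P G x z.
Proof.
move=> sG sx.
pose N z := ip (fun w => x w - z w) (fun w => x w - z w).
pose D := [set r | exists2 z, rspan G z & r = N z].
have D0 : has_lbound D by exists 0 => _ [z _ ->]; exact: ip_ge0.
have Dn : D !=set0 by exists (N (fun=> 0)); exists (fun=> 0) => //; exact: rspan0.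
have iD : has_inf D by [].
have DN z : rspan G z -> inf D <= N z by move=> Gz; apply: ge_inf => //; exists z.
have /choice[u hu] : forall n : nat, exists z, rspan G z /\ N z < inf D + n.+1%:R^-1.
  move=> n; have n0 : 0 < (n.+1%:R^-1 : R) by rewrite invr_gt0.
  by have [_ [z Gz ->] Nz] := inf_adherent n0 iD; exists z.
have su n : sqi (u n) by have [[]] := hu n.
have cu e : 0 < e -> exists M, forall m n, (M <= m)%N -> (M <= n)%N ->
    ip (fun w => u m w - u n w) (fun w => u m w - u n w) <= e.
  move=> e0; have e4 : 0 < e / 4 by rewrite divr_gt0.
  have [M hM] := small_natSinv e4; exists M => m n Mm Mn.
  pose y w := x w - u m w; pose z w := x w - u n w.
  have sy : sqi y by exact: sqiB.
  have sz : sqi z by exact: sqiB.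
  have [Gm Nm] := hu m; have [Gn Nn] := hu n.
  have := DN _ (rspanZ (1 / 2) sG (rspanD sG Gm Gn)).
  have -> : N (fun w => 1 / 2 * (u m w + u n w)) =
      (1 / 2) ^+ 2 * ip (fun w => y w + z w) (fun w => y w + z w).
    rewrite -ip_sqrZ; last exact: sqiD.
    by apply: eq_Rintegral => w _; rewrite /y /z; field.
  have -> : ip (fun w => u m w - u n w) (fun w => u m w - u n w) =
      ip (fun w => y w - z w) (fun w => y w - z w).
    by apply: eq_Rintegral => w _; rewrite /y /z; ring.
  rewrite ip_sqrD // ip_sqrB //; have := hM m Mm; have := hM n Mn.
  move: Nm Nn; rewrite -[N (u m)]/(ip y y) -[N (u n)]/(ip z z).
  move: (m.+1%:R^-1 : R) (n.+1%:R^-1 : R) => a b; lra.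
have [z sz hz] := sqi_complete su cu.
have Gz : rspan G z.
  apply: rspan_closed => // e e0; have e2 : 0 < e / 2 by rewrite divr_gt0.
  have [M hM] := hz _ e2; exists (u M); first by have [] := hu M.
  by have := hM M (leqnn _); lra.
exists z; split => // W GW; have [sW _] := GW.
apply/eqP; rewrite -sqrf_eq0 eq_le sqr_ge0 andbT; apply/ler_addgt0Pl => e e0.
rewrite addr0; set q := ip W W; have q0 : 0 <= q by exact: ip_ge0.
have e1 : 0 < e / (4 * (q + 1)) by rewrite divr_gt0 // mulr_gt0 // ltr_wpDl.
have [M hM] := hz _ e1; have [M' hM'] := small_natSinv e1.
pose n := maxn M M'; have {hM}hM := hM n (leq_maxl _ _).
have {hM'}hM' := hM' n (leq_maxr _ _); have [Gn Nn] := hu n.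
have hp : ip (fun w => x w - u n w) W ^+ 2 <= n.+1%:R^-1 * (q + 1).
  (* The optimal step is p / q; adding 1 to the denominator covers q = 0. *)
  set p := ip _ W; pose t := p / (q + 1).
  have q1 : 0 < q + 1 by rewrite ltr_wpDl.
  have := DN _ (rspanD sG Gn (rspanZ t sG GW)).
  have -> : N (fun w => u n w + t * W w) =
      ip (fun w => (x w - u n w) - t * W w) (fun w => (x w - u n w) - t * W w).
    by apply: eq_Rintegral => w _; ring.
  rewrite ip_sqrB; [|exact: sqiB|exact: sqiZ].
  rewrite ip_sqrZ // ipZr //; last exact: sqiB.
  rewrite -/p -/q -[ip _ _]/(N (u n)) => h.
  have tp : t * (q + 1) = p by rewrite /t divfK // gt_eqF.
  have : 2 * (t * p) - t ^+ 2 * q <= n.+1%:R^-1.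
    by move: Nn h; rewrite -/(N (u n)); move: (N _) (inf D) (n.+1%:R^-1) => a b c; lra.
  rewrite -(ler_pM2r q1); apply: le_trans.
  have -> : p ^+ 2 = t ^+ 2 * (q + 1) ^+ 2 by rewrite -tp exprMn.
  rewrite -tp; have := sqr_ge0 t; nra.
have hn : ip (fun w => u n w - z w) W ^+ 2 <= e / (4 * (q + 1)) * q.
  apply: (le_trans (cauchy_schwarz (sqiB (su n) sz) sW)).
  by rewrite ler_wpM2r // ip_sqrBC.
have -> : ip (fun w => x w - z w) W =
    ip (fun w => x w - u n w) W + ip (fun w => u n w - z w) W.
  by rewrite -ipDl //; [apply: eq_Rintegral => w _; ring|exact: sqiB|exact: sqiB].
set p1 := ip _ W in hp *; set p2 := ip _ W in hn *.
have hp' : p1 ^+ 2 <= e / (4 * (q + 1)) * (q + 1).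
  by apply: (le_trans hp); rewrite ler_wpM2r // addr_ge0.
have hn' : p2 ^+ 2 <= e / (4 * (q + 1)) * (q + 1).
  by apply: (le_trans hn); rewrite ler_wpM2l ?ltW // ltrDl.
have E : e / (4 * (q + 1)) * (q + 1) = e / 4.
  by field; rewrite gt_eqF // ltr_wpDl.
move: hp' hn'; rewrite E; have := sqr_ge0 (p1 - p2); nra.
Qed.

End hilbert.

(** * Complex conditional orthogonality over real generators *)

Definition complexified (T : Type) (R : realType) (G : set (T -> R)) : set (T -> R[i]) :=
  [set X | exists2 g, G g & X = fun w => (g w)%:C%C].

Section complexify.
Local Open Scope complex_scope.
Context d (T : measurableType d) (R : realType) (P : probability T R).
Implicit Types (f g h x y z : T -> R) (X Y Z W : T -> R[i]) (G : set (T -> R)).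
Notation sqi := (square_integrable P).
Notation ip := (l2ip P).
Notation rspan := (rspan P).
Notation rproj := (rproj P).
Notation re X := (fun w => complex.Re (X w)).
Notation im X := (fun w => complex.Im (X w)).

Lemma csqnormE X : sqi (re X) -> sqi (im X) ->
  csqnorm P X = (ip (re X) (re X) + ip (im X) (im X))%:E.
Proof.
move=> sr si; rewrite EFinD -!sqi_fin //= /csqnorm.
under eq_integral do rewrite EFinD.
rewrite ge0_integralD //=; try by [move=> w _; rewrite lee_fin sqr_ge0].
- by apply/measurable_EFinP; apply: measurable_funX; case: sr.
- by apply/measurable_EFinP; apply: measurable_funX; case: si.
Qed.

Lemma L2CE X : L2C P X <-> sqi (re X) /\ sqi (im X).
Proof.
split=> [[mr mi lX]|[sr si]]; last first.
  by split; [case: sr|case: si|rewrite csqnormE // ltry].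
split; split => //; apply: le_lt_trans lX; apply: ge0_le_integral => //=;
  try by [move=> w _; rewrite lee_fin sqr_ge0|move=> w _; rewrite lee_fin addr_ge0 ?sqr_ge0].
- by apply/measurable_EFinP; exact: measurable_funX.
- by apply/measurable_EFinP; apply: measurable_funD; exact: measurable_funX.
- by move=> w _; rewrite lee_fin lerDl sqr_ge0.
- by apply/measurable_EFinP; exact: measurable_funX.
- by apply/measurable_EFinP; apply: measurable_funD; exact: measurable_funX.
- by move=> w _; rewrite lee_fin lerDr sqr_ge0.
Qed.

Lemma innerE X Y : sqi (re X) -> sqi (im X) -> sqi (re Y) -> sqi (im Y) ->
  inner P X Y = (ip (re X) (re Y) + ip (im X) (im Y))
             +i* (ip (im X) (re Y) - ip (re X) (im Y)).
Proof.
move=> rX iX rY iY; rewrite /inner /cexpectation /l2ip.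
rewrite -RintegralD ?sqi_mul // -RintegralB ?sqi_mul //.
congr (_ +i* _); apply: eq_Rintegral => w _; case: (X w) => a b; case: (Y w) => a' b' /=; ring.
Qed.

Lemma linear_span_cons (G : set (T -> R[i])) c (g : T -> R[i]) Z : G g -> linear_span G Z ->
  linear_span G (fun w => c * g w + Z w).
Proof.
move=> Gg [n [e [h [Gh ->]]]].
exists n.+1, (fun i => if unlift ord0 i is Some j then e j else c),
  (fun i => if unlift ord0 i is Some j then h j else g); split.
  by move=> i; case: unliftP.
apply/funext => w; rewrite big_ord_recl unlift_none; congr (_ + _).
by apply: eq_bigr => i _; rewrite liftK.
Qed.

(** Complex coefficients on real generators act on the real and the imaginary part
    separately, so no condition couples the two parts. *)
Lemma linear_span_complexified G X :
  linear_span (complexified G) X <-> lspan G (re X) /\ lspan G (im X).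
Proof.
split=> [[n [c [g [Gg ->]]]]|[Gr Gi]].
  have /choice[h hP] : forall i, exists h, G h /\ g i = (fun w => (h w)%:C).
    by move=> i; have [h] := Gg i; exists h.
  clear Gg.
  elim: n c g h hP => [|n ih] c g h hP.
    by split; [under eq_fun do rewrite big_ord0|under eq_fun do rewrite big_ord0];
      exact: lspan0.
  have [ihr ihi] := ih (fun i => c (lift ord0 i)) (fun i => g (lift ord0 i))
    (fun i => h (lift ord0 i)) (fun i => hP _).
  have [Gh gE] := hP ord0.
  split.
    rewrite (_ : (fun w => _) = (fun w => complex.Re (c ord0) * h ord0 w +
      complex.Re (\sum_(i < n) c (lift ord0 i) * g (lift ord0 i) w))); first exact: lspanS.
    apply/funext => w; rewrite big_ord_recl gE raddfD /=; congr (_ + _).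
    by case: (c ord0) => a b /=; rewrite mulr0 subr0.
  rewrite (_ : (fun w => _) = (fun w => complex.Im (c ord0) * h ord0 w +
    complex.Im (\sum_(i < n) c (lift ord0 i) * g (lift ord0 i) w))); first exact: lspanS.
  apply/funext => w; rewrite big_ord_recl gE raddfD /=; congr (_ + _).
  by case: (c ord0) => a b /=; rewrite mulr0 add0r.
have Hi v : lspan G v -> linear_span (complexified G) (fun w => 'i * (v w)%:C).
  elim=> [|c g x Gg _ ih].
    exists 0%N, (fun=> 0), (fun=> fun=> 0); split => [[]//|].
    by apply/funext => w; rewrite big_ord0 rmorph0 mulr0.
  rewrite (_ : (fun w => _) = (fun w => ('i * c%:C) * (g w)%:C + 'i * (x w)%:C)).
    by apply: linear_span_cons => //; exists g.
  by apply/funext => w; rewrite rmorphD rmorphM /= mulrDr mulrA.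
have Hr u v : lspan G v -> lspan G u ->
    linear_span (complexified G) (fun w => (u w)%:C + 'i * (v w)%:C).
  move=> Gv; elim=> [|c g x Gg _ ih].
    by under eq_fun do rewrite rmorph0 add0r; exact: Hi.
  rewrite (_ : (fun w => _) = (fun w => c%:C * (g w)%:C + ((x w)%:C + 'i * (v w)%:C))).
    by apply: linear_span_cons => //; exists g.
  by apply/funext => w; rewrite rmorphD rmorphM /= addrA.
have -> : X = (fun w => (complex.Re (X w))%:C + 'i * (complex.Im (X w))%:C).
  by apply/funext => w; rewrite -complexE.
exact: Hr.
Qed.

Lemma ReB (a b : R[i]) : complex.Re (a - b) = complex.Re a - complex.Re b.
Proof. by case: a; case: b. Qed.

Lemma ImB (a b : R[i]) : complex.Im (a - b) = complex.Im a - complex.Im b.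
Proof. by case: a; case: b. Qed.

Lemma re_sub X Z :
  (fun w => complex.Re (X w - Z w)) = (fun w => complex.Re (X w) - complex.Re (Z w)).
Proof. by apply/funext => w; rewrite ReB. Qed.

Lemma im_sub X Z :
  (fun w => complex.Im (X w - Z w)) = (fun w => complex.Im (X w) - complex.Im (Z w)).
Proof. by apply/funext => w; rewrite ImB. Qed.

Lemma csqnormB X Z : sqi (re X) -> sqi (im X) -> sqi (re Z) -> sqi (im Z) ->
  csqnorm P (fun w => X w - Z w) =
  (ip (fun w => complex.Re (X w) - complex.Re (Z w))
      (fun w => complex.Re (X w) - complex.Re (Z w)) +
   ip (fun w => complex.Im (X w) - complex.Im (Z w))
      (fun w => complex.Im (X w) - complex.Im (Z w)))%:E.
Proof.
move=> rX iX rZ iZ.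
by rewrite csqnormE /= ?re_sub ?im_sub //; exact: sqiB.
Qed.

Lemma closed_span_complexified G X : G `<=` sqi ->
  closed_span P (complexified G) X <-> rspan G (re X) /\ rspan G (im X).
Proof.
move=> sG; split=> [[/L2CE[sr si] hX]|[[sr hr] [si hi]]].
  split; split => // e e0; have [Z /linear_span_complexified[Zr Zi]] := hX _ e0;
    have sZr := lspan_sqi sG Zr; have sZi := lspan_sqi sG Zi;
    rewrite csqnormB // lte_fin => XZ; [exists (re Z)|exists (im Z)] => //;
    by apply: le_lt_trans XZ; rewrite ?lerDl ?lerDr ip_ge0.
split; first exact/L2CE.
move=> e e0; have e2 : 0 < e / 2 by rewrite divr_gt0.
have [x Gx Xx] := hr _ e2; have [y Gy Xy] := hi _ e2.
exists (fun w => x w +i* y w); first exact/linear_span_complexified.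
have sx := lspan_sqi sG Gx; have sy := lspan_sqi sG Gy.
by rewrite csqnormB // lte_fin /=; lra.
Qed.

Lemma is_orth_proj_complexified G X Z : G `<=` sqi -> L2C P X ->
  is_orth_proj P (closed_span P (complexified G)) X Z <->
  rproj G (re X) (re Z) /\ rproj G (im X) (im Z).
Proof.
move=> sG /L2CE[sr si]; split=> [[/closed_span_complexified -/(_ sG)[Gr Gi] hZ]|].
  have H (W : T -> R) : rspan G W -> ip (fun w => complex.Re (X w) - complex.Re (Z w)) W = 0 /\
      ip (fun w => complex.Im (X w) - complex.Im (Z w)) W = 0.
    move=> GW; have [sW _] := GW; have [sZr _] := Gr; have [sZi _] := Gi.
    have := hZ (fun w => (W w)%:C).
    rewrite innerE /= ?re_sub ?im_sub //; [|exact: sqiB|exact: sqiB|exact: sqi0].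
    rewrite ![ip _ (fun=> 0)]ipC !ip0l addr0 subr0 => h.
    have /h[] // : closed_span P (complexified G) (fun w => (W w)%:C).
    by apply/closed_span_complexified => //; split => //; exact: rspan0.
  by split; split => // W /H[].
move=> [[Gr hr] [Gi hi]]; split; first exact/closed_span_complexified.
move=> W /closed_span_complexified -/(_ sG)[Wr Wi].
have [sWr _] := Wr; have [sWi _] := Wi; have [sZr _] := Gr; have [sZi _] := Gi.
rewrite innerE /= ?re_sub ?im_sub //; [|exact: sqiB|exact: sqiB].
by rewrite !hr // !hi // addr0 subr0.
Qed.

(** The chosen projection [orth_proj] is meaningful only when some projection exists;
    two real projections provide one. *)
Lemma orth_proj_complexified G X : G `<=` sqi -> L2C P X ->
  let Z := orth_proj P (closed_span P (complexified G)) X in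
  rproj G (re X) (re Z) /\ rproj G (im X) (im Z).
Proof.
move=> sG LX; apply/is_orth_proj_complexified => //; have [sr si] := (L2CE X).1 LX.
rewrite /orth_proj; apply: xgetPex.
have [x hx] := rproj_exists sG sr; have [y hy] := rproj_exists sG si.
by exists (fun w => x w +i* y w); apply/is_orth_proj_complexified.
Qed.

(** Self-adjointness of the projection: both sides are the inner product of the two
    residuals. *)
Lemma rproj_sym G x y z z' : rproj G x z -> rproj G y z' -> sqi x -> sqi y ->
  ip (fun w => x w - z w) y = ip x (fun w => y w - z' w).
Proof.
move=> [Gz hz] [Gz' hz'] sx sy; have [sz _] := Gz; have [sz' _] := Gz'.
have := hz _ Gz'; have := hz' _ Gz.
rewrite ![ip (fun w => y w - _) _]ipC ipBr // [in X in _ -> X -> _]ipBl //.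
rewrite ipBl // ipBr //; lra.
Qed.

Lemma rproj_uniq G x z z' : G `<=` sqi -> sqi x -> rproj G x z -> rproj G x z' ->
  ip (fun w => z w - z' w) (fun w => z w - z' w) = 0.
Proof.
move=> sG sx [Gz hz] [Gz' hz']; have [sz _] := Gz; have [sz' _] := Gz'.
have GB := rspanB sG Gz Gz'; have [sB _] := GB.
have := hz _ GB; have := hz' _ GB; rewrite !ipBl //; lra.
Qed.

(** The residual of [y] may be replaced by [y], since the residual of [x] is orthogonal to
    the conditioning space. In this form the condition passes from generators to closed
    spans, first in [y] and then, by self-adjointness, in [x]; and the complex inner
    product is a combination of four real ones. *)
Lemma cond_orth_complexified G1 G2 G3 :
  G1 `<=` sqi -> G2 `<=` sqi -> G3 `<=` sqi ->
  cond_orth P (closed_span P (complexified G1)) (closed_span P (complexified G2))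
    (closed_span P (complexified G3)) <->
  forall x y z, G1 x -> G2 y -> rproj G3 x z -> ip (fun w => x w - z w) y = 0.
Proof.
move=> s1 s2 s3; split=> [h x y z Gx Gy xz|h].
  have sx := s1 _ Gx; have sy := s2 _ Gy.
  have Lx : L2C P (fun w => (x w)%:C) by apply/L2CE; split => //; exact: sqi0.
  have Ly : L2C P (fun w => (y w)%:C) by apply/L2CE; split => //; exact: sqi0.
  have := h (fun w => (x w)%:C) (fun w => (y w)%:C).
  have := orth_proj_complexified s3 Lx; have := orth_proj_complexified s3 Ly.
  set zy := orth_proj P _ _; set zx := orth_proj P _ _ => /= -[yr yi] [xr xi].
  have [[syr _] hyr] := yr; have [[syi _] _] := yi.
  have [[sxr _] hxr] := xr; have [[sxi _] hxi] := xi.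
  have rE (a : T -> R) (b : T -> R[i]) : (fun w => complex.Re ((a w)%:C - b w)) = (fun w => a w - complex.Re (b w)).
    by apply/funext => w; rewrite ReB.
  have iE (a : T -> R) (b : T -> R[i]) : (fun w => complex.Im ((a w)%:C - b w)) = (fun w => 0 - complex.Im (b w)).
    by apply/funext => w; rewrite ImB.
  rewrite innerE ?rE ?iE; try by [exact: sqiB|apply: sqiB => //; exact: sqi0].
  move=> h1; have {h1} : ip (fun w => x w - complex.Re (zx w)) (fun w => y w - complex.Re (zy w))
      + ip (fun w => 0 - complex.Im (zx w)) (fun w => 0 - complex.Im (zy w)) = 0.
    have GE (G : set (T -> R)) g : G `<=` sqi -> G g ->
        closed_span P (complexified G) (fun w => (g w)%:C).
      move=> sG Gg; apply/closed_span_complexified => //.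
      by split; [exact: rspan_gen|exact: rspan0].
    by have [] := h1 (GE _ _ s1 Gx) (GE _ _ s2 Gy).
  have s0 := sqi0 P; have sB := sqiB s0 sxi.
  rewrite ipBr //; last exact: sqiB.
  rewrite [X in _ + X]ipBr // (hxr _ yr.1) (hxi _ yi.1).
  rewrite [ip _ (fun=> 0)]ipC ip0l !subr0 addr0 => h1.
  have := ip_null (sqiB sxr xz.1.1) sy (rproj_uniq s3 sx xr xz).
  by move: h1; rewrite !ipBl //; [lra|exact: xz.1.1|exact: xz.1.1].
have h2 x y z : rspan G1 x -> rspan G2 y -> rproj G3 x z -> ip (fun w => x w - z w) y = 0.
  move=> Gx Gy xz; have [sx _] := Gx; have [sz _] := xz.1.
  apply: (rspan_orth s2 _ _ Gy); first exact: sqiB.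
  move=> g Gg; have sg := s2 _ Gg; have [zg hg] := rproj_exists s3 sg.
  rewrite (rproj_sym xz hg) // ipC; have [szg _] := hg.1.
  apply: (rspan_orth s1 _ _ Gx); first exact: sqiB.
  move=> f Gf; have sf := s1 _ Gf; have [zf hf] := rproj_exists s3 sf.
  by rewrite ipC -(rproj_sym hf hg) //; exact: h.
have h3 x y z z' : rspan G1 x -> rspan G2 y -> rproj G3 x z -> rproj G3 y z' ->
    ip (fun w => x w - z w) (fun w => y w - z' w) = 0.
  move=> Gx Gy xz yz; have [sx _] := Gx; have [sz _] := xz.1.
  have [sy _] := Gy; have [sz' _] := yz.1.
  rewrite ipBr //; last exact: sqiB.
  by rewrite (h2 x y z) // (xz.2 _ yz.1) subrr.
move=> X Y GX GY; have [LX _] := GX; have [LY _] := GY.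
have [Xr Xi] := (closed_span_complexified X s1).1 GX.
have [Yr Yi] := (closed_span_complexified Y s2).1 GY.
have := orth_proj_complexified s3 LX; have := orth_proj_complexified s3 LY.
move: (orth_proj P _ X) (orth_proj P _ Y) => zx zy /= [yr yi] [xr xi].
have s1' := sqiB Xr.1 xr.1.1; have s2' := sqiB Xi.1 xi.1.1.
have s3' := sqiB Yr.1 yr.1.1; have s4' := sqiB Yi.1 yi.1.1.
rewrite innerE; rewrite ?re_sub ?im_sub //.
by rewrite (h3 _ _ _ _ Xr Yr xr yr) (h3 _ _ _ _ Xi Yi xi yi) (h3 _ _ _ _ Xi Yr xi yr)
  (h3 _ _ _ _ Xr Yi xr yi) addr0 subr0.
Qed.

End complexify.

(** * Expectations of products of independent variables *)

Section indep.
Context d (T : measurableType d) (R : realType) (P : probability T R).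
Implicit Types (X Y : T -> R).

Definition indep2 X Y := forall A B : set R, measurable A -> measurable B ->
  P (X @^-1` A `&` Y @^-1` B) = (P (X @^-1` A) * P (Y @^-1` B))%E.

(** Independence says that the law of the pair is the product of the laws; Fubini does
    the rest. *)
Lemma indep2_ip X Y : measurable_fun setT X -> measurable_fun setT Y -> indep2 X Y ->
  P.-integrable setT (EFin \o X) -> P.-integrable setT (EFin \o Y) ->
  P.-integrable setT (EFin \o (fun w => X w * Y w)) ->
  l2ip P X Y = (\int[P]_w X w) * \int[P]_w Y w.
Proof.
move=> mX mY XY iX iY iXY.
pose X' : {RV P >-> R} := mfun_Sub (mem_set mX).
pose Y' : {RV P >-> R} := mfun_Sub (mem_set mY).
have mZ : measurable_fun setT (fun w => (X w, Y w)) by exact: measurable_fun_pair.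
pose Z' : {RV P >-> (R * R)%type} := mfun_Sub (mem_set mZ).
pose muX := distribution P X'; pose muY := distribution P Y'.
pose m' := distribution P Z'.
have E C : measurable C -> (muX \x muY)%E C = m' C.
  apply: product_measure_unique => A B mA mB.
  exact: XY.
pose f (z : R * R) := (z.1 * z.2)%:E.
have mf : measurable_fun setT f.
  by apply/measurable_EFinP; apply: measurable_funM.
have iff : m'.-integrable setT f.
  exact: integrable_pushforward.
have ifp : (muX \x muY)%E.-integrable setT f.
  apply/integrableP; split => //; rewrite (@eq_measure_integral _ _ _ _ m').
    by case/integrableP: iff.
  by move=> A mA _; exact: E.
have e1 : (\int[m']_z f z = \int[P]_w (X w * Y w)%:E)%E.
  by rewrite integral_pushforward.
have e2 : (\int[muX]_x x%:E = \int[P]_w (X w)%:E)%E.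
  by rewrite integral_pushforward.
have e3 : (\int[muY]_x x%:E = \int[P]_w (Y w)%:E)%E.
  by rewrite integral_pushforward.
rewrite /l2ip /Rintegral -e1 -fineM; try exact: integrable_fin_num.
congr fine; rewrite -(@eq_measure_integral _ _ _ _ m' (muX \x muY)%E); last first.
  by move=> A mA _; exact: E.
rewrite -integral12_prod_meas1 //.
have iY' : muY.-integrable setT EFin by exact: integrable_pushforward.
have iX' : muX.-integrable setT EFin by exact: integrable_pushforward.
rewrite (eq_integral (fun x : R => (x%:E * \int[muY]_y y%:E)%E)); last first.
  by move=> x _; rewrite -integralZl //; apply: eq_integral => y _; rewrite EFinM.
rewrite -e2 -e3 -(fineK (integrable_fin_num measurableT iY')).
by rewrite integralZr.
Qed.

End indep.

(** * Additive functions and independent summands *)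

(** Additivity gives f = 0 at multiples of 1/N, so every value of [f] is already taken
    between 0 and 1/N, where |f| is at most [M] for N large; then n |f t| = |f (n t)| <= M
    for all n. *)
Lemma additive_bounded_eq0 (R : realType) (f : R -> R) (delta M : R) :
  (forall s t : R, 0 <= s -> 0 <= t -> f (s + t) = f s + f t) -> f 1 = 0 ->
  0 < delta -> (forall s : R, 0 <= s -> s <= delta -> `|f s| <= M) ->
  forall t : R, 0 <= t -> f t = 0.
Proof.
move=> fD f1 d0 fM t t0.
have f0 : f 0 = 0 by have := fD 0 0 (lexx _) (lexx _); rewrite addr0; lra.
have fn n s : 0 <= s -> f (n%:R * s) = n%:R * f s.
  move=> s0; elim: n => [|n ih]; first by rewrite !mul0r.
  by rewrite -natr1 !mulrDl !mul1r fD ?ih // mulr_ge0.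
have [N _ hN] := near_infty_natSinv_lt (PosNum d0).
have N0 : 0 < (N.+1%:R : R) by [].
have fN : f N.+1%:R^-1 = 0.
  have := fn N.+1 N.+1%:R^-1; rewrite divff ?gt_eqF // f1 => /(_ _)/esym/eqP.
  by rewrite mulf_eq0 (gt_eqF N0) /= => h; apply/eqP/h; rewrite invr_ge0.
have bn n : n%:R * `|f t| <= M.
  rewrite -[X in X * _](ger0_norm (ler0n R n)) -normrM -fn //.
  pose x := n%:R * t * N.+1%:R; have x0 : 0 <= x by rewrite !mulr_ge0.
  have /andP[q1 q2] := truncn_itv x0; set q := Num.truncn x in q1 q2.
  have -> : n%:R * t = q%:R * N.+1%:R^-1 + (x - q%:R) / N.+1%:R.
    rewrite -mulrDl addrC subrK /x mulfK // gt_eqF //.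
  rewrite fD ?mulr_ge0 ?invr_ge0 ?subr_ge0 // fn ?invr_ge0 // fN mulr0 add0r.
  apply: fM; first by rewrite mulr_ge0 ?invr_ge0 ?subr_ge0.
  apply: (@le_trans _ _ N.+1%:R^-1); last by apply: ltW; exact: hN (leqnn N).
  by rewrite ler_piMl ?invr_ge0 // lerBlDl natr1 ltW.
apply/eqP; rewrite -normr_eq0 eq_le normr_ge0 andbT leNgt; apply/negP => ft0.
have M0 : 0 <= M by have := bn 0%N; rewrite mul0r.
have := bn (Num.bound (M / `|f t|)); rewrite leNgt => /negP; apply.
by rewrite -ltr_pdivrMr //; apply: archi_boundP; rewrite divr_ge0.
Qed.

Section law.
Context d (T : measurableType d) (R : realType) (P : probability T R).
Implicit Types (X Y : T -> R).

Definition same_dist X Y := forall B : set R, measurable B ->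
  P (X @^-1` B) = P (Y @^-1` B).

Lemma same_dist_ge0_integral X Y (f : R -> \bar R) :
  measurable_fun setT X -> measurable_fun setT Y -> same_dist X Y ->
  measurable_fun setT f -> (forall x, 0 <= f x)%E ->
  (\int[P]_w f (X w) = \int[P]_w f (Y w))%E.
Proof.
move=> mX mY XY mf f0.
pose X' : {RV P >-> R} := mfun_Sub (mem_set mX).
pose Y' : {RV P >-> R} := mfun_Sub (mem_set mY).
transitivity (\int[distribution P X']_x f x)%E.
  by rewrite ge0_integral_pushforward.
transitivity (\int[distribution P Y']_x f x)%E.
  by apply: eq_measure_integral => A mA _; exact: XY.
by rewrite ge0_integral_pushforward.
Qed.

Lemma same_dist_sqi X Y :
  measurable_fun setT X -> measurable_fun setT Y -> same_dist X Y ->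
  square_integrable P X -> square_integrable P Y.
Proof.
move=> mX mY XY [_ lX]; split => //.
rewrite -(@same_dist_ge0_integral X Y (fun x => (x ^+ 2)%:E)) //.
- by apply/measurable_EFinP; exact: measurable_funX.
- by move=> x; rewrite lee_fin sqr_ge0.
Qed.

Lemma same_dist_ip X Y : square_integrable P X -> square_integrable P Y ->
  same_dist X Y -> l2ip P X X = l2ip P Y Y.
Proof.
move=> sX sY XY; apply: EFin_inj; rewrite -!sqi_fin //.
apply: (@same_dist_ge0_integral X Y (fun x => (x ^+ 2)%:E)) => //;
  try by [case: sX|case: sY].
- by apply/measurable_EFinP; exact: measurable_funX.
- by move=> x; rewrite lee_fin sqr_ge0.
Qed.

Lemma sqi_cst c : square_integrable P (fun=> c).
Proof.
split => //; rewrite integral_cst //.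
have -> : ((P : {measure set T -> \bar R}) [set: T] = 1)%E by exact: probability_setT.
by rewrite mule1 ltry.
Qed.

Lemma ip_cst1 : l2ip P (fun=> 1) (fun=> 1) = 1.
Proof.
apply: EFin_inj; rewrite -sqi_fin; last exact: sqi_cst.
rewrite expr1n integral_cst // mul1e.
exact: probability_setT.
Qed.

Lemma mean_ip X : \int[P]_w X w = l2ip P X (fun=> 1).
Proof. by apply: eq_Rintegral => w _; rewrite mulr1. Qed.

(** The mean is read off from the second moments of [X] and [X + 1], which reduces the
    signed integrand to nonnegative ones. *)
Lemma same_dist_mean X Y : square_integrable P X -> square_integrable P Y ->
  same_dist X Y -> \int[P]_w X w = \int[P]_w Y w.
Proof.
move=> sX sY XY; have mX := sX.1; have mY := sY.1.
have s1 := sqi_cst 1.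
have XY1 : same_dist (fun w => X w + 1) (fun w => Y w + 1).
  move=> B mB; have mB' : measurable ((fun x : R => x + 1) @^-1` B).
    by rewrite -[X in measurable X]setTI; apply: measurable_funD.
  exact: XY mB'.
have := same_dist_ip (sqiD sX s1) (sqiD sY s1) XY1.
rewrite !ip_sqrD // (same_dist_ip sX sY XY) !mean_ip; lra.
Qed.

Lemma indep2_ge0 X Y (f g : R -> \bar R) :
  measurable_fun setT X -> measurable_fun setT Y -> indep2 P X Y ->
  measurable_fun setT f -> measurable_fun setT g ->
  (forall x, 0 <= f x)%E -> (forall x, 0 <= g x)%E ->
  (\int[P]_w (f (X w) * g (Y w)) = (\int[P]_w f (X w)) * \int[P]_w g (Y w))%E.
Proof.
move=> mX mY XY mf mg f0 g0.
pose X' : {RV P >-> R} := mfun_Sub (mem_set mX).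
pose Y' : {RV P >-> R} := mfun_Sub (mem_set mY).
have mZ : measurable_fun setT (fun w => (X w, Y w)) by exact: measurable_fun_pair.
pose Z' : {RV P >-> (R * R)%type} := mfun_Sub (mem_set mZ).
pose muX := distribution P X'; pose muY := distribution P Y'.
pose m' := distribution P Z'.
have E C : measurable C -> (muX \x muY)%E C = m' C.
  apply: product_measure_unique => A B mA mB.
  exact: XY.
pose h (z : R * R) := (f z.1 * g z.2)%E.
have mh : measurable_fun setT h.
  by apply: emeasurable_funM; apply: measurableT_comp.
have h0 z : (0 <= h z)%E by rewrite mule_ge0.
transitivity (\int[m']_z h z)%E; first by rewrite ge0_integral_pushforward.
transitivity (\int[muX \x muY]_z h z)%E.
  by apply: eq_measure_integral => A mA _; exact/esym/E.
have -> : (\int[P]_w f (X w) = \int[muX]_x f x)%E by rewrite ge0_integral_pushforward.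
have -> : (\int[P]_w g (Y w) = \int[muY]_x g x)%E by rewrite ge0_integral_pushforward.
rewrite fubini_tonelli1 // /fubini_F /h /=.
under eq_integral do rewrite ge0_integralZl //.
by rewrite ge0_integralZr // integral_ge0.
Qed.

(** An independent summand cannot cancel the tails of the other one. If X had infinite second
    moment, then so would X^2 g(Y) with g(y) = 1 / (1 + y^2) by independence, yet
    X^2 <= 2 (X + Y)^2 + 2 Y^2 bounds it by 2 (X + Y)^2 + 2. *)
Lemma indep2_sqi X Y : measurable_fun setT X -> measurable_fun setT Y -> indep2 P X Y ->
  square_integrable P (fun w => X w + Y w) -> square_integrable P X.
Proof.
move=> mX mY XY sXY; split => //.
pose g (y : R) := (1 + y ^+ 2)^-1.
have g0 y : 0 < g y by rewrite invr_gt0 ltr_pwDl // sqr_ge0.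
have mg : measurable_fun setT g.
  apply: continuous_measurable_fun => y; apply: cvgV.
    by rewrite gt_eqF // ltr_pwDl // sqr_ge0.
  by apply: cvgD; [exact: cvg_cst|exact: exprn_continuous].
have := @indep2_ge0 X Y (fun x => (x ^+ 2)%:E) (fun y => (g y)%:E) mX mY XY.
have mX2 : measurable_fun setT (fun x : R => (x ^+ 2)%:E).
  by apply/measurable_EFinP; exact: measurable_funX.
move=> /(_ mX2) H; rewrite ltNge leye_eq; apply/negP => /eqP EX.
have : (\int[P]_w (g (Y w))%:E != 0)%E.
  apply/eqP => Eg0.
  have mgY : measurable_fun setT (fun w => (g (Y w))%:E).
    by apply/measurable_EFinP; exact: measurableT_comp.
  have := (ae_eq_integral_abs P measurableT mgY).1.
  under eq_integral do rewrite gee0_abs ?lee_fin ?ltW ?g0 //.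
  move=> /(_ Eg0)[N [mN N0 hN]].
  have NT : N = setT.
    apply/seteqP; split => // w _; apply: hN => /= /(_ I) [] gw.
    by have := g0 (Y w); rewrite gw ltxx.
  have := probability_setT P; rewrite -NT => PN.
  have : (1%:E = 0 :> \bar R)%E by rewrite -PN -N0.
  by move=> [] /eqP; rewrite oner_eq0.
have Eg_ge : (0 <= \int[P]_w (g (Y w))%:E)%E.
  by apply: integral_ge0 => w _; rewrite lee_fin ltW.
move=> Eg0.
have {}H : (\int[P]_w ((X w) ^+ 2 * g (Y w))%:E = +oo)%E.
  under eq_integral do rewrite EFinM.
  rewrite H; [|exact/measurable_EFinP|by move=> x; rewrite lee_fin sqr_ge0
    |by move=> x; rewrite lee_fin ltW].
  by rewrite EX gt0_mulye // lt_neqAle eq_sym Eg0.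
have s1 := sqi_cst 1.
have iB : P.-integrable setT (EFin \o (fun w => 2 * (X w + Y w) ^+ 2 + 2)).
  apply: (@eq_integrable _ _ _ _ _ measurableT
    ((fun w => 2%:E * ((X w + Y w) ^+ 2)%:E) \+ cst 2%:E)%E) => [w _ //|].
  apply: integrableD => //.
    by apply: integrableZl => //; exact: sqi_integrable_sqr.
  exact: finite_measure_integrable_cst.
have := integrable_lty measurableT iB; apply/negP; rewrite -leNgt -H.
apply: ge0_le_integral => //=.
- by move=> w _; rewrite lee_fin mulr_ge0 ?sqr_ge0 ?ltW.
- apply/measurable_EFinP; apply: measurable_funM; first exact: measurable_funX.
  exact: measurableT_comp.
- by case/integrableP: iB.
- move=> w _; rewrite lee_fin /g ler_pdivrMr; last by rewrite ltr_pwDl // sqr_ge0.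
  have := mulr_ge0 (sqr_ge0 (X w + Y w)) (sqr_ge0 (Y w)); have := sqr_ge0 (X w + 2 * Y w).
  set a := X w; set b := Y w; nra.
Qed.

End law.

(** * Second moments of a real process with stationary independent increments *)

(** Only independence of one increment from the past value, stationarity and tightness near
    time 0 are assumed, so that every linear combination of the coordinates of a
    Levy process qualifies. *)
Section scalar_levy.
Context d (T : measurableType d) (R : realType) (P : probability T R).
Variables (m : R -> T -> R).
Hypothesis mm : forall t : R, 0 <= t -> measurable_fun setT (m t).
Hypothesis m0 : forall w, m 0 w = 0.
Hypothesis m_indep : forall s t : R, 0 < s -> s < t ->
  indep2 P (m s) (fun w => m t w - m s w).
Hypothesis m_stat : forall s h : R, 0 <= s -> 0 <= h ->
  same_dist P (fun w => m (s + h) w - m s w) (m h).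
Hypothesis m_near0 : exists2 delta : R, 0 < delta & forall s : R, 0 <= s -> s <= delta ->
  ((2^-1)%:E <= P [set w | (`|m s w| <= 1)%R])%E.
Hypothesis sm1 : square_integrable P (m 1).
Hypothesis Em1 : \int[P]_w m 1 w = 0.
Notation sqi := (square_integrable P).
Notation E f := (l2ip P f (fun=> 1)).
Notation V f := (l2ip P f f).

Let minc (s t : R) : 0 <= s -> 0 <= t -> measurable_fun setT (fun w => m t w - m s w).
Proof. by move=> s0 t0; apply: measurable_funB; exact: mm. Qed.

(** For t < 1, [m t] is an independent summand of [m 1]; larger times are
    reached by stationary increments of length t / n < 1. *)
Lemma scalar_levy_sqi (t : R) : 0 <= t -> sqi (m t).
Proof.
have m00 : m 0 = fun=> 0 by apply/funext.
have H u : 0 <= u -> u < 1 -> sqi (m u).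
  rewrite le_eqVlt => /predU1P[<- _|u0 u1]; first by rewrite m00; exact: sqi0.
  apply: (@indep2_sqi _ _ _ _ _ (fun w => m 1 w - m u w)).
  - exact: mm (ltW u0).
  - by apply: minc => //; exact: ltW.
  - exact: m_indep.
  - by under eq_fun do rewrite addrC subrK.
move=> t0; pose n := (Num.bound t).+1.
have n0 : 0 < (n%:R : R) by [].
have tn : t < n%:R.
  by apply: lt_trans (archi_boundP t0) _; rewrite ltr_nat.
pose h := t / n%:R; have h0 : 0 <= h by rewrite divr_ge0.
have sh : sqi (m h) by apply: H => //; rewrite ltr_pdivrMr // mul1r.
have sj j : sqi (m (j%:R * h)).
  elim: j => [|j ih]; first by rewrite mul0r m00; exact: sqi0.
  have jh0 : 0 <= j%:R * h by rewrite mulr_ge0.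
  have sd : sqi (fun w => m (j%:R * h + h) w - m (j%:R * h) w).
    apply: same_dist_sqi sh; [exact: mm|by apply: minc => //; rewrite addr_ge0|].
    by move=> B mB; rewrite (m_stat jh0 h0).
  rewrite -natr1 mulrDl mul1r; have := sqiD sd ih.
  by under eq_fun do rewrite subrK.
by have := sj n; rewrite /h mulrC divfK // gt_eqF.
Qed.

Let s1 : sqi (fun=> 1) := sqi_cst P 1.

Let sinc (s t : R) : 0 <= s -> 0 <= t -> sqi (fun w => m t w - m s w).
Proof. by move=> s0 t0; apply: sqiB; exact: scalar_levy_sqi. Qed.

Let Einc (s h : R) : 0 <= s -> 0 <= h -> E (fun w => m (s + h) w - m s w) = E (m h).
Proof.
move=> s0 h0; rewrite -!mean_ip; apply: same_dist_mean; last exact: m_stat.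
- by apply: sinc; rewrite ?addr_ge0.
- exact: scalar_levy_sqi.
Qed.

Let Vinc (s h : R) : 0 <= s -> 0 <= h ->
  V (fun w => m (s + h) w - m s w) = V (m h).
Proof.
move=> s0 h0; apply: same_dist_ip; last exact: m_stat.
- by apply: sinc; rewrite ?addr_ge0.
- exact: scalar_levy_sqi.
Qed.

Lemma sqi_integrable X : sqi X -> P.-integrable setT (EFin \o X).
Proof.
move=> sX; have := sqi_mul sX s1; apply: eq_integrable => // w _.
by rewrite /= mulr1.
Qed.

Lemma indep2_ip_sqi X Y : sqi X -> sqi Y -> indep2 P X Y -> l2ip P X Y = E X * E Y.
Proof.
move=> sX sY XY; rewrite -!mean_ip; apply: indep2_ip => //.
- by case: sX.
- by case: sY.
- exact: sqi_integrable.
- exact: sqi_integrable.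
- exact: sqi_mul.
Qed.

Let var (t : R) := V (m t) - E (m t) ^+ 2.

Let E_add (s t : R) : 0 <= s -> 0 <= t -> E (m (s + t)) = E (m s) + E (m t).
Proof.
move=> s0 t0; rewrite -(Einc s0 t0) ipBl //; [lra| |]; apply: scalar_levy_sqi => //.
exact: addr_ge0.
Qed.

Let var_add (s t : R) : 0 <= s -> 0 <= t -> var (s + t) = var s + var t.
Proof.
have m00 : m 0 = fun=> 0 by apply/funext.
have var0 : var 0 = 0 by rewrite /var m00 !ip0l expr0n /= subr0.
rewrite le_eqVlt => /predU1P[<- _|sp]; first by rewrite var0 !add0r.
rewrite le_eqVlt => /predU1P[<-|tp]; first by rewrite var0 !addr0.
have s0 := ltW sp; have t0 := ltW tp.
have ss := scalar_levy_sqi s0; have sd := sinc s0 (addr_ge0 s0 t0).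
rewrite /var (E_add s0 t0).
have -> : m (s + t) = (fun w => m s w + (m (s + t) w - m s w)).
  by apply/funext => w; ring.
rewrite ip_sqrD //.
rewrite (@indep2_ip_sqi (m s) (fun w => m (s + t) w - m s w)) //; last first.
  by apply: m_indep => //; rewrite ltrDl.
rewrite (Einc s0 t0) (Vinc s0 t0); ring.
Qed.

Let var_ge0 (t : R) : 0 <= t -> 0 <= var t.
Proof.
move=> t0; have := cauchy_schwarz (scalar_levy_sqi t0) s1.
by rewrite ip_cst1 mulr1 /var; lra.
Qed.

Let var_le1 (t : R) : 0 <= t -> t <= 1 -> var t <= var 1.
Proof.
move=> t0 t1; have h0 : 0 <= 1 - t by rewrite subr_ge0.
have := var_add t0 h0; rewrite addrC subrK => ->.
by rewrite lerDl var_ge0.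
Qed.

(** The mean is additive and vanishes at 1, so a bound near 0 suffices. With probability at
    least 1/2 the value is between -1 and 1, whereas the variance is at most that at time 1:
    a large mean would contradict Chebyshev. *)
Let E0 (t : R) : 0 <= t -> E (m t) = 0.
Proof.
have [delta d0 hd] := m_near0.
have d1 : 0 < Num.min delta 1 by rewrite lt_min d0 ltr01.
apply: (@additive_bounded_eq0 _ (fun u => E (m u)) (Num.min delta 1) (4 * var 1 + 5)) => //.
  by rewrite -mean_ip.
move=> s s0; rewrite le_min => /andP[sd s1'].
have ss := scalar_levy_sqi s0; have sE : sqi (fun=> E (m s)) := sqi_cst P _.
have sB := sqiB ss sE.
have Vs : V (fun w => m s w - E (m s)) = var s.
  rewrite ip_sqrB //.
  have -> : (fun=> E (m s)) = (fun w : T => E (m s) * 1) by apply/funext => w; rewrite mulr1.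
  rewrite ip_sqrZ // ipZr // ip_cst1 /var; ring.
have key : E (m s) ^+ 2 <= 4 * var 1 + 4.
  pose A := [set w | `|m s w| <= 1].
  have mA : measurable A.
    have := measurableT_comp (@normr_measurable R setT) (mm s0).
    move=> /(_ measurableT `]-oo, 1]%classic (measurable_itv _)); rewrite setTI => h.
    rewrite (_ : A = (fun w => `|m s w|) @^-1` `]-oo, 1]%classic); first exact: h.
    by apply/seteqP; split => w /=; rewrite in_itv.
  have iA : (\int[P]_w ((E (m s) ^+ 2) * \1_A w)%:E <=
      \int[P]_w (2 * (m s w - E (m s)) ^+ 2 + 2)%:E)%E.
    have mB : measurable_fun setT (fun w => (m s w - E (m s)) ^+ 2).
      by apply: measurable_funX; case: sB.
    apply: ge0_le_integral => //=.
    - by move=> w _; rewrite lee_fin mulr_ge0 ?sqr_ge0 // indicE.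
    - by apply/measurable_EFinP; apply: measurable_funM => //; exact: measurable_indic.
    - apply/measurable_EFinP; apply: measurable_funD => //.
      exact: measurable_funM.
    - move=> w _; rewrite lee_fin indicE; have [|_] := boolP (w \in A); last first.
        by rewrite mulr0 addr_ge0 // mulr_ge0 // sqr_ge0.
      rewrite inE /A /= => mw; rewrite mulr1.
      have : m s w ^+ 2 <= 1 by rewrite -real_normK ?num_real // expr_le1.
      have := sqr_ge0 (2 * m s w - E (m s)); set a := m s w; set b := E _; nra.
  move: iA; under eq_integral do rewrite EFinM.
  rewrite ge0_integralZl_EFin ?sqr_ge0 //=; last first.
    by apply/measurable_EFinP; exact: measurable_indic.
  rewrite integral_indic // setIT.
  under [X in (_ <= X)%E]eq_integral do rewrite EFinD EFinM.
  rewrite ge0_integralD //=; last 2 first.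
    by move=> w _; rewrite lee_fin mulr_ge0 // sqr_ge0.
    apply: emeasurable_funM => //; apply/measurable_EFinP; apply: measurable_funX.
    by case: sB.
  rewrite ge0_integralZl_EFin //=; last 2 first.
    by move=> w _; rewrite lee_fin sqr_ge0.
    by apply/measurable_EFinP; apply: measurable_funX; case: sB.
  rewrite sqi_fin // Vs integral_cst //.
  have -> : ((P : {measure set T -> \bar R}) [set: T] = 1)%E by exact: probability_setT.
  rewrite mule1 -EFinM -EFinD => iA.
  have hA : ((E (m s) ^+ 2 / 2)%:E <= (2 * var s + 2)%:E)%E.
    apply: le_trans iA; rewrite EFinM; apply: lee_wpmul2l; first by rewrite lee_fin sqr_ge0.
    exact: hd.
  move: hA; rewrite lee_fin; have := var_le1 s0 s1'; lra.
rewrite ler_norml; have := var_ge0 ler01; move: key; set a := E _; nra.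
Qed.

Lemma scalar_levy_mean (t : R) : 0 <= t -> \int[P]_w m t w = 0.
Proof. by move=> t0; rewrite mean_ip E0. Qed.

(** The variance is additive, and up to time 1 it is between 0 and its value at 1;
    its difference with the linear function is therefore additive, bounded near 0 and zero
    at 1. *)
Lemma scalar_levy_var (t : R) : 0 <= t -> l2ip P (m t) (m t) = t * l2ip P (m 1) (m 1).
Proof.
move=> t0; have VE u : 0 <= u -> V (m u) = var u by move=> u0; rewrite /var E0 // expr0n subr0.
rewrite !VE //; apply/eqP; rewrite -subr_eq0; apply/eqP.
apply: (@additive_bounded_eq0 _ (fun u => var u - u * var 1) 1 (2 * var 1)) t0 => //.
- by move=> u v u0 v0; rewrite var_add //; ring.
- by rewrite mul1r subrr.
- move=> u u0 u1; have := var_ge0 u0; have := var_ge0 ler01; have := var_le1 u0 u1.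
  rewrite ler_norml; nra.
Qed.

End scalar_levy.

(** * Second moments of a one-sided Levy process *)

Section ae.
Context d (T : measurableType d) (R : realType) (P : probability T R).
Notation sqi := (square_integrable P).
Implicit Types f g h : T -> R.

Lemma sqi_ae f g : measurable_fun setT g -> {ae P, forall w, f w = g w} -> sqi f -> sqi g.
Proof.
move=> mg fg [mf lf]; split => //.
rewrite (ae_eq_integral (fun w => (f w ^+ 2)%:E)) //.
- by apply/measurable_EFinP; exact: measurable_funX.
- by apply/measurable_EFinP; exact: measurable_funX.
- by apply: filterS fg => w fg _; rewrite fg.
Qed.

Lemma ip_ae f g h : sqi f -> sqi g -> sqi h -> {ae P, forall w, f w = g w} ->
  l2ip P f h = l2ip P g h.
Proof.
move=> sf sg sh fg; rewrite /l2ip /Rintegral; congr fine; apply: ae_eq_integral => //.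
- by case/integrableP: (sqi_mul sf sh).
- by case/integrableP: (sqi_mul sg sh).
- by apply: filterS fg => w fg _; rewrite fg.
Qed.

Lemma ip_null_eq f g h : sqi f -> sqi g -> sqi h ->
  l2ip P (fun w => f w - g w) (fun w => f w - g w) = 0 -> l2ip P f h = l2ip P g h.
Proof.
by move=> sf sg sh /(ip_null (sqiB sf sg) sh); rewrite ipBl // => /eqP; rewrite subr_eq0 => /eqP.
Qed.

End ae.

Section cyl.
Context d (T : measurableType d) (R : realType) (P : probability T R).

Lemma cylinders_lincomb (I : Type) (D : set I) (J : eqType) (s : seq J) (c : J -> R) (h : J -> I)
    (B : set R) : (forall j, D (h j)) -> measurable B ->
  <<s cylinders D >> [set x : I -> R | B (\sum_(j <- s) c j * x (h j))].
Proof.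
move=> Dh mB.
pose S := g_sigma_algebraType (@cylinders R I D).
have mp j : measurable_fun [set: S] (fun x : S => (x : I -> R) (h j)).
  move=> _ C mC; rewrite setTI; apply: sub_gen_smallest.
  by exists (h j); split => //; exists C.
have mS : measurable_fun [set: S] (fun x : S => \sum_(j <- s) c j * (x : I -> R) (h j)).
  by apply: measurable_sum => j; apply: measurable_funM.
by have := mS measurableT B mB; rewrite setTI.
Qed.

Lemma sigma_family_lincomb (I : Type) (D : set I) (X : I -> T -> R) (J : eqType) (s : seq J)
    (c : J -> R) (h : J -> I) (B : set R) : (forall j, D (h j)) -> measurable B ->
  sigma_family D X [set w | B (\sum_(j <- s) c j * X (h j) w)].
Proof.
move=> Dh mB.
pose G := [set E | exists i, D i /\ exists2 B : set R, measurable B & E = X i @^-1` B].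
pose S := g_sigma_algebraType G.
have mp j : measurable_fun [set: S] (fun x : S => X (h j) (x : T)).
  move=> _ C mC; rewrite setTI; apply: sub_gen_smallest.
  by exists (h j); split => //; exists C.
have mS : measurable_fun [set: S] (fun x : S => \sum_(j <- s) c j * X (h j) (x : T)).
  by apply: measurable_sum => j; apply: measurable_funM.
by have := mS measurableT B mB; rewrite setTI.
Qed.

End cyl.

Section levy.
Context d (T : measurableType d) (R : realType) (P : probability T R) (k : nat).
Variable L : R -> 'I_k -> T -> R.
Hypothesis HL : is_levy P L.
Notation sqi := (square_integrable P).
Hypothesis sL1 : forall i, sqi (L 1 i).
Hypothesis EL1 : forall i, \int[P]_w L 1 i w = 0.

(** Subtracting [L 0], which is null only almost surely, makes the combination exactly zero
    at time 0 and an exact combination of increments. *)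
Let mc (c : 'I_k -> R) (t : R) (w : T) := \sum_i c i * (L t i w - L 0 i w).

Let mL (t : R) i : 0 <= t -> measurable_fun setT (L t i).
Proof. by move=> t0; case: HL => -[h _] _ _ _ _; exact: h. Qed.

Let L0 : {ae P, forall w, forall i, L 0 i w = 0}.
Proof. by case: HL => -[_ h]. Qed.

Let mcB c s t w : mc c t w - mc c s w = \sum_i c i * increment L s t i w.
Proof.
rewrite /mc -sumrB; apply: eq_bigr => i _; rewrite /increment; ring.
Qed.

Let mmc c (t : R) : 0 <= t -> measurable_fun setT (mc c t).
Proof.
move=> t0; apply: measurable_sum => i; apply: measurable_funM => //.
by apply: measurable_funB; exact: mL.
Qed.

Let mc_indep c c' (s t : R) : 0 < s -> s < t ->
  indep2 P (mc c s) (fun w => mc c' t w - mc c' s w).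
Proof.
move=> s0 st A B mA mB; case: HL => _ hI _ _ _.
(* The independence axiom is stated for infinite increasing sequences of times, hence the tail. *)
pose tt n : R := match n with 0%N => 0 | 1%N => s | n.+2 => t + n%:R end.
pose E n := match n with 0%N => mc c s @^-1` A
  | 1%N => (fun w => mc c' t w - mc c' s w) @^-1` B | _ => setT end.
have := hI 2%N tt E (lexx _).
have -> : \bigcap_(m in `I_2) E m = E 0%N `&` E 1%N.
  apply/seteqP; split => w h; first by split; exact: h.
  by case=> [_|[_|//]]; case: h.
rewrite big_ord_recl big_ord1 /= => -> //.
  case=> [//|[|n]]; rewrite ?addr0 //= ?ltrD2l ?ltr_nat //.
case=> [|[|//]] _ /=.
  have := @sigma_family_lincomb _ _ R _ setT (increment L 0 s) _ (index_enum 'I_k) c id A (fun=> I) mA.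
  exact.
rewrite addr0; have := @sigma_family_lincomb _ _ R _ setT (increment L s t) _ (index_enum 'I_k) c' id B (fun=> I) mB.
by congr (sigma_family _ _ _); apply/seteqP; split => w /=; rewrite mcB.
Qed.

Let mc_stat c (s h : R) : 0 <= s -> 0 <= h ->
  same_dist P (fun w => mc c (s + h) w - mc c s w) (mc c h).
Proof.
move=> s0 h0 B mB; case: HL => _ _ hS _ _.
have := hS s h s0 h0 _ (@cylinders_lincomb R _ setT _ (index_enum 'I_k) c id B (fun=> I) mB).
rewrite (_ : _ @^-1` B = [set w | B (\sum_j c j * increment L s (s + h) j w)]) //.
by apply/seteqP; split => w /=; rewrite mcB.
Qed.

(** Continuity in probability at 0 of the Euclidean norm controls every linear combination,
    the threshold being 1 / (1 + l1 norm of the coefficients). *)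
Let mc_near0 c : exists2 delta : R, 0 < delta & forall s : R, 0 <= s -> s <= delta ->
  ((2^-1)%:E <= P [set w | (`|mc c s w| <= 1)%R])%E.
Proof.
case: HL => _ _ _ hC _.
pose C : R := \sum_i `|c i| + 1; have C0 : 0 < (C : R) by rewrite ltr_wpDl // sumr_ge0.
have e0 : 0 < C^-1 by rewrite invr_gt0.
have := hC 0 C^-1 (lexx _) e0.
move=> /fine_cvgP[_ h].
have h2 : 0 < (2^-1 : R) by [].
have h3 : nbhs (0 : R) (fun s : R => 0 <= s -> fine (P [set w | C^-1 <
    Num.sqrt (\sum_(i < k) (L s i w - L 0 i w) ^+ 2)]) < 2^-1).
  by have := cvgr_lt _ h _ h2; apply; exact: within_filter.
have [delta /= d0 hd] := (nbhs_ballP (0 : R) _).1 h3.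
exists (delta / 2); first by rewrite divr_gt0.
move=> s s0 sd.
have {}hd : fine (P [set w | C^-1 < Num.sqrt (\sum_(i < k) (L s i w - L 0 i w) ^+ 2)]) < 2^-1.
  apply: hd => //=; rewrite /ball /= sub0r normrN ger0_norm //; lra.
set N := [set w | _] in hd.
have mN : measurable N.
  pose f w := \sum_(i < k) (L s i w - L 0 i w) ^+ 2.
  have mf : measurable_fun setT f.
    apply: measurable_sum => i; apply: measurable_funX.
    by apply: measurable_funB; exact: mL.
  rewrite (_ : N = f @^-1` `]C^-1 ^+ 2, +oo[%classic).
    by rewrite -[X in measurable X]setTI; exact: mf.
  apply/seteqP; split => w; rewrite /N /= in_itv /= andbT -/(f w) => h1.
    rewrite -(sqr_sqrtr (_ : 0 <= f w)); last by apply: sumr_ge0 => i _; exact: sqr_ge0.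
    by rewrite ltrXn2r // ltW.
  by rewrite -[X in X < _]ger0_norm ?ltW // -sqrtr_sqr ltr_sqrt // (lt_trans _ h1) // exprn_gt0.
have NC : ~` N `<=` [set w | `|mc c s w| <= 1].
  move=> w /negP; rewrite -leNgt => wN /=.
  have hi i : `|L s i w - L 0 i w| <= C^-1.
    apply: le_trans wN; rewrite -sqrtr_sqr ler_sqrt; last first.
      by apply: sumr_ge0 => j _; exact: sqr_ge0.
    by rewrite (bigD1 i) //= lerDl sumr_ge0 // => j _; exact: sqr_ge0.
  apply: (le_trans (ler_norm_sum _ _ _)).
  apply: (@le_trans _ _ (\sum_i `|c i| * C^-1)).
    by apply: ler_sum => i _; rewrite normrM ler_wpM2l.
  by rewrite -mulr_suml ler_pdivrMr // mul1r /C lerDl.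
apply: (@le_trans _ _ (P (~` N))); last first.
  apply: le_measure NC; rewrite inE; first exact: measurableC.
  have := measurableT_comp (@normr_measurable R setT) (mmc c s0).
  move=> /(_ measurableT `]-oo, 1]%classic (measurable_itv _)); rewrite setTI => hh.
  rewrite (_ : [set w | _] = (fun w => `|mc c s w|) @^-1` `]-oo, 1]%classic); first exact: hh.
  by apply/seteqP; split => w /=; rewrite in_itv.
rewrite probability_setC // -(fineK (fin_num_measure P N mN)) -EFinB lee_fin.
by move: hd; rewrite -/N; lra.
Qed.

Let sM1 i : sqi (fun w => L 1 i w - L 0 i w).
Proof.
apply: sqi_ae (sL1 i); first by apply: measurable_funB; exact: mL.
by apply: filterS L0 => w ->; rewrite subr0.
Qed.

Let smc1 c : sqi (mc c 1).
Proof. by apply: sqi_sum => i; apply: sqiZ. Qed.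

Let Emc1 c : \int[P]_w mc c 1 w = 0.
Proof.
have s1 := sqi_cst P 1.
rewrite mean_ip ip_suml //; last by move=> i; exact: sqiZ.
apply: big1 => i _; rewrite ipZl // (ip_ae (g := L 1 i)) //.
  by rewrite -mean_ip EL1 mulr0.
by apply: filterS L0 => w ->; rewrite subr0.
Qed.

Let mc0 c w : mc c 0 w = 0.
Proof. by rewrite /mc big1 // => i _; rewrite subrr mulr0. Qed.

Let smc c (t : R) : 0 <= t -> sqi (mc c t).
Proof.
apply: scalar_levy_sqi; [exact: mmc|exact: mc0|move=> *; exact: mc_indep|exact: mc_stat|exact: smc1].
Qed.

Let mc_var c (t : R) : 0 <= t -> l2ip P (mc c t) (mc c t) = t * l2ip P (mc c 1) (mc c 1).
Proof.
apply: scalar_levy_var; [exact: mmc|exact: mc0|move=> *; exact: mc_indep|exact: mc_stat|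
  exact: mc_near0|exact: smc1|exact: Emc1].
Qed.

Let mc_mean c (t : R) : 0 <= t -> l2ip P (mc c t) (fun=> 1) = 0.
Proof.
rewrite -mean_ip; apply: scalar_levy_mean; [exact: mmc|exact: mc0|move=> *; exact: mc_indep|exact: mc_stat|
  exact: mc_near0|exact: smc1|exact: Emc1].
Qed.

Let dl (i j : 'I_k) : R := (i == j)%:R.

Let mc_dl i t w : mc (dl i) t w = L t i w - L 0 i w.
Proof.
rewrite /mc (bigD1 i) //= /dl eqxx mul1r big1 ?addr0 // => j ji.
by rewrite eq_sym (negbTE ji) mul0r.
Qed.

Let mcD c c' t w : mc (fun i => c i + c' i) t w = mc c t w + mc c' t w.
Proof. by rewrite /mc -big_split; apply: eq_bigr => i _ /=; rewrite mulrDl. Qed.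

(** Polarization of the variance. *)
Let mc_cov1 c c' (t : R) : 0 <= t ->
  l2ip P (mc c t) (mc c' t) = t * l2ip P (mc c 1) (mc c' 1).
Proof.
move=> t0; have := mc_var (fun i => c i + c' i) t0.
have E u : mc (fun i => c i + c' i) u = (fun w => mc c u w + mc c' u w).
  by apply/funext => w; exact: mcD.
rewrite !E !ip_sqrD //; try exact: smc.
rewrite (mc_var c t0) (mc_var c' t0); lra.
Qed.

Let mc_cov c c' (s t : R) : 0 <= s -> s <= t ->
  l2ip P (mc c s) (mc c' t) = s * l2ip P (mc c 1) (mc c' 1).
Proof.
move=> s0; rewrite le_eqVlt => /predU1P[<-|st]; first exact: mc_cov1.
have t0 : 0 <= t by lra.
move: s0; rewrite le_eqVlt => /predU1P[<-|sp].
  have -> : mc c 0 = fun=> 0 by apply/funext => w; exact: mc0.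
  by rewrite ip0l mul0r.
have s0 := ltW sp; have ss := smc c s0; have ss' := smc c' s0; have st' := smc c' t0.
have -> : mc c' t = (fun w => mc c' s w + (mc c' t w - mc c' s w)).
  by apply/funext => w; ring.
rewrite ipDr //; last exact: sqiB.
rewrite mc_cov1 // (@indep2_ip_sqi _ _ _ _ (mc c s) (fun w => mc c' t w - mc c' s w)) //;
  [|exact: sqiB|exact: mc_indep].
by rewrite mc_mean // mul0r addr0.
Qed.

Let L_ae i (t : R) : {ae P, forall w, mc (dl i) t w = L t i w}.
Proof. by apply: filterS L0 => w h; rewrite mc_dl h subr0. Qed.

Lemma levy_sqi i (t : R) : 0 <= t -> sqi (L t i).
Proof. by move=> t0; apply: sqi_ae (L_ae i t) (smc _ t0); exact: mL. Qed.

Lemma levy_mean i (t : R) : 0 <= t -> l2ip P (L t i) (fun=> 1) = 0.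
Proof.
move=> t0; rewrite -(ip_ae _ _ _ (L_ae i t)) ?mc_mean //;
  [exact: smc|exact: levy_sqi|exact: sqi_cst].
Qed.

Lemma levy_cov i j (s t : R) : 0 <= s -> 0 <= t ->
  l2ip P (L s i) (L t j) = Num.min s t * l2ip P (L 1 i) (L 1 j).
Proof.
have E (u v : R) a b : 0 <= u -> 0 <= v ->
    l2ip P (L u a) (L v b) = l2ip P (mc (dl a) u) (mc (dl b) v).
  move=> u0 v0; have su := smc (dl a) u0; have sv := smc (dl b) v0.
  have su' := levy_sqi a u0; have sv' := levy_sqi b v0.
  by rewrite (ip_ae su su' sv (L_ae a u)) ipC [RHS]ipC (ip_ae sv sv' su' (L_ae b v)).
have H i' j' (u v : R) : 0 <= u -> u <= v ->
    l2ip P (L u i') (L v j') = u * l2ip P (L 1 i') (L 1 j').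
  move=> u0 uv; have v0 := le_trans u0 uv.
  rewrite (E u v i' j' u0 v0) (E 1 1 i' j' ler01 ler01); exact: mc_cov.
move=> s0 t0; have [st|ts] := leP s t; first exact: H.
by rewrite ipC (H _ _ _ _ t0 (ltW ts)) (ipC P (L 1 j)).
Qed.

End levy.

(** * Second moments of a two-sided Levy process *)

(** The covariance kernel of two-sided Brownian motion. *)
Definition levy_kappa (R : realType) (s t : R) : R :=
  if (0 <= s) && (0 <= t) then Num.min s t
  else if (s < 0) && (t < 0) then Num.min (- s) (- t) else 0.

(** In this form the second difference over a rectangle of times simplifies without
    distinguishing signs. *)
Lemma levy_kappaE (R : realType) (s t : R) : levy_kappa s t = (`|s| + `|t| - `|s - t|) / 2.
Proof.
rewrite /levy_kappa; case: (ger0P s) => s0; case: (ger0P t) => t0;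
  case: (ger0P (s - t)) => st /=; rewrite /Order.min; try lra.
- by case: ltP; lra.
- by case: ltP; lra.
- by rewrite ltrN2; case: ltP; lra.
- by rewrite ltrN2; case: ltP; lra.
Qed.

Section two_sided.
Context d (T : measurableType d) (R : realType) (P : probability T R) (k : nat).
Variable L : R -> 'I_k -> T -> R.
Hypothesis HL : is_two_sided_levy P L.
Hypothesis HC : centered_sq_integrable P L.
Notation sqi := (square_integrable P).

Let mL (t : R) i : measurable_fun setT (L t i).
Proof. by case: HL. Qed.

Let sL1 i : sqi (L 1 i).
Proof.
case: HC => _ h; split; first exact: mL.
apply: le_lt_trans h; apply: ge0_le_integral => //=.
- by move=> w _; rewrite lee_fin sqr_ge0.
- by apply/measurable_EFinP; exact: measurable_funX.
- by apply/measurable_EFinP; apply: measurable_sum => j; exact: measurable_funX.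
- move=> w _; rewrite lee_fin (bigD1 i) //= lerDl.
  by apply: sumr_ge0 => j _; exact: sqr_ge0.
Qed.

Let EL1 i : l2ip P (L 1 i) (fun=> 1) = 0.
Proof.
case: HC => /(_ i) h _; rewrite -mean_ip /Rintegral.
by move: h; rewrite unlock => ->.
Qed.

(** Both halves have the covariance min(s, t) S, the second one because it has the law of
    the first, and they are uncorrelated because they are independent and centred. *)
Lemma two_sided_second_order : (forall t i, sqi (L t i)) /\
  forall i j s t, l2ip P (L s i) (L t j) = levy_kappa s t * SigmaL P L i j.
Proof.
case: HL => _ [L1 [L2 [[H1 H2] HS HI HT]]].
have SE i j : SigmaL P L i j = l2ip P (L 1 i) (L 1 j) by rewrite mxE.
have m1 (t : R) i : 0 <= t -> measurable_fun setT (L1 t i).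
  by move=> t0; case: H1 => -[h _] _ _ _ _; exact: h.
have m2 (t : R) i : 0 <= t -> measurable_fun setT (L2 t i).
  by move=> t0; case: H2 => -[h _] _ _ _ _; exact: h.
have a1 (t : R) i : 0 <= t -> {ae P, forall w, L t i w = L1 t i w}.
  by move=> t0; apply: filterS HT => w /(_ i)[h _]; exact: h.
have s11 i : sqi (L1 1 i) by apply: sqi_ae (a1 1 i _) (sL1 i) => //; exact: m1.
have s1c := sqi_cst P 1.
have E11 i : \int[P]_w L1 1 i w = 0.
  by rewrite mean_ip -(ip_ae (sL1 i) (s11 i) s1c (a1 1 i ler01)) EL1.
have C11 i j : l2ip P (L1 1 i) (L1 1 j) = SigmaL P L i j.
  rewrite SE (ip_ae (sL1 i) (s11 i) (sL1 j) (a1 1 i ler01)) ipC [RHS]ipC.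
  by rewrite (ip_ae (sL1 j) (s11 j) (s11 i) (a1 1 j ler01)).
have sd i j (c c' : R) : same_dist P (fun w => c * L1 1 i w + c' * L1 1 j w)
    (fun w => c * L2 1 i w + c' * L2 1 j w).
  move=> B mB.
  pose h (b : bool) : R * 'I_k := (1, if b then i else j).
  pose cc (b : bool) := if b then c else c'.
  have Dh b : @nonneg_times R k (h b) by rewrite /nonneg_times /=.
  have := HS _ (@cylinders_lincomb R _ (@nonneg_times R k) _ [:: true; false] cc h B Dh mB).
  rewrite /preimage /=; under eq_fun do rewrite !big_cons big_nil /= addr0.
  by under [X in _ = P X -> _]eq_fun do rewrite !big_cons big_nil /= addr0.
have s21 i : sqi (L2 1 i).
  apply: (@same_dist_sqi _ _ _ _ (L1 1 i)) => //; [exact: m1|exact: m2|].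
  have := sd i i 1 0.
  under eq_fun do rewrite mul1r mul0r addr0.
  by under [X in same_dist _ _ X -> _]eq_fun do rewrite mul1r mul0r addr0.
have E21 i : \int[P]_w L2 1 i w = 0.
  rewrite -(E11 i); apply/esym; apply: same_dist_mean => //.
  have := sd i i 1 0.
  under eq_fun do rewrite mul1r mul0r addr0.
  by under [X in same_dist _ _ X -> _]eq_fun do rewrite mul1r mul0r addr0.
have C21 i j : l2ip P (L2 1 i) (L2 1 j) = SigmaL P L i j.
  have V c c' : l2ip P (fun w => c * L1 1 i w + c' * L1 1 j w) (fun w => c * L1 1 i w + c' * L1 1 j w) =
      l2ip P (fun w => c * L2 1 i w + c' * L2 1 j w) (fun w => c * L2 1 i w + c' * L2 1 j w).
    by apply: same_dist_ip; [apply: sqiD; exact: sqiZ|apply: sqiD; exact: sqiZ|exact: sd].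
  rewrite -C11; have := V 1 1; have := V 1 0; have := V 0 1.
  by rewrite !ip_sqrD ?ip_sqrZ ?ipZl ?ipZr //; try exact: sqiZ; lra.
have sL1' i (t : R) : 0 <= t -> sqi (L1 t i) by exact: (levy_sqi H1).
have sL2' i (t : R) : 0 <= t -> sqi (L2 t i) by exact: (levy_sqi H2).
have cL1 i j (s t : R) : 0 <= s -> 0 <= t ->
    l2ip P (L1 s i) (L1 t j) = Num.min s t * SigmaL P L i j.
  by move=> s0 t0; rewrite (levy_cov H1 s11 E11) // C11.
have cL2 i j (s t : R) : 0 <= s -> 0 <= t ->
    l2ip P (L2 s i) (L2 t j) = Num.min s t * SigmaL P L i j.
  by move=> s0 t0; rewrite (levy_cov H2 s21 E21) // C21.
have c12 i j (s t : R) : 0 <= s -> 0 <= t -> l2ip P (L1 s i) (L2 t j) = 0.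
  move=> s0 t0; rewrite indep2_ip_sqi; [|exact: sL1'|exact: sL2'|].
    by rewrite (levy_mean H1 s11 E11) // mul0r.
  move=> A B mA mB; apply: HI.
    apply: sub_gen_smallest; exists (s, i); split => //.
    by exists A.
  apply: sub_gen_smallest; exists (t, j); split => //.
  by exists B.
(* [L t] is the limit of - L2 along times increasing to -t; by Fatou its distance to
   - L2 (-t) in mean square is at most the limit of the variances of increments over
   shrinking intervals, which is 0. *)
have neg i (t : R) : t < 0 -> sqi (L t i) /\
    l2ip P (fun w => L t i w - (- L2 (- t) i w)) (fun w => L t i w - (- L2 (- t) i w)) = 0.
  move=> t0; have nt0 : 0 <= - t by lra.
  pose h n : R := - t * n.+2%:R^-1.
  have n1 n : 0 < (n.+2%:R^-1 : R) < 1.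
    by rewrite invr_gt0 ltr0n /= invf_lt1 // ltr1n.
  have sn n : 0 <= - t - h n by rewrite /h; have /andP[] := n1 n; move: (_^-1) => q; nra.
  pose f w := L t i w - (- L2 (- t) i w).
  pose v n w := - L2 (- t - h n) i w - (- L2 (- t) i w).
  have sv n : sqi (v n) by apply: sqiB; apply: sqiN; exact: sL2'.
  have mf : measurable_fun setT f.
    by apply: measurable_funB => //; apply: measurableT_comp => //; exact: m2.
  have vv n : (\int[P]_w (v n w ^+ 2)%:E = (h n * SigmaL P L i i)%:E)%E.
    rewrite sqi_fin //; congr EFin.
    rewrite /v ip_sqrB; [|by apply: sqiN; exact: sL2'|by apply: sqiN; exact: sL2'].
    have hn : 0 <= h n by rewrite /h mulr_ge0 // invr_ge0.
    rewrite !ipNl; try (by [exact: sL2'|apply: sqiN; exact: sL2']).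
    rewrite ![l2ip P (L2 _ _) (fun w => - _)]ipC !ipNl; try (by [exact: sL2']).
    rewrite !cL2 // minxx minxx min_r; [ring|lra].
  have vf : {ae P, forall w, v n w @[n --> \oo] --> f w}.
    apply: filterS HT => w /(_ i)[_ /(_ t t0) hl].
    apply: cvgB; last exact: cvg_cst.
    suff : L2 (- t - h n) i w @[n --> \oo] --> - L t i w.
      by move/cvgN; rewrite opprK.
    apply: (cvg_at_leftP _ _ _).1 hl _ _; split.
      by move=> n; rewrite ltrBlDr ltrDl /h mulr_gt0 // oppr_gt0.
    rewrite -[X in _ --> X]subr0; apply: cvgB; first exact: cvg_cst.
    rewrite -[X in _ --> X](mulr0 (- t)); apply: cvgMr.
    have := @cvg_harmonic R; rewrite -(@cvg_shiftS R^o (@harmonic R)).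
    exact.
  have fe (e : R) : 0 < e -> (\int[P]_w (f w ^+ 2)%:E <= e%:E)%E.
    move=> e0.
    have S0 : 0 <= SigmaL P L i i by rewrite SE ip_ge0.
    have e1 : 0 < e / (- t * SigmaL P L i i + 1).
      by rewrite divr_gt0 // ltr_wpDl // mulr_ge0.
    have [M hM] := small_natSinv e1.
    apply: (@fatou_sqr _ _ _ P (fun n => v (n + M)%N)) => //.
    - by move=> n; case: (sv (n + M)%N).
    - apply: filterS vf => w vf.
      by have := vf; rewrite -(@cvg_shiftn M R^o (v ^~ w)).
    - move=> n; rewrite vv lee_fin /h.
      have := hM (n + M).+1 _; rewrite -addSn leq_addl => /(_ isT).
      rewrite ler_pdivlMr ?ltr_wpDl ?mulr_ge0 //.
      have n0 : 0 <= (n + M).+2%:R^-1 :> R by rewrite invr_ge0.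
      rewrite -addSn; move: n0; rewrite -!addSn; move: (_%:R^-1) => q q0; nra.
  have sf : sqi f by split => //; apply: (le_lt_trans (fe 1 ltr01)); exact: ltry.
  split.
    have -> : L t i = (fun w => f w + - L2 (- t) i w) by apply/funext => w; rewrite /f; ring.
    by apply: sqiD => //; apply: sqiN; exact: sL2'.
  apply/eqP; rewrite eq_le ip_ge0 andbT; apply/ler_addgt0Pl => e e0; rewrite addr0.
  by have := fe e e0; rewrite sqi_fin.
pose L' (t : R) i w := if 0 <= t then L1 t i w else - L2 (- t) i w.
have sL' t i : sqi (L' t i).
  rewrite /L'; have [t0|t0] := leP 0 t; first exact: sL1'.
  by apply: sqiN; apply: sL2'; lra.
have sL t i : sqi (L t i).
  have [t0|t0] := leP 0 t; last by have [] := neg i t t0.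
  apply: sqi_ae (sL1' i t t0); first exact: mL.
  by apply: filterS (a1 t i t0) => w ->.
have LL' t i g : sqi g -> l2ip P (L t i) g = l2ip P (L' t i) g.
  move=> sg; have := sL' t i; rewrite /L'; have [t0|t0] := leP 0 t => s'.
    by apply: ip_ae => //; exact: a1.
  by apply: ip_null_eq => //; have [] := neg i t t0.
split => // i j s t; rewrite LL' // ipC LL' // ipC /L' /levy_kappa.
have [s0|s0] := leP 0 s; have [t0|t0] := leP 0 t => /=.
- exact: cL1.
- by rewrite ipC ipNl ?(ipC P (L2 _ _)) ?c12 ?oppr0 ?mul0r //; [lra|apply: sL2'; lra|exact: sL1'].
- by rewrite ipNl ?(ipC P (L2 _ _)) ?c12 ?oppr0 ?mul0r //; [lra|apply: sL2'; lra|exact: sL1'].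
- have s1' : 0 <= - s by lra.
  have t1' : 0 <= - t by lra.
  have a2 := sL2' i _ s1'; have a3 := sL2' j _ t1'.
  by rewrite ipNl ?(ipC P (L2 _ _)) ?ipNl ?opprK ?(ipC P (L2 _ j)) ?cL2 //; exact: sqiN.
Qed.

End two_sided.

Section increments.
Context d (T : measurableType d) (R : realType) (P : probability T R) (k : nat).
Variable L : R -> 'I_k -> T -> R.
Hypothesis HL : is_two_sided_levy P L.
Hypothesis HC : centered_sq_integrable P L.

Lemma increment_sqi s t i : square_integrable P (increment L s t i).
Proof.
have [sL _] := two_sided_second_order HL HC.
exact: sqiB.
Qed.

(** The right-hand factor is the length of the intersection of the two intervals: this is
    the isometry on indicator functions. *)
Lemma increment_ip s t s' t' i j : s <= t -> s' <= t' ->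
  l2ip P (increment L s t i) (increment L s' t' j) =
  Num.max 0 (Num.min t t' - Num.max s s') * SigmaL P L i j.
Proof.
have [sL cL] := two_sided_second_order HL HC => st st'.
rewrite /increment ipBl ?ipBr //; try exact: sqiB.
rewrite !cL -!mulrBl; congr (_ * _); rewrite !levy_kappaE.
have Ele (x y : R) : x <= y -> `|x - y| = y - x by move=> xy; rewrite ler0_norm; lra.
have Ege (x y : R) : y <= x -> `|x - y| = x - y by move=> xy; rewrite ger0_norm; lra.
have Emax (x y : R) : Num.max 0 (x - y) = (x - y + `|x - y|) / 2.
  by case: (ger0P (x - y)) => h; lra.
have st3 : s' <= s -> s' <= t by move=> h; exact: le_trans st.
have st4 : s <= s' -> s <= t' by move=> h; exact: le_trans st'.
rewrite Emax; have [h1|/ltW h1] := leP t t'; have [h2|/ltW h2] := leP s s'.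
- by rewrite (Ele t t') // (Ele s s') // (Ele s t') ?st4 //; lra.
- by rewrite (Ele t t') // (Ege s s') // (Ege t s') ?st3 // (Ele s t') ?(le_trans st) // (Ege t s) //; lra.
- by rewrite (Ege t t') // (Ele s s') // (Ege t s') ?(le_trans st') // (Ele s t') ?st4 // (Ege t' s') //; lra.
- by rewrite (Ege t t') // (Ege s s') // (Ege t s') ?st3 // (distrC t' s); lra.
Qed.

End increments.

(** * The isometry of the stochastic integral *)

Section limits.
Context d (T : measurableType d) (R : realType) (mu : {measure set T -> \bar R}).
Notation sqi := (square_integrable mu).

Lemma cvg0_sqr_le (x y : nat -> R) : (forall n, x n ^+ 2 <= y n) ->
  y n @[n --> \oo] --> 0 -> x n @[n --> \oo] --> 0.
Proof.
move=> xy y0; apply/cvgrPdist_lt => e e0.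
have e2 : 0 < e ^+ 2 by rewrite exprn_gt0.
have : \forall n \near \oo, y n < e ^+ 2 by have := cvgr_lt _ y0 _ e2; exact.
apply: filterS => n yn.
rewrite sub0r normrN -(@ltr_pXn2r _ 2) ?nnegrE ?normr_ge0 ?ltW // real_normK ?num_real //.
exact: le_lt_trans yn.
Qed.

Lemma cvg0_le (x y : nat -> R) : (forall n, 0 <= x n) -> (forall n, x n <= y n) ->
  y n @[n --> \oo] --> 0 -> x n @[n --> \oo] --> 0.
Proof.
move=> x0 xy y0; apply: squeeze_cvgr y0; last exact: cvg_cst.
by apply: nearW => n; rewrite x0 xy.
Qed.

Lemma ip_cvg (a b : nat -> T -> R) (f g : T -> R) :
  (forall n, sqi (a n)) -> (forall n, sqi (b n)) -> sqi f -> sqi g ->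
  l2ip mu (fun w => f w - a n w) (fun w => f w - a n w) @[n --> \oo] --> 0 ->
  l2ip mu (fun w => g w - b n w) (fun w => g w - b n w) @[n --> \oo] --> 0 ->
  l2ip mu (a n) (b n) @[n --> \oo] --> l2ip mu f g.
Proof.
move=> sa sb sf sg af bg.
have sfa n := sqiB sf (sa n); have sgb n := sqiB sg (sb n).
pose A n := l2ip mu (fun w => f w - a n w) g.
pose B n := l2ip mu f (fun w => g w - b n w).
pose C n := l2ip mu (fun w => f w - a n w) (fun w => g w - b n w).
have -> : (fun n => l2ip mu (a n) (b n)) = (fun n => l2ip mu f g - A n - B n + C n).
  apply/funext => n.
  rewrite /A /B /C (ipBl sf (sa n) (sgb n)) (ipBl sf (sa n) sg).
  rewrite (ipBr sg (sb n) sf) (ipBr sg (sb n) (sa n)); ring.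
rewrite -[X in _ --> X]addr0 -[X in _ --> X + _]subr0 -[X in _ --> X - _ + _]subr0.
have A0 : A n @[n --> \oo] --> 0.
  apply: (@cvg0_sqr_le _ (fun n => l2ip mu (fun w => f w - a n w) (fun w => f w - a n w) * l2ip mu g g)).
    by move=> n; exact: cauchy_schwarz.
  by rewrite -(mul0r (l2ip mu g g)); apply: cvgMl.
have B0 : B n @[n --> \oo] --> 0.
  apply: (@cvg0_sqr_le _ (fun n => l2ip mu f f * l2ip mu (fun w => g w - b n w) (fun w => g w - b n w))).
    by move=> n; exact: cauchy_schwarz.
  by rewrite -(mulr0 (l2ip mu f f)); apply: cvgMr.
have C0 : C n @[n --> \oo] --> 0.
  apply: (@cvg0_sqr_le _ (fun n => l2ip mu (fun w => f w - a n w) (fun w => f w - a n w)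
     * l2ip mu (fun w => g w - b n w) (fun w => g w - b n w))).
    by move=> n; exact: cauchy_schwarz.
  by rewrite -(mulr0 0); apply: cvgM.
apply: cvgD => //; apply: cvgB => //; apply: cvgB => //; exact: cvg_cst.
Qed.

Lemma ip_lincomb_cvg0 (c : R) (f g : T -> R) (a b h : nat -> T -> R) :
  (forall n, sqi (a n)) -> (forall n, sqi (b n)) -> sqi f -> sqi g ->
  (forall n w, h n w = c * a n w + b n w) ->
  l2ip mu (fun w => f w - a n w) (fun w => f w - a n w) @[n --> \oo] --> 0 ->
  l2ip mu (fun w => g w - b n w) (fun w => g w - b n w) @[n --> \oo] --> 0 ->
  l2ip mu (fun w => c * f w + g w - h n w) (fun w => c * f w + g w - h n w) @[n --> \oo] --> 0.
Proof.
move=> sa sb sf sg hE af bg.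
pose A n := l2ip mu (fun w => f w - a n w) (fun w => f w - a n w).
pose B n := l2ip mu (fun w => g w - b n w) (fun w => g w - b n w).
apply: (@cvg0_le _ (fun n => 2 * (c ^+ 2 * A n) + 2 * B n)) => [n|n|]; first exact: ip_ge0.
  have sfa := sqiB sf (sa n); have sgb := sqiB sg (sb n).
  have := ip_sqrD_le (sqiZ c sfa) sgb; rewrite ip_sqrZ // -/(A n) -/(B n).
  apply: le_trans; rewrite le_eqVlt; apply/orP; left; apply/eqP.
  by apply: eq_Rintegral => w _; rewrite hE; ring.
rewrite -(addr0 0) -[X in _ --> X + _](mulr0 2) -[X in _ --> _ + X](mulr0 2).
apply: cvgD; apply: cvgMr => //.
by rewrite -(mulr0 (c ^+ 2)); exact: cvgMr.
Qed.

Lemma sqi_cvg0 (f : T -> R) (a : nat -> T -> R) : measurable_fun setT f ->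
  (forall n, sqi (a n)) ->
  (\int[mu]_w ((f w - a n w) ^+ 2)%:E)%E @[n --> \oo] --> 0%E ->
  sqi f /\ l2ip mu (fun w => f w - a n w) (fun w => f w - a n w) @[n --> \oo] --> 0.
Proof.
move=> mf sa /fine_cvgP[[N _ hN] h].
have sf : sqi f.
  have -> : f = (fun w => f w - a N w + a N w) by apply/funext => w; rewrite subrK.
  apply: sqiD => //; split; first by apply: measurable_funB => //; case: (sa N).
  have := hN N (leqnn N); rewrite /= fin_numE => /andP[_ h'].
  by rewrite lt_neqAle h' leey.
by split => //; apply: cvg_trans h; apply: near_eq_cvg; exact: nearW.
Qed.

End limits.

Lemma cvg_sumr (R : realType) (U : Type) (F : set_system U) (FF : Filter F) (I : Type) (s : seq I)
    (f : I -> U -> R) (l : I -> R) :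
  (forall i, f i x @[x --> F] --> l i) ->
  (\sum_(i <- s) f i x) @[x --> F] --> \sum_(i <- s) l i.
Proof.
move=> fl; elim: s => [|i s ih].
  by rewrite big_nil; under eq_fun do rewrite big_nil; exact: cvg_cst.
by rewrite big_cons; under eq_fun do rewrite big_cons; exact: cvgD.
Qed.

Lemma Rintegral_sumr d (T : measurableType d) (R : realType) (mu : {measure set T -> \bar R})
    (I : Type) (s : seq I) (F : I -> T -> R) :
  (forall i, mu.-integrable setT (EFin \o F i)) ->
  \int[mu]_x (\sum_(i <- s) F i x) = \sum_(i <- s) \int[mu]_x F i x.
Proof.
move=> iF.
have isum s' : mu.-integrable setT (EFin \o (fun x => \sum_(i <- s') F i x)).
  elim: s' => [|i s' ih].
    rewrite (_ : _ \o _ = cst 0%E); first exact: integrable0.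
    by apply/funext => x /=; rewrite big_nil.
  rewrite (_ : _ \o _ = ((EFin \o F i) \+ (EFin \o (fun x => (\sum_(i <- s') F i x)%R)))%E).
    exact: integrableD.
  by apply/funext => x /=; rewrite big_cons.
elim: s => [|i s ih].
  rewrite big_nil; under eq_Rintegral do rewrite big_nil.
  by rewrite /Rintegral integral0.
rewrite big_cons -ih -RintegralD //.
by apply: eq_Rintegral => x _; rewrite big_cons.
Qed.

Section form.
Context (R : realType) (k : nat) (S : 'M[R]_k).
Hypothesis HS : posdef S.
Notation leb := (@lebesgue_measure R).
Notation ipl := (l2ip leb).
Notation sqil := (square_integrable leb).
Implicit Types F G H : 'I_k -> R -> R.

(** The inner product of L2(R; R^k) weighted by [S], the covariance of integrals against
    a process with covariance [S] per unit time. *)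
Definition bform F G := \sum_i \sum_j S i j * ipl (F i) (G j).

Lemma bform_integral F G : (forall i, sqil (F i)) -> (forall i, sqil (G i)) ->
  bform F G = \int[leb]_v (\sum_i \sum_j S i j * (F i v * G j v)).
Proof.
move=> sF sG; rewrite /bform.
transitivity (\sum_i \sum_j \int[leb]_v (S i j * (F i v * G j v))).
  apply: eq_bigr => i _; apply: eq_bigr => j _.
  by rewrite RintegralZl //; exact: sqi_mul.
under eq_bigr => i _.
  rewrite -Rintegral_sumr; last first.
    move=> j; rewrite (_ : _ \o _ = (fun v => (S i j)%:E * (EFin \o (fun v => (F i v * G j v)%R)) v))%E //.
    by apply: integrableZl => //; exact: sqi_mul.
  over.
rewrite -Rintegral_sumr //.
move=> i.
have -> : EFin \o (fun v : R => \sum_j S i j * (F i v * G j v)) =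
    EFin \o (fun v : R => F i v * (\sum_j S i j * G j v)).
  by apply/funext => v /=; rewrite mulr_sumr; congr EFin; apply: eq_bigr => j _; ring.
by apply: (@sqi_mul _ _ _ leb) => //; apply: sqi_sum => j; exact: sqiZ.
Qed.

Lemma posdef_unitmx : S \in unitmx.
Proof.
rewrite -row_free_unit -kermx_eq0; apply/eqP/row_matrixP => i; rewrite row0.
apply/eqP; apply: contraT => v0.
have [_ /(_ (row i (kermx S))^T)] := HS.
rewrite trmxK.
have -> : row i (kermx S) *m S = 0 by apply/sub_kermxP; exact: row_sub.
rewrite mul0mx mxE ltxx => /(_ _); apply.
by apply: contra_neq v0 => h; rewrite -[row i _]trmxK h trmx0.
Qed.

Lemma bformC F G : bform F G = bform G F.
Proof.
rewrite /bform exchange_big; apply: eq_bigr => i _; apply: eq_bigr => j _ /=.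
have [ST _] := HS; rewrite (ipC leb (F j)); congr (_ * _).
by rewrite -[in LHS]ST mxE.
Qed.

Lemma bformDl a F G H : (forall i, sqil (F i)) -> (forall i, sqil (G i)) ->
  (forall i, sqil (H i)) ->
  bform (fun i v => a * F i v + G i v) H = a * bform F H + bform G H.
Proof.
move=> sF sG sH; rewrite /bform mulr_sumr -big_split; apply: eq_bigr => i _ /=.
rewrite mulr_sumr -big_split; apply: eq_bigr => j _ /=.
by rewrite ipDl ?ipZl //; [ring|exact: sqiZ].
Qed.

Lemma bform_ge0 F : (forall i, sqil (F i)) -> 0 <= bform F F.
Proof.
move=> sF; rewrite bform_integral //; apply: Rintegral_ge0 => v _.
pose f : 'cV[R]_k := \col_i F i v.
have -> : \sum_i \sum_j S i j * (F i v * F j v) = (f^T *m S *m f) ord0 ord0.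
  rewrite exchange_big mxE; apply: eq_bigr => j _; rewrite mxE mulr_suml.
  by apply: eq_bigr => i _ /=; rewrite !mxE; ring.
have [->|f0] := eqVneq f 0; first by rewrite mulmx0 mxE.
by have [_ h] := HS; exact/ltW/h.
Qed.

(** The form is positive because [S] is positive semidefinite pointwise; the rest is the
    discriminant argument. *)
Lemma bform_cauchy_schwarz F G : (forall i, sqil (F i)) -> (forall i, sqil (G i)) ->
  bform F G ^+ 2 <= bform F F * bform G G.
Proof.
move=> sF sG.
have H a : 0 <= a ^+ 2 * bform F F + 2 * a * bform F G + bform G G.
  have sFG i : sqil (fun v => a * F i v + G i v) by apply: sqiD => //; exact: sqiZ.
  have := bform_ge0 sFG; rewrite bformDl //.
  rewrite (bformC F (fun i v => a * F i v + G i v)) (bformC G (fun i v => a * F i v + G i v)).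
  by rewrite !bformDl // (bformC G F); nra.
have F0 := bform_ge0 sF; have G0 := bform_ge0 sG.
have [f0|f0] := eqVneq (bform F F) 0.
  rewrite f0 mul0r; have [->|b0] := eqVneq (bform F G) 0; first by rewrite expr0n.
  have := H (- (bform G G + 1) / (2 * bform F G)); rewrite f0 mulr0 add0r.
  have -> : 2 * (- (bform G G + 1) / (2 * bform F G)) * bform F G = - (bform G G + 1).
    by field.
  lra.
have fp : 0 < bform F F by rewrite lt_neqAle eq_sym f0.
have := H (- bform F G / bform F F).
rewrite -(pmulr_lge0 _ fp) => h; rewrite -subr_ge0; apply: le_trans h _.
rewrite le_eqVlt; apply/orP; left; apply/eqP; field; exact: f0.
Qed.

End form.

Section isometry.
Context d (T : measurableType d) (R : realType) (P : probability T R) (k : nat).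
Variable L : R -> 'I_k -> T -> R.
Hypothesis HL : is_two_sided_levy P L.
Hypothesis HC : centered_sq_integrable P L.
Notation leb := (@lebesgue_measure R).
Notation sqi := (square_integrable P).
Notation sqil := (square_integrable leb).
Implicit Types phi psi : step_fun R k.

(** Indexed by a whole piece of a step function, so that a step function is a sum of these
    over its own list of pieces. *)
Definition ioc_indic (x : R * R * 'rV[R]_k) (u : R) : R := (x.1.1 < u <= x.1.2)%R%:R.

Lemma ioc_indicE x : ioc_indic x = \1_(`]x.1.1, x.1.2]%classic).
Proof.
apply/funext => u; rewrite /ioc_indic indicE; congr (_%:R); congr nat_of_bool.
by apply/idP/idP; rewrite inE /= in_itv.
Qed.

Lemma ioc_indic_sqi x : sqil (ioc_indic x).
Proof.
rewrite ioc_indicE; split; first exact: measurable_indic.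
have E (u : R) : (\1_(`]x.1.1, x.1.2]%classic) u : R) ^+ 2 = \1_(`]x.1.1, x.1.2]%classic) u.
  by rewrite indicE; case: (_ \in _); rewrite ?expr1n ?expr0n.
under eq_integral do rewrite E.
rewrite integral_indic // setIT.
rewrite [X in (X < _)%E](_ : _ = lebesgue_measure `]x.1.1, x.1.2]%classic) // lebesgue_measure_itv /=.
by case: ifP => _; rewrite ltry.
Qed.

Lemma ioc_indic_ip x y : x.1.1 <= x.1.2 -> y.1.1 <= y.1.2 ->
  l2ip leb (ioc_indic x) (ioc_indic y) = Num.max 0 (Num.min x.1.2 y.1.2 - Num.max x.1.1 y.1.1).
Proof.
move=> hx hy; rewrite /l2ip /Rintegral.
have E (u : R) : ioc_indic x u * ioc_indic y u =
    \1_(`](Num.max x.1.1 y.1.1), (Num.min x.1.2 y.1.2)]%classic) u.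
  rewrite indicE /ioc_indic -natrM mulnb; congr (_%:R); congr nat_of_bool.
  apply/idP/idP; rewrite inE /= in_itv /= gt_max le_min.
    by move=> /andP[/andP[-> ->] /andP[-> ->]].
  by move=> /andP[/andP[-> ->] /andP[-> ->]].
under eq_integral do rewrite E.
rewrite integral_indic // setIT.
rewrite [X in fine X](_ : _ = lebesgue_measure
  `]Num.max x.1.1 y.1.1, Num.min x.1.2 y.1.2]%classic) //.
rewrite lebesgue_measure_itv /= lte_fin.
case: ifPn => [h|]; first by rewrite -EFinB /= [RHS]max_r // subr_ge0 ltW.
by rewrite -leNgt => h /=; rewrite [RHS]max_l // subr_le0.
Qed.

Lemma step_evalE phi u j : step_eval phi u ord0 j = \sum_(x <- phi) x.2 ord0 j * ioc_indic x u.
Proof.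
rewrite /step_eval summxE; apply: eq_bigr => x _.
by rewrite mxE mulrC.
Qed.

Lemma step_eval_sqi phi j : sqil (fun u => step_eval phi u ord0 j).
Proof.
under eq_fun do rewrite step_evalE.
by apply: sqi_sum => x; apply: sqiZ; exact: ioc_indic_sqi.
Qed.

Lemma step_integral_sqi phi : sqi (step_integral L phi).
Proof.
apply: sqi_sum => x; apply: sqi_sum => j; apply: sqiZ; exact: increment_sqi.
Qed.

Lemma step_isometry phi psi : step_wf phi -> step_wf psi ->
  l2ip P (step_integral L phi) (step_integral L psi) =
  bform (SigmaL P L) (fun j u => step_eval phi u ord0 j) (fun j u => step_eval psi u ord0 j).
Proof.
move=> /allP wphi /allP wpsi.
have si s t i := increment_sqi HL HC s t i.
transitivity (\sum_(x <- phi) \sum_(y <- psi) \sum_i \sum_j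
    SigmaL P L i j * (x.2 ord0 i * y.2 ord0 j * l2ip leb (ioc_indic x) (ioc_indic y))).
  rewrite /step_integral ip_suml; [|by move=> x; apply: sqi_sum => j; exact: sqiZ
    |exact: step_integral_sqi].
  apply: eq_big_seq => x /wphi hx.
  rewrite ip_sumr; [|by move=> y; apply: sqi_sum => j; exact: sqiZ
    |by apply: sqi_sum => j; exact: sqiZ].
  apply: eq_big_seq => y /wpsi hy.
  rewrite ip_suml; [|by move=> i; exact: sqiZ|by apply: sqi_sum => j; exact: sqiZ].
  apply: eq_bigr => i _.
  rewrite ip_sumr; [|by move=> j; exact: sqiZ|exact: sqiZ].
  apply: eq_bigr => j _.
  rewrite ipZl ?ipZr //; last exact: sqiZ.
  rewrite (increment_ip HL HC) // ioc_indic_ip //; ring.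
under eq_bigr do rewrite exchange_big /=.
rewrite exchange_big /=; apply: eq_bigr => i _.
under eq_bigr do rewrite exchange_big /=.
rewrite exchange_big /=; apply: eq_bigr => j _.
under eq_bigr do rewrite -mulr_sumr.
rewrite -mulr_sumr; congr (_ * _).
have -> : (fun u => step_eval phi u ord0 i) = (fun u => \sum_(x <- phi) x.2 ord0 i * ioc_indic x u).
  by apply/funext => u; rewrite step_evalE.
have -> : (fun u => step_eval psi u ord0 j) = (fun u => \sum_(x <- psi) x.2 ord0 j * ioc_indic x u).
  by apply/funext => u; rewrite step_evalE.
have sc x := ioc_indic_sqi x.
rewrite ip_suml; [|by move=> x; exact: sqiZ|by apply: sqi_sum => x; exact: sqiZ].
apply: eq_bigr => x _; rewrite ip_sumr; [|by move=> y; exact: sqiZ|exact: sqiZ].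
by apply: eq_bigr => y _; rewrite ipZl ?ipZr ?mulrA //; exact: sqiZ.
Qed.

(** The stochastic integral over the whole line. Predictors combine integrals with different
    end times, whereas [is_integral_upto] ties each integrand to one of them. *)
Definition levy_int (f : 'I_k -> R -> R) (X : T -> R) : Prop :=
  [/\ forall j, sqil (f j), sqi X &
    exists phi : nat -> step_fun R k,
    [/\ forall n, step_wf (phi n),
        forall j, l2ip leb (fun u => f j u - step_eval (phi n) u ord0 j)
                         (fun u => f j u - step_eval (phi n) u ord0 j) @[n --> \oo] --> 0 &
        l2ip P (fun w => X w - step_integral L (phi n) w)
             (fun w => X w - step_integral L (phi n) w) @[n --> \oo] --> 0]].

Lemma levy_isometry f g X Y : levy_int f X -> levy_int g Y ->
  l2ip P X Y = bform (SigmaL P L) f g.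
Proof.
move=> [sf sX [phi [wphi f0 X0]]] [sg sY [psi [wpsi g0 Y0]]].
have H1 := ip_cvg (fun n => step_integral_sqi (phi n)) (fun n => step_integral_sqi (psi n)) sX sY X0 Y0.
apply: cvg_unique H1 _ => //.
rewrite [X in X @ _](_ : _ = (fun n => bform (SigmaL P L)
    (fun j u => step_eval (phi n) u ord0 j) (fun j u => step_eval (psi n) u ord0 j))); last first.
  by apply/funext => n; rewrite step_isometry.
apply: cvg_sumr => i; apply: cvg_sumr => j; apply: cvgMr.
apply: ip_cvg => //; move=> n; exact: step_eval_sqi.
Qed.

Lemma step_evalD a phi psi u :
  step_eval ([seq (x.1, a *: x.2) | x <- phi] ++ psi) u = a *: step_eval phi u + step_eval psi u.
Proof.
rewrite /step_eval big_cat big_map /= scaler_sumr; congr (_ + _).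
by apply: eq_bigr => x _; rewrite !scalerA mulrC.
Qed.

Lemma step_integralD a phi psi w :
  step_integral L ([seq (x.1, a *: x.2) | x <- phi] ++ psi) w =
  a * step_integral L phi w + step_integral L psi w.
Proof.
rewrite /step_integral big_cat big_map /= mulr_sumr; congr (_ + _).
apply: eq_bigr => x _; rewrite mulr_sumr; apply: eq_bigr => j _.
by rewrite mxE mulrA.
Qed.

Lemma levy_intD a f g X Y : levy_int f X -> levy_int g Y ->
  levy_int (fun j u => a * f j u + g j u) (fun w => a * X w + Y w).
Proof.
move=> [sf sX [phi [wphi f0 X0]]] [sg sY [psi [wpsi g0 Y0]]].
split=> [j| |]; [apply: sqiD => //; exact: sqiZ|apply: sqiD => //; exact: sqiZ|].
exists (fun n => [seq (x.1, a *: x.2) | x <- phi n] ++ psi n); split.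
- move=> n; rewrite /step_wf all_cat all_map; apply/andP; split; last exact: wpsi.
  exact: wphi.
- move=> j; apply: (@ip_lincomb_cvg0 _ _ _ leb a _ _
      (fun n u => step_eval (phi n) u ord0 j) (fun n u => step_eval (psi n) u ord0 j)) => //.
  + by move=> n; exact: step_eval_sqi.
  + by move=> n; exact: step_eval_sqi.
  + by move=> n u; rewrite step_evalD !mxE.
- apply: (@ip_lincomb_cvg0 _ _ _ P a _ _
      (fun n => step_integral L (phi n)) (fun n => step_integral L (psi n))) => //.
  + by move=> n; exact: step_integral_sqi.
  + by move=> n; exact: step_integral_sqi.
  + by move=> n w; rewrite step_integralD.
Qed.

Lemma levy_int0 : levy_int (fun=> fun=> 0) (fun=> 0).
Proof.
split=> [j| |]; [exact: sqi0|exact: sqi0|exists (fun=> [::])]; split => //.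
- move=> j; rewrite [X in X @ _](_ : _ = fun=> 0); first exact: cvg_cst.
  apply/funext => n; under eq_fun do rewrite step_evalE big_nil subr0.
  by rewrite ip0l.
- rewrite [X in X @ _](_ : _ = fun=> 0); first exact: cvg_cst.
  apply/funext => n; under eq_fun do rewrite /step_integral big_nil subr0.
  by rewrite ip0l.
Qed.

Lemma levy_int_sum (I : Type) (s : seq I) (c : I -> R) (f : I -> 'I_k -> R -> R) (X : I -> T -> R) :
  (forall i, levy_int (f i) (X i)) ->
  levy_int (fun j u => \sum_(i <- s) c i * f i j u) (fun w => \sum_(i <- s) c i * X i w).
Proof.
move=> H; elim: s => [|i s ih].
  under [X in levy_int X]eq_fun do under eq_fun do rewrite big_nil.
  under [X in levy_int _ X]eq_fun do rewrite big_nil.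
  exact: levy_int0.
under [X in levy_int X]eq_fun do under eq_fun do rewrite big_cons.
under [X in levy_int _ X]eq_fun do rewrite big_cons.
exact: levy_intD.
Qed.

Lemma levy_int_upto (F : R -> 'rV[R]_k) t X :
  (forall j, measurable_fun [set: R] (fun u : R => F u ord0 j)) ->
  is_integral_upto P L F t X -> levy_int (fun j u => (u <= t)%R%:R * F u ord0 j) X.
Proof.
move=> mF [mX [phi [wphi hF hX]]].
have mf j : measurable_fun [set: R] (fun u : R => (u <= t)%R%:R * F u ord0 j).
  apply: measurable_funM => //.
  rewrite (_ : (fun u : R => _) = \1_(`]-oo, t]%classic)); first exact: measurable_indic.
  apply/funext => u; rewrite indicE; congr (_%:R); congr nat_of_bool.
  by apply/idP/idP; rewrite inE /= in_itv.
have H j := @sqi_cvg0 _ _ _ leb _ _ (mf j) (fun n => step_eval_sqi (phi n) j) (hF j).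
have [sX cX] := sqi_cvg0 mX (fun n => step_integral_sqi (phi n)) hX.
split=> [j| //|]; first by have [] := H j.
by exists phi; split => // j; have [] := H j.
Qed.

End isometry.

(** * Entries of the matrix exponential *)

Section expmx.
Context (R : realType) (n : nat) (M : 'M[R]_n).

Lemma mxpowS m : M ^+ m.+1 = M *m M ^+ m.
Proof. by rewrite exprS. Qed.

Lemma mxpowSr m : M ^+ m.+1 = M ^+ m *m M.
Proof. by rewrite exprSr. Qed.

Lemma mxpow_scale x m : (x *: M) ^+ m = x ^+ m *: M ^+ m.
Proof.
elim: m => [|m ih]; first by rewrite !expr0 scale1r.
have E : (x *: M) ^+ m.+1 = (x *: M) *m (x *: M) ^+ m := exprS _ _.
by rewrite E ih mxpowS -scalemxAl -scalemxAr scalerA exprS.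
Qed.

(** Taylor coefficients at 0 of the entries of U e^{xM}. Multiplying by [U] makes the
    family stable under differentiation, which replaces [U] by [U *m M]. *)
Definition expmx_coef q (U : 'M[R]_(q, n)) i j (m : nat) : R := (U *m M ^+ m) i j / m`!%:R.

Lemma mxpow_bound q (U : 'M[R]_(q, n)) i j m :
  `|(U *m M ^+ m) i j| <= (\sum_a \sum_b `|U a b|) * (\sum_a \sum_b `|M a b|) ^+ m.
Proof.
set K := \sum_a \sum_b `|M a b|; set C := \sum_a \sum_b _.
have rowle (q' : nat) (V : 'M[R]_(q', n)) a : \sum_b `|V a b| <= \sum_a \sum_b `|V a b|.
  by rewrite [leRHS](bigD1 a) //= lerDl; apply: sumr_ge0 => x _; apply: sumr_ge0.
have C0 : 0 <= C by apply: sumr_ge0 => x _; apply: sumr_ge0.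
have K0 : 0 <= K by apply: sumr_ge0 => x _; apply: sumr_ge0.
suff H : \sum_b `|(U *m M ^+ m) i b| <= C * K ^+ m.
  by apply: le_trans H; rewrite (bigD1 j) //= lerDl sumr_ge0.
elim: m => [|m ih]; first by rewrite !expr0 mulr1 mulmx1; exact: rowle.
rewrite mxpowSr mulmxA; apply: (@le_trans _ _ (\sum_b \sum_a `|(U *m M ^+ m) i a| * `|M a b|)).
  apply: ler_sum => b _; rewrite mxE; apply: (le_trans (ler_norm_sum _ _ _)).
  by apply: ler_sum => a _; rewrite normrM.
rewrite exchange_big /=; apply: (@le_trans _ _ (\sum_a `|(U *m M ^+ m) i a| * K)).
  by apply: ler_sum => a _; rewrite -mulr_sumr ler_wpM2l // rowle.
by rewrite -mulr_suml exprSr mulrA ler_wpM2r.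
Qed.

Lemma expmx_coef_cvg q (U : 'M[R]_(q, n)) i j x : cvgn (pseries (expmx_coef U i j) x).
Proof.
apply: normed_cvg; rewrite /normed_series_of /pseries.
set C := \sum_a \sum_b `|U a b|; set K := \sum_a \sum_b `|M a b|.
have C0 : 0 <= C by apply: sumr_ge0 => a _; apply: sumr_ge0.
have K0 : 0 <= K by apply: sumr_ge0 => a _; apply: sumr_ge0.
apply: (@series_le_cvg _ _ (fun m => C * exp_coeff (K * `|x|) m)).
- by move=> m; exact: normr_ge0.
- move=> m; rewrite mulr_ge0 // /exp_coeff /= divr_ge0 // exprn_ge0 // mulr_ge0 //.
- move=> m; rewrite -[leLHS]/(`|expmx_coef U i j m * x ^+ m|) /expmx_coef !normrM normrX normfV
    [ `|m`!%:R|]ger0_norm // /exp_coeff /=.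
  rewrite exprMn mulrA mulrA -[leLHS]mulrAC ler_wpM2r ?invr_ge0 //.
  by rewrite ler_wpM2r ?exprn_ge0 // mxpow_bound.
- exact/is_cvg_seriesZ/is_cvg_series_exp_coeff.
Qed.

Lemma expmx_coef_diffs q (U : 'M[R]_(q, n)) i j :
  pseries_diffs (expmx_coef U i j) = expmx_coef (U *m M) i j.
Proof.
apply/funext => m; rewrite /pseries_diffs /expmx_coef mxpowS mulmxA factS natrM.
have h1 : (m.+1%:R : R) != 0 by rewrite pnatr_eq0.
by rewrite invfM mulrCA [X in _ * X]mulrA mulfV // mul1r.
Qed.

Lemma mulmx_expmxE q (U : 'M[R]_(q, n)) x i j :
  (U *m expmx (x *: M)) i j = limn (pseries (expmx_coef U i j) x).
Proof.
rewrite mxE; apply/esym/cvg_lim => //.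
rewrite [X in X @ _](_ : _ = fun m => \sum_l U i l * pseries (expmx_coef 1%:M l j) x m).
  have H l : pseries (expmx_coef 1%:M l j) x m @[m --> \oo] --> expmx (x *: M) l j.
    rewrite /expmx mxE (_ : series _ = pseries (expmx_coef 1%:M l j) x); first exact: expmx_coef_cvg.
    congr series; apply/funext => m.
    by rewrite mxpow_scale /expmx_coef /= mul1mx [LHS]mxE [X in _ * X]mxE; ring.
  elim: (index_enum _) => [|l s ih].
    by rewrite big_nil; under eq_fun do rewrite big_nil; exact: cvg_cst.
  rewrite big_cons; under eq_fun do rewrite big_cons.
  by apply: cvgD => //; apply: cvgMr; exact: H.
apply/funext => m; rewrite /pseries /series /=.
under [RHS]eq_bigr do rewrite mulr_sumr.
rewrite exchange_big /=; apply: eq_bigr => r _.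
rewrite /expmx_coef mxE !mulr_suml; apply: eq_bigr => l _.
by rewrite mul1mx !mulrA.
Qed.

(** Termwise differentiation of the power series, which converges everywhere. *)
Lemma mulmx_expmx_is_derive q (U : 'M[R]_(q, n)) (x : R) i j :
  is_derive x 1 (fun x => (U *m expmx (x *: M)) i j) ((U *m M *m expmx (x *: M)) i j).
Proof.
rewrite mulmx_expmxE -expmx_coef_diffs.
rewrite (_ : (fun x => _) = (fun x => limn (pseries (expmx_coef U i j) x))); last first.
  by apply/funext => y; rewrite mulmx_expmxE.
apply: (@pseries_snd_diffs _ _ (`|x| + 1)); rewrite ?expmx_coef_diffs; try exact: expmx_coef_cvg.
by rewrite [ltRHS]ger0_norm ?addr_ge0 // ltrDl.
Qed.

Lemma expmx0 : expmx ((0 : R) *: M) = 1%:M.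
Proof.
apply/matrixP => i j; rewrite -[expmx _]mul1mx mulmx_expmxE.
apply/cvg_lim => //; apply: cvg_near_cst; exists 1%N => // -[//|m] _ /=.
rewrite /pseries /series /= big_nat_recl // expr0 mulr1 big1 ?addr0.
  by rewrite /expmx_coef expr0 fact0 divr1 mulmx1.
by move=> l _; rewrite expr0n mulr0.
Qed.

Lemma mulmx_expmxC x : M *m expmx (x *: M) = expmx (x *: M) *m M.
Proof.
apply/matrixP => i j; rewrite mulmx_expmxE.
apply/cvg_lim => //.
rewrite mxE [X in X @ _](_ : _ = fun m => \sum_l pseries (expmx_coef 1%:M i l) x m * M l j).
  have H l : pseries (expmx_coef 1%:M i l) x m @[m --> \oo] --> expmx (x *: M) i l.
    by rewrite -[expmx _]mul1mx mulmx_expmxE; exact: expmx_coef_cvg.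
  elim: (index_enum _) => [|l s ih].
    by rewrite big_nil; under eq_fun do rewrite big_nil; exact: cvg_cst.
  rewrite big_cons; under eq_fun do rewrite big_cons.
  by apply: cvgD => //; apply: cvgMl; exact: H.
apply/funext => m; rewrite /pseries /series /=.
under [RHS]eq_bigr do rewrite mulr_suml.
rewrite exchange_big /=; apply: eq_bigr => r _.
rewrite /expmx_coef -mxpowS mxpowSr mxE !mulr_suml; apply: eq_bigr => l _.
by rewrite mul1mx; ring.
Qed.

Lemma expmx_is_derive (x : R) i j :
  is_derive x 1 (fun x => expmx (x *: M) i j) ((M *m expmx (x *: M)) i j).
Proof.
have := mulmx_expmx_is_derive 1%:M x i j; rewrite mul1mx.
by under eq_fun do rewrite mul1mx.
Qed.

Lemma bilinear_expmx_is_derive q r (U : 'M[R]_(q, n)) (V : 'M[R]_(n, r)) (x : R) i j :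
  is_derive x 1 (fun x => (U *m expmx (x *: M) *m V) i j)
    ((U *m M *m expmx (x *: M) *m V) i j).
Proof.
rewrite mxE (_ : (fun x => _) = \sum_l (fun x => (U *m expmx (x *: M)) i l * V l j)).
  apply: is_derive_sum => l.
  have := is_deriveM (mulmx_expmx_is_derive U x i l) (is_derive_cst (V l j) x (1 : R)).
  have E : V l j *: ((U *m M *m expmx (x *: M)) i l : R) = (U *m M *m expmx (x *: M)) i l * V l j.
    exact: mulrC.
  by rewrite scaler0 add0r E.
by apply/funext => y; rewrite mxE fct_sumE.
Qed.

Lemma is_derive_continuous (f : R -> R) (x : R) df : is_derive x 1 f df -> {for x, continuous f}.
Proof.
by move=> [h _]; apply: differentiable_continuous; apply/derivable1_diffP.
Qed.

Lemma bilinear_expmx_continuous q r (U : 'M[R]_(q, n)) (V : 'M[R]_(n, r)) i j :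
  continuous (fun x : R => (U *m expmx (x *: M) *m V) i j).
Proof. by move=> x; apply: is_derive_continuous; exact: bilinear_expmx_is_derive. Qed.

(** If the function vanishes on (0, e), so do its derivatives there, and their limits at 0
    are the entries of U M^a V. The induction on [a] generalizes [U], since
    differentiating replaces [U] by [U *m M]. *)
Lemma bilinear_expmx_eq0 q r (U : 'M[R]_(q, n)) (V : 'M[R]_(n, r)) i j (e : R) : 0 < e ->
  (forall x : R, 0 < x -> x < e -> (U *m expmx (x *: M) *m V) i j = 0) ->
  forall a, (U *m M ^+ a *m V) i j = 0.
Proof.
move=> e0 h a; elim: a U h => [|a ih] U h.
  rewrite expr0 mulmx1.
  have := @bilinear_expmx_continuous _ _ U V i j 0; rewrite /continuous_at expmx0 mulmx1.
  move=> hc; apply/eqP; rewrite -normr_eq0 eq_le normr_ge0 andbT leNgt; apply/negP => c0.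
  have hb : nbhs (0 : R) (fun x : R =>
      `|(U *m V) i j - (U *m expmx (x *: M) *m V) i j| < `|(U *m V) i j|).
    by move/cvgrPdist_lt : hc; exact.
  have [del /= d0 hd] := (nbhs_ballP (0 : R) _).1 hb.
  pose x := Num.min del e / 2.
  have m0 : 0 < Num.min del e by rewrite lt_min d0 e0.
  have x0 : 0 < x by rewrite divr_gt0.
  have xm : x < Num.min del e by rewrite /x; lra.
  move: xm; rewrite lt_min => /andP[xd xe].
  have := hd x; rewrite h // subr0 /ball /= sub0r normrN gtr0_norm // => /(_ xd).
  by rewrite ltxx.
rewrite exprS mulmxA; apply: ih => x x0 xe.
have hD := bilinear_expmx_is_derive U V x i j.
rewrite -(@derive_val _ _ _ _ _ _ _ hD).
rewrite (@near_eq_derive _ _ _ _ (fun=> 0)) ?derive_cst //.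
near=> y; apply: h; near: y.
- exact: lt_nbhsr.
- exact: lt_nbhsl.
Unshelve. all: by end_near. Qed.

(** The derivative of x |-> e^{(s+t-x)M} e^{xM} is zero; compare its values at 0 and t. *)
Lemma expmxD s t : expmx ((s + t) *: M) = expmx (s *: M) *m expmx (t *: M).
Proof.
apply/matrixP => i j.
pose g (x : R) : R := (expmx ((s + t - x) *: M) *m expmx (x *: M)) i j.
have gD (x : R) : is_derive x 1 g 0.
  have E : g = \sum_l (fun x => expmx ((s + t - x) *: M) i l * expmx (x *: M) l j).
    by apply/funext => y; rewrite /g mxE fct_sumE.
  rewrite E.
  have F l : is_derive x 1 (fun x : R => expmx ((s + t - x) *: M) i l)
     (- (M *m expmx ((s + t - x) *: M)) i l).
    have := @is_derive1_comp _ (fun x => expmx (x *: M) i l) (fun x => s + t - x) x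
      ((M *m expmx ((s + t - x) *: M)) i l) (-1) (expmx_is_derive _ _ _).
    rewrite mulrN1; apply.
    have := is_deriveB (is_derive_cst (s + t) x (1 : R)) (is_derive_id x (1 : R)).
    by rewrite sub0r.
  apply: is_derive_eq; first by apply: is_derive_sum => l; exact: (is_deriveM (F l) (expmx_is_derive x l j)).
  rewrite /= big_split /=.
  have -> : \sum_l expmx ((s + t - x) *: M) i l *: (M *m expmx (x *: M)) l j =
     (expmx ((s + t - x) *: M) *m (M *m expmx (x *: M))) i j by rewrite [RHS]mxE.
  have -> : \sum_l expmx (x *: M) l j *: (- (M *m expmx ((s + t - x) *: M)) i l) =
     - (M *m expmx ((s + t - x) *: M) *m expmx (x *: M)) i j.
    rewrite [in RHS]mxE -sumrN; apply: eq_bigr => l _.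
    by rewrite scalerN [_ *: _]mulrC.
  by rewrite (mulmx_expmxC (s + t - x)) mulmxA subrr.
have := is_derive_0_is_cst t 0 gD; rewrite /g addrK subr0 expmx0 mulmx1.
by move=> <-.
Qed.

End expmx.

(** Every power of [M] is a combination of the first n ones: reduce X^a modulo the
    characteristic polynomial. *)
Lemma cayley_hamilton_span (R : realType) n q r (M : 'M[R]_n)
    (U : 'M[R]_(q, n)) (V : 'M[R]_(n, r)) i j :
  (forall a, (a <= n - 1)%N -> (U *m M ^+ a *m V) i j = 0) ->
  forall a, (U *m M ^+ a *m V) i j = 0.
Proof.
case: n M U V => [|n] M U V h a.
  by rewrite mxE big1 // => -[].
have : M ^+ a = horner_mx M ('X^a %% char_poly M).
  transitivity (horner_mx M 'X^a); first by rewrite rmorphXn /= horner_mx_X.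
  rewrite {1}(divp_eq 'X^a (char_poly M)).
  by rewrite rmorphD rmorphM /= Cayley_Hamilton mulr0 add0r.
set p := _ %% _ => ->.
have sp : (size p <= n.+1)%N.
  rewrite -ltnS -(size_char_poly M) /p ltn_modp.
  by rewrite -size_poly_eq0 size_char_poly.
rewrite -[p]coefK poly_def rmorph_sum /= mulmx_sumr mulmx_suml summxE big1 // => l _.
rewrite linearZ /= rmorphXn /= horner_mx_X -scalemxAr -scalemxAl mxE h ?mulr0 //.
by rewrite subn1 /= -ltnS (leq_trans (ltn_ord l) sp).
Qed.

Lemma bilinear_expmx_pow_eq0 (R : realType) n q r (M : 'M[R]_n)
    (U : 'M[R]_(q, n)) (V : 'M[R]_(n, r)) i j :
  (forall a, (U *m M ^+ a *m V) i j = 0) ->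
  forall x : R, (U *m expmx (x *: M) *m V) i j = 0.
Proof.
move=> h x; rewrite mxE.
have H : (\sum_l pseries (expmx_coef M U i l) x m * V l j) @[m --> \oo] -->
    \sum_l (U *m expmx (x *: M)) i l * V l j.
  elim: (index_enum _) => [|l s ih].
    by rewrite big_nil; under eq_fun do rewrite big_nil; exact: cvg_cst.
  rewrite big_cons; under eq_fun do rewrite big_cons.
  apply: cvgD => //; apply: cvgMl; rewrite mulmx_expmxE; exact: expmx_coef_cvg.
apply: (cvg_unique _ H) => //.
rewrite [X in X @ _](_ : _ = fun=> 0); first exact: cvg_cst.
apply/funext => m; rewrite /pseries /series /=.
under eq_bigr do rewrite mulr_suml.
rewrite exchange_big big1 //= => a _.
have := h a; rewrite mxE => ha.
transitivity ((\sum_l (U *m M ^+ a) i l * V l j) * (x ^+ a / a`!%:R)).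
  by rewrite mulr_suml; apply: eq_bigr => l _; rewrite /expmx_coef; ring.
by rewrite ha mul0r.
Qed.

(** * Entries of the block companion matrices *)

Section blocks.
Context (R : realType) (k p : nat).
Variable Ac : 'I_p -> 'M[R]_k.

Lemma mcarA_blk (j j' : 'I_p) (i i' : 'I_k) : mcarA Ac (blk j i) (blk j' i') =
  (if (j.+1 < p)%N then (if j' == j.+1 :> nat then 1%:M else 0)
     else - Ac (rev_ord j')) i i'.
Proof.
have -> : mcarA Ac (blk j i) (blk j' i') = submxblock (mcarA Ac) j j' i i' by rewrite [RHS]mxE.
by rewrite /mcarA mxblockK.
Qed.

Lemma mcarE_blk (j j' : 'I_p) (i i' : 'I_k) :
  mcarE R k j' (blk j i) i' = ((j == j') && (i == i'))%:R.
Proof.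
have -> : mcarE R k j' (blk j i) i' = submxcol (mcarE R k j') j i i' by rewrite [RHS]mxE.
by rewrite /mcarE mxcolK; case: eqP => _; rewrite !mxE.
Qed.

Lemma mcarB_blk (j : 'I_p) (i i' : 'I_k) :
  mcarB R k p (blk j i) i' = ((j.+1 == p)%N && (i == i'))%:R.
Proof.
have -> : mcarB R k p (blk j i) i' = submxcol (mcarB R k p) j i i' by rewrite [RHS]mxE.
by rewrite /mcarB mxcolK; case: eqP => _; rewrite !mxE.
Qed.

Lemma mcarC_blk (j : 'I_p) (i i' : 'I_k) :
  mcarC R k p i' (blk j i) = ((j == 0%N :> nat) && (i' == i))%:R.
Proof.
have -> : mcarC R k p i' (blk j i) = submxrow (mcarC R k p) j i' i by rewrite [RHS]mxE.
by rewrite /mcarC mxrowK; case: eqP => _; rewrite !mxE.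
Qed.

Lemma blkP (q : 'I_(\sum_(i < p) k)) : exists j i, q = blk j i.
Proof. by exists (tagnat.sig1 q), (tagnat.sig2 q); rewrite /blk tagnat.sig2K. Qed.

Lemma blk_eq (j j' : 'I_p) (i i' : 'I_k) : (blk j i == blk j' i') = (j == j') && (i == i').
Proof. by rewrite -val_eqE /blk tagnat.eq_Rank. Qed.

Lemma sum_blk (V : nmodType) (F : 'I_(\sum_(i < p) k) -> V) :
  \sum_q F q = \sum_(j < p) \sum_(i < k) F (blk j i).
Proof.
rewrite pair_big /= (reindex (fun x : 'I_p * 'I_k => blk x.1 x.2)) //=.
exists (fun q => (tagnat.sig1 q, tagnat.sig2 q : 'I_k)) => [[j i] _|q _] /=; last first.
  exact: tagnat.sig2K.
have : blk (tagnat.sig1 (blk j i)) (tagnat.sig2 (blk j i)) = blk j i by exact: tagnat.sig2K.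
by move/eqP; rewrite blk_eq => /andP[/eqP h1 /eqP h2]; congr pair.
Qed.

Lemma mulmx_mcarC (hp : (0 < p)%N) m (M : 'M[R]_(_, m)) b c :
  (mcarC R k p *m M) b c = M (blk (Ordinal hp) b) c.
Proof.
rewrite mxE sum_blk (bigD1 (Ordinal hp)) //= (bigD1 b) //= mcarC_blk !eqxx mul1r.
rewrite [X in _ + X + _]big1 ?addr0 => [|i ib]; last by rewrite mcarC_blk [b == i]eq_sym (negbTE ib) andbF mul0r.
rewrite [X in _ + X]big1 ?addr0 // => j j0; apply: big1 => i _.
by rewrite mcarC_blk -[j == 0%N :> nat]/(j == Ordinal hp) (negbTE j0) mul0r.
Qed.

Lemma mulmx_mcarE m (M : 'M[R]_(m, _)) (j : 'I_p) b a :
  (M *m mcarE R k j) b a = M b (blk j a).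
Proof.
rewrite mxE sum_blk (bigD1 j) //= (bigD1 a) //= mcarE_blk !eqxx mulr1.
rewrite [X in _ + X + _]big1 ?addr0 => [|i ib]; last by rewrite mcarE_blk (negbTE ib) andbF mulr0.
rewrite [X in _ + X]big1 ?addr0 // => j' j0; apply: big1 => i _.
by rewrite mcarE_blk (negbTE j0) mulr0.
Qed.

End blocks.

(** * The state process and its innovations *)

Section state.
Context d (T : measurableType d) (R : realType) (P : probability T R) (k n : nat).
Variable L : R -> 'I_k -> T -> R.
Hypothesis HL : is_two_sided_levy P L.
Hypothesis HC : centered_sq_integrable P L.
Variables (A : 'M[R]_n) (B : 'M[R]_(n, k)) (X : R -> 'I_n -> T -> R).
Hypothesis HX : forall t r,
  is_integral_upto P L (fun u => row r (expmx ((t - u) *: A) *m B)) t (X t r).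
Notation sqi := (square_integrable P).
Notation leb := (@lebesgue_measure R).
Notation ip := (l2ip P).
Notation ipl := (l2ip leb).
Notation E x := (expmx (x *: A)).
Notation S := (SigmaL P L).

Lemma kernel_continuous r j : continuous (fun x : R => (E x *m B) r j).
Proof.
have := @bilinear_expmx_continuous R n A n k 1%:M B r j.
by under eq_fun do rewrite mul1mx.
Qed.

Definition state_kernel t r j v : R := (v <= t)%R%:R * (E (t - v) *m B) r j.

Lemma state_levy_int t r : levy_int P L (state_kernel t r) (X t r).
Proof.
have mF j : measurable_fun [set: R] (fun u : R => (row r (E (t - u) *m B)) ord0 j).
  apply: continuous_measurable_fun => u.
  rewrite (_ : (fun u : R => _) = (fun x : R => (E x *m B) r j) \o (fun u => t - u)); last first.
    by apply/funext => v; rewrite mxE.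
  apply: continuous_comp; last exact: kernel_continuous.
  by apply: cvgB; [exact: cvg_cst|exact: cvg_id].
have := levy_int_upto HL HC mF (HX t r).
rewrite (_ : (fun (j : 'I_k) (u : R) => _) = state_kernel t r) //.
by apply/funext => j; apply/funext => u; rewrite mxE.
Qed.

Lemma state_sqi t r : sqi (X t r).
Proof. by have [] := state_levy_int t r. Qed.

(** The part of X(u) that is not predicted by X(t). For u < t this is the deviation of the
    backward flow from the state, and the formulas below serve both directions. *)
Definition innovation u t r w : R := X u r w - \sum_q E (u - t) r q * X t q w.

(** By e^{A(u-t)} e^{A(t-v)} = e^{A(u-v)}, the two kernels cancel off the interval between
    [t] and [u]. *)
Definition innovation_kernel u t r j v : R :=
  ((v <= u)%R%:R - (v <= t)%R%:R) * (E (u - v) *m B) r j.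

Lemma innovation_levy_int u t r : levy_int P L (innovation_kernel u t r) (innovation u t r).
Proof.
have := levy_int_sum HL HC (index_enum 'I_n) (fun q => E (u - t) r q) (state_levy_int t).
move=> /(levy_intD HL HC (-1))/(_ (state_levy_int u r)).
rewrite (_ : (fun w => _) = innovation u t r); last first.
  by apply/funext => w; rewrite /innovation; ring.
rewrite (_ : (fun j v => _) = innovation_kernel u t r) //.
apply/funext => j; apply/funext => v; rewrite /innovation_kernel /state_kernel.
have -> : \sum_q E (u - t) r q * ((v <= t)%R%:R * (E (t - v) *m B) q j) =
    (v <= t)%R%:R * (E (u - v) *m B) r j.
  have -> : u - v = (u - t) + (t - v) by ring.
  rewrite (expmxD A (u - t)) -mulmxA mxE mulr_sumr; apply: eq_bigr => q _; ring.
ring.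
Qed.

Lemma innovation_sqi u t r : sqi (innovation u t r).
Proof. by have [] := innovation_levy_int u t r. Qed.

Lemma ipl_eq0 (f g : R -> R) : (forall v, f v * g v = 0) -> ipl f g = 0.
Proof.
move=> h; rewrite /l2ip; under eq_Rintegral do rewrite h.
by rewrite /Rintegral integral0.
Qed.

(** Integrals over disjoint time sets: the kernel of [X s q] lives on v <= s, that of the
    innovation on t < v <= u. *)
Lemma innovation_orth u t s r q : s <= t -> t <= u -> ip (innovation u t r) (X s q) = 0.
Proof.
move=> st tu; rewrite (levy_isometry HL HC (innovation_levy_int u t r) (state_levy_int s q)).
apply: big1 => i _; apply: big1 => j _; rewrite ipl_eq0 ?mulr0 // => v.
rewrite /innovation_kernel /state_kernel; case: (leP v s) => vs; last by rewrite mul0r mulr0.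
by rewrite (le_trans vs st) (le_trans (le_trans vs st) tu) subrr !mul0r.
Qed.

Definition innovation_density u u' v : 'M[R]_n :=
  E (u - v) *m B *m S *m (E (u' - v) *m B)^T.

(** For u <= u' the two kernels overlap exactly on (t, u]. *)
Lemma innovation_cov u u' t r q : t <= u -> u <= u' ->
  ip (innovation u t r) (innovation u' t q) =
  \int[leb]_(v in `]t, u]%classic) innovation_density u u' v r q.
Proof.
move=> tu uu'.
have [sf _ _] := innovation_levy_int u t r; have [sg _ _] := innovation_levy_int u' t q.
rewrite (levy_isometry HL HC (innovation_levy_int u t r) (innovation_levy_int u' t q)).
rewrite bform_integral //.
rewrite [RHS]Rintegral_mkcond; apply: eq_Rintegral => v _; rewrite patchE.
case: ifPn => [|vt].
  rewrite inE /= in_itv /= => /andP[tv vu].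
  rewrite /innovation_kernel vu (le_trans vu uu') leNgt tv /= subr0.
  rewrite /innovation_density mxE exchange_big; apply: eq_bigr => j _ /=.
  rewrite [X in _ = X * _]mxE [in RHS]mxE mulr_suml; apply: eq_bigr => i _.
  by rewrite !mul1r; ring.
apply: big1 => i _; apply: big1 => j _.
suff -> : innovation_kernel u t r i v = 0 by rewrite mul0r mulr0.
rewrite /innovation_kernel; move: vt; rewrite notin_setE /= in_itv /= => /negP.
rewrite negb_and -!leNgt => /orP[vt|]; first by rewrite vt (le_trans vt tu) subrr mul0r.
by rewrite -ltNge => uv; rewrite (leNgt v u) uv (leNgt v t) (le_lt_trans tu uv) subrr mul0r.
Qed.

(** Backward from [t] over a time h: a kernel bounded by [kappa] on an interval of length
    h has variance O(kappa^2 h). *)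
Lemma innovation_small t h r (kappa : R) : 0 <= h -> 0 <= kappa ->
  (forall i x, - h <= x -> x <= 0 -> `|(E x *m B) r i| <= kappa) ->
  ip (innovation (t - h) t r) (innovation (t - h) t r) <=
  (\sum_i \sum_j `|S i j|) * (kappa ^+ 2 * h).
Proof.
move=> h0 k0 hk.
have [sf _ _] := innovation_levy_int (t - h) t r.
rewrite (levy_isometry HL HC (innovation_levy_int (t - h) t r) (innovation_levy_int (t - h) t r)).
pose c := ioc_indic ((t - h, t), 0 : 'rV[R]_k).
have sc : square_integrable leb c by exact: ioc_indic_sqi.
have ht : t - h <= t by rewrite lerBlDr lerDl.
have cc : ipl c c = h.
  by rewrite ioc_indic_ip //= maxxx minxx /Num.max; case: ltP; lra.
have bi i : ipl (innovation_kernel (t - h) t r i) (innovation_kernel (t - h) t r i) <= kappa ^+ 2 * h.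
  rewrite -[X in _ * X]cc -ip_sqrZ //.
  apply: le_Rintegral => //; [exact: sqi_mul|by apply: sqi_mul; exact: sqiZ|].
  move=> v _; rewrite -!expr2 -[leLHS]real_normK ?num_real // -[leRHS]real_normK ?num_real //.
  rewrite lerXn2r // ?nnegrE // normrM [leRHS]normrM (ger0_norm k0) /c /ioc_indic /=.
  have [vh|vh] := leP v (t - h).
    by rewrite (le_trans vh ht) subrr normr0 mul0r mulr_ge0.
  have [vt|vt] := leP v t; last by rewrite subrr normr0 mul0r mulr_ge0.
  rewrite sub0r normrN normr1 mul1r mulr1; apply: hk; lra.
rewrite mulr_suml; apply: ler_sum => i _; rewrite mulr_suml; apply: ler_sum => j _.
apply: (le_trans (ler_norm _)); rewrite normrM ler_wpM2l //.
set f := innovation_kernel _ _ _.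
have := bi i; have := bi j; have := ip_ge0 leb (fun v => f i v + f j v).
have := ip_ge0 leb (fun v => f i v - f j v).
rewrite ip_sqrB // ip_sqrD // ler_norml -/f; lra.
Qed.

Lemma state_lincomb_small t (a : 'I_n -> R) (eps : R) : (forall q, `|a q| <= eps) ->
  ip (fun w => \sum_q a q * X t q w) (fun w => \sum_q a q * X t q w) <=
  eps ^+ 2 * \sum_q \sum_q' `|ip (X t q) (X t q')|.
Proof.
move=> ha; have sX q := state_sqi t q.
have sZ q : sqi (fun w => a q * X t q w) by exact: sqiZ.
rewrite ip_suml //; last exact: sqi_sum.
rewrite mulr_sumr; apply: ler_sum => q _.
rewrite ip_sumr // mulr_sumr; apply: ler_sum => q' _.
rewrite ipZl // ipZr //; apply: (le_trans (ler_norm _)).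
rewrite !normrM mulrA ler_wpM2r // expr2 ler_pM //.
Qed.

Lemma is_derive_near (f : R -> R) (l eps : R) : is_derive (0 : R) 1 f l -> 0 < eps ->
  exists2 del : R, 0 < del & forall y, `|y| < del -> `|f y - f 0 - l * y| <= eps * `|y|.
Proof.
move=> [df fl] e0.
have H : (fun h : R => h^-1 *: ((f \o shift 0) (h *: (1 : R)) - f 0)) @ 0^' --> l.
  by rewrite -fl /derive; exact: df.
have H2 : nbhs (0 : R) (fun h : R => h != 0 ->
    `|l - h^-1 *: ((f \o shift 0) (h *: (1 : R)) - f 0)| < eps).
  by move/cvgrPdist_lt : H => /(_ _ e0); rewrite near_withinE; exact.
have [del /= d0 hd] := (nbhs_ballP (0 : R) _).1 H2; exists del => // y yd.
have [->|y0] := eqVneq y 0.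
  by rewrite subrr mulr0 subrr normr0 mulr0.
have := hd y; rewrite /ball /= sub0r normrN => /(_ yd y0).
rewrite addr0 -[y *: 1]/(y * 1) mulr1 -[y^-1 *: _]/(y^-1 * _) => h.
have -> : f y - f 0 - l * y = - ((l - y^-1 * (f y - f 0)) * y) by field.
by rewrite normrN normrM ler_wpM2r // ltW.
Qed.

(** When row [r] of [B] vanishes, the kernel e^{yA} B starts at 0 in that row, hence is
    O(y). *)
Lemma kernel_near0 r : (forall j, B r j = 0) -> exists2 K : R, 0 <= K &
  exists2 del : R, 0 < del & forall i y, `|y| < del -> `|(E y *m B) r i| <= K * `|y|.
Proof.
move=> Br0.
have hd i : is_derive (0 : R) 1 (fun y => (E y *m B) r i) ((A *m B) r i).
  have := bilinear_expmx_is_derive A 1%:M B 0 r i; rewrite mul1mx expmx0 mulmx1.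
  by under eq_fun do rewrite mul1mx.
have /choice[del hdel] : forall i, exists del : R, 0 < del /\
    forall y, `|y| < del -> `|(E y *m B) r i| <= (`|(A *m B) r i| + 1) * `|y|.
  move=> i; have [del d0 h] := is_derive_near (hd i) ltr01; exists del; split => // y yd.
  have := h y yd; rewrite expmx0 mul1mx Br0 subr0 mul1r => hy.
  have -> : (E y *m B) r i = ((E y *m B) r i - (A *m B) r i * y) + (A *m B) r i * y by ring.
  by apply: (le_trans (ler_normD _ _)); rewrite mulrDl mul1r normrM addrC lerD2l.
exists (\sum_i (`|(A *m B) r i| + 1)); first by apply: sumr_ge0 => i _; rewrite addr_ge0.
exists (\big[Num.min/1]_i del i).
  by apply: (big_ind (fun x : R => 0 < x)) => //= [x y x0 y0|i _]; [rewrite lt_min x0|have [] := hdel i].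
move=> i y yd; have [_ h] := hdel i; apply: (le_trans (h y _)).
  by apply: (lt_le_trans yd); rewrite (bigD1 i) //= ge_min lexx.
rewrite ler_wpM2r // [leRHS](bigD1 i) //= lerDl; apply: sumr_ge0 => j _.
by rewrite addr_ge0.
Qed.

(** The row of [A X(t)] is the mean square left derivative of [X r] at [t]. Indeed
    X(t-h) = e^{-hA} X(t) + innovation, so the difference quotient is A X(t) up to o(1)
    plus 1/h times an innovation of variance O(h^3), because its kernel is O(h) on an
    interval of length h. *)
Lemma rspan_derivative G t r : G `<=` sqi -> (forall j, B r j = 0) ->
  (forall s, s <= t -> rspan P G (X s r)) -> rspan P G (fun w => \sum_q A r q * X t q w).
Proof.
move=> sG Br0 hG.
have sX q := state_sqi t q.
have sAX : sqi (fun w => \sum_q A r q * X t q w) by apply: sqi_sum => q; exact: sqiZ.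
apply: rspan_closed => // e e0.
pose V := \sum_q \sum_q' `|ip (X t q) (X t q')|.
have V0 : 0 <= V by apply: sumr_ge0 => q _; apply: sumr_ge0.
pose C := \sum_i \sum_j `|S i j|.
have C0 : 0 <= C by apply: sumr_ge0 => q _; apply: sumr_ge0.
have [K K0 [del1 d10 hK]] := kernel_near0 Br0.
pose eps := Num.min 1 (e / (8 * (V + 1))).
have eps0 : 0 < eps by rewrite lt_min ltr01 divr_gt0 // mulr_gt0 // ltr_wpDl.
have epsV : eps ^+ 2 * V <= e / 8.
  apply: (@le_trans _ _ (eps * (V + 1))).
    have e1 : eps <= 1 by rewrite ge_min lexx.
    rewrite expr2 -mulrA ler_pM2l //; have := ler_piMl V0 e1; lra.
  have : eps <= e / (8 * (V + 1)) by rewrite ge_min lexx orbT.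
  rewrite -(@ler_pM2r _ (V + 1)) ?ltr_wpDl //; move=> h; apply: (le_trans h).
  by rewrite le_eqVlt; apply/orP; left; apply/eqP; field; rewrite gt_eqF // ltr_wpDl.
have hd q : is_derive (0 : R) 1 (fun y => E y r q) (A r q).
  have := expmx_is_derive A 0 r q; by rewrite expmx0 mulmx1.
have /choice[del hdel] : forall q, exists del : R, 0 < del /\
    forall y, `|y| < del -> `|E y r q - E 0 r q - A r q * y| <= eps * `|y|.
  by move=> q; have [del d0 h] := is_derive_near (hd q) eps0; exists del.
(* Halving makes the strict inequalities available. *)
pose h := Num.min (\big[Num.min/1]_q del q) (Num.min del1 (e / (8 * (C * K ^+ 2 + 1)))) / 2.
have dq0 : 0 < \big[Num.min/1]_q del q.
  by apply: (big_ind (fun x : R => 0 < x)) => //= [x y x0 y0|i _]; [rewrite lt_min x0|have [] := hdel i].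
have CK0 : 0 < C * K ^+ 2 + 1 by rewrite ltr_wpDl // mulr_ge0 // sqr_ge0.
have h2 : 0 < h *+ 2.
  by rewrite /h -mulr_natr divfK // !lt_min dq0 d10 divr_gt0 // mulr_gt0.
have h0 : 0 < h by move: h2; rewrite pmulrn_lgt0.
have [hq h1 hC] : [/\ forall q, h < del q, h < del1 & h < e / (8 * (C * K ^+ 2 + 1))].
  have hh : h < h *+ 2 by rewrite mulr2n ltrDl.
  have : h *+ 2 <= Num.min (\big[Num.min/1]_q del q) (Num.min del1 (e / (8 * (C * K ^+ 2 + 1)))).
    by rewrite /h -mulr_natr divfK.
  rewrite !le_min => /and3P[H1 H2 H3]; split; [|exact: lt_le_trans H2|exact: lt_le_trans H3].
  move=> q; apply: (lt_le_trans hh); apply: (le_trans H1).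
  by rewrite (bigD1 q) //= ge_min lexx.
(* The coefficients of the error in the expansion of e^{-hA}. *)
pose a q := A r q - h^-1 * ((r == q)%:R - E (- h) r q).
have ha q : `|a q| <= eps.
  have [_ /(_ (- h))] := hdel q; rewrite normrN gtr0_norm // => /(_ (hq q)).
  rewrite expmx0 [X in _ - X - _]mxE => H.
  have -> : a q = h^-1 * (E (- h) r q - (r == q)%:R - A r q * - h).
    by rewrite /a; field; rewrite gt_eqF.
  rewrite normrM gtr0_norm ?invr_gt0 // mulrC ler_pdivrMr //; exact: H.
exists (fun w => h^-1 * (X t r w - X (t - h) r w)).
  by apply: rspanZ => //; apply: rspanB => //; apply: hG => //; rewrite lerBlDr lerDl ltW.
have sD := innovation_sqi (t - h) t r.
have sa : sqi (fun w => \sum_q a q * X t q w) by apply: sqi_sum => q; exact: sqiZ.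
have -> : (fun w => \sum_q A r q * X t q w - h^-1 * (X t r w - X (t - h) r w)) =
   (fun w => \sum_q a q * X t q w + h^-1 * innovation (t - h) t r w).
  apply/funext => w; rewrite /innovation /a.
  have -> : t - h - t = - h by ring.
  under [X in _ = X + _]eq_bigr do rewrite mulrBl -mulrA mulrBl.
  rewrite sumrB -mulr_sumr sumrB.
  have -> : \sum_q (r == q)%:R * X t q w = X t r w.
    rewrite (bigD1 r) //= eqxx mul1r big1 ?addr0 // => q qr.
    by rewrite eq_sym (negbTE qr) mul0r.
  ring.
apply: (le_lt_trans (ip_sqrD_le sa (sqiZ h^-1 sD))); rewrite ip_sqrZ //.
have H1 := state_lincomb_small t ha; rewrite -/V in H1.
have H2 : ip (innovation (t - h) t r) (innovation (t - h) t r) <= C * ((K * h) ^+ 2 * h).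
  apply: innovation_small; [exact: ltW|by rewrite mulr_ge0 // ltW|].
  move=> i x hx x0; apply: (le_trans (hK i x _)).
    by rewrite ler0_norm //; apply: le_lt_trans h1; lra.
  by rewrite ler_wpM2l // ler0_norm //; lra.
have H3 : h^-1 ^+ 2 * ip (innovation (t - h) t r) (innovation (t - h) t r) <= e / 8.
  apply: (@le_trans _ _ (h^-1 ^+ 2 * (C * ((K * h) ^+ 2 * h)))).
    by rewrite ler_wpM2l // sqr_ge0.
  have -> : h^-1 ^+ 2 * (C * ((K * h) ^+ 2 * h)) = C * K ^+ 2 * h by field; rewrite gt_eqF.
  apply: (@le_trans _ _ ((C * K ^+ 2 + 1) * h)); first by rewrite ler_wpM2r ?lerDl // ltW.
  move: hC; rewrite ltr_pdivlMr ?mulr_gt0 //; lra.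
lra.
Qed.

End state.

Lemma continuous_itv_sqi (R : realType) (g : R -> R) (s t : R) : continuous g ->
  square_integrable (@lebesgue_measure R) (fun v => (s < v <= t)%R%:R * g v).
Proof.
move=> cg.
have mg : measurable_fun [set: R] g by exact: continuous_measurable_fun.
have E v : (s < v <= t)%R%:R = \1_(`]s, t]%classic) v :> R.
  by rewrite indicE; congr (_%:R); congr nat_of_bool; apply/idP/idP; rewrite inE /= in_itv.
split.
  under eq_fun do rewrite E.
  by apply: measurable_funM => //; exact: measurable_indic.
have cg2 : {within `[s, t], continuous (fun v => g v ^+ 2)}.
  apply: continuous_subspaceT => v; rewrite (_ : (fun v => g v ^+ 2) = g \* g); last first.
    by apply/funext => y; rewrite expr2.
  by apply: cvgM; exact: cg.
have := continuous_compact_integrable (@segment_compact _ s t) cg2.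
move=> /integrableP[_]; apply: le_lt_trans.
rewrite [leRHS]integral_mkcond; apply: ge0_le_integral => //=.
- by move=> v _; rewrite lee_fin sqr_ge0.
- apply/measurable_EFinP; apply: measurable_funX; under eq_fun do rewrite E.
  by apply: measurable_funM => //; exact: measurable_indic.
- apply/(measurable_restrictT _ _).1 => //.
  apply/measurable_EFinP; apply: measurableT_comp => //; apply: measurable_funTS.
  exact: measurable_funX.
- move=> v _; rewrite patchE; case: ifPn => [_|].
    rewrite lee_fin exprMn -[leRHS](mul1r) ger0_norm ?sqr_ge0 // ler_wpM2r ?sqr_ge0 //.
    by case: (_ && _); rewrite ?expr1n ?expr0n.
  rewrite notin_setE /= in_itv /= => /negP h; rewrite lee_fin.
  have -> : (s < v <= t) = false.
    by apply/negbTE; apply: contra h => /andP[/ltW -> ->].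
  by rewrite mul0r expr0n.
Qed.

(** * Which coordinates of the state lie in a past *)

Section pow.
Context (R : realType).

Definition divpow (m : nat) (v : R) : R := v ^+ m / m`!%:R.

Lemma divpow_is_derive m (s v : R) :
  is_derive v 1 (fun v => divpow m.+1 (v - s)) (divpow m (v - s)).
Proof.
have h1 := is_deriveB (is_derive_id v (1 : R)) (is_derive_cst s v (1 : R)).
have h2 := is_deriveX m.+1 h1.
have h3 := is_deriveZ m.+1`!%:R^-1 h2.
have h4 : (m.+1%:R : R) != 0 by rewrite pnatr_eq0.
have h5 : (m`!%:R : R) != 0 by rewrite pnatr_eq0 -lt0n fact_gt0.
move: h3; set F := (X in is_derive _ _ X _) => h3.
have -> : (fun v => divpow m.+1 (v - s)) = F.
  by apply/funext => y; rewrite /F /divpow exprfctE /= mulrC.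
apply: (is_derive_eq h3).
rewrite subr0 /divpow /= factS natrM invfM /GRing.scale /= mulr1.
rewrite -[(id - cst s) v]/(v - s); move: h4 h5; move: (m.+1%:R : R) (m`!%:R : R) ((v - s) ^+ m).
by move=> a b c ha hb; field; rewrite hb ha.
Qed.

End pow.

Section mcar.
Context d (T : measurableType d) (R : realType) (P : probability T R) (k p : nat).
Variable L : R -> 'I_k -> T -> R.
Hypothesis HL : is_two_sided_levy P L.
Hypothesis HC : centered_sq_integrable P L.
Hypothesis hp : (0 < p)%N.
Variable Ac : 'I_p -> 'M[R]_k.
Notation n := (\sum_(i < p) k)%N.
Notation A := (mcarA Ac).
Notation B := (mcarB R k p).
Notation S := (SigmaL P L).
Hypothesis HS : posdef S.
Variable X : R -> 'I_n -> T -> R.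
Hypothesis HX : forall t r,
  is_integral_upto P L (fun u => row r (expmx ((t - u) *: A) *m B)) t (X t r).
Notation sqi := (square_integrable P).
Notation leb := (@lebesgue_measure R).
Notation ip := (l2ip P).
Notation ipl := (l2ip leb).
Notation E x := (expmx (x *: A)).
Notation i0 := (Ordinal hp).

Definition past (D : set 'I_k) (t : R) : set (T -> R) :=
  [set g | exists i u, [/\ D i, u <= t & g = X u (blk i0 i)]].

Lemma past_sqi D t : past D t `<=` sqi.
Proof. by move=> _ [i [u [_ _ ->]]]; exact: (state_sqi HL HC HX). Qed.

(** By induction on the block: each block of the state is the left derivative of the block
    before it, as the companion matrix shifts blocks and [B] feeds only the last one. *)
Lemma state_past (D : set 'I_k) (t : R) (j : 'I_p) i : D i -> rspan P (past D t) (X t (blk j i)).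
Proof.
move=> Di; case: j => j hj; elim: j hj t => [|j ih] hj t.
  apply: rspan_gen; first exact: past_sqi.
  exists i, t; split => //; congr (X t (blk _ _)); exact: val_inj.
have hj' : (j < p)%N by exact: ltnW.
have := @rspan_derivative _ _ _ _ _ _ _ HL HC A B X HX (past D t) t (blk (Ordinal hj') i)
  (@past_sqi D t).
have -> : (fun w => \sum_q A (blk (Ordinal hj') i) q * X t q w) = X t (blk (Ordinal hj) i).
  apply/funext => w; rewrite sum_blk (bigD1 (Ordinal hj)) //= (bigD1 i) //=.
  rewrite mcarA_blk /= hj eqxx mxE eqxx mul1r.
  rewrite [X in _ + X + _]big1 ?addr0 => [|i' ii]; last first.
    by rewrite mcarA_blk /= hj eqxx mxE [i == i']eq_sym (negbTE ii) mul0r.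
  rewrite [X in _ + X]big1 ?addr0 // => j' jj; apply: big1 => i' _.
  by rewrite mcarA_blk /= hj -[j' == j.+1 :> nat]/(j' == Ordinal hj) (negbTE jj) mxE mul0r.
apply.
  by move=> i'; rewrite mcarB_blk /= (ltn_eqF hj).
move=> s st; apply: rspan_mono (ih hj' s).
by move=> _ [i' [u [Di' us ->]]]; exists i', u; split => //; exact: le_trans st.
Qed.

Let jlast : 'I_p := rev_ord i0.

Let jlastE : jlast.+1 = p.
Proof. by rewrite /jlast /= subn1 prednK. Qed.

Section steering.
Variables (a : 'I_k) (s t : R).
Hypothesis st : s < t.

(** A trajectory of the control system x' = A x + B w that starts at 0 at time [s] and
    moves coordinate [a] of each block only: in block j it is (v - s)^(p-j) / (p-j)!, each block
    being the derivative of the previous one. *)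
Definition steer (v : R) : 'cV[R]_n :=
  \col_q (((tagnat.sig2 q : 'I_k) == a)%:R * divpow (p - tagnat.sig1 q) (v - s)).

Let steer_blk v j i : steer v (blk j i) ord0 = (i == a)%:R * divpow (p - j) (v - s).
Proof.
have : blk (tagnat.sig1 (blk j i)) (tagnat.sig2 (blk j i)) = blk j i by exact: tagnat.sig2K.
by rewrite mxE; move/eqP; rewrite blk_eq => /andP[/eqP -> /eqP ->].
Qed.

(** Only the last block of the system is controlled, and the control makes its derivative
    equal to 1 in coordinate [a] and 0 in the others. *)
Definition control (v : R) : 'cV[R]_k :=
  \col_i ((i == a)%:R - (A *m steer v) (blk jlast i) ord0).

Let steer_is_derive (v : R) q :
  is_derive v 1 (fun v => steer v q ord0) ((A *m steer v + B *m control v) q ord0).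
Proof.
have [j [i ->]] := blkP q.
rewrite (_ : (fun v => _) = (fun v => (i == a)%:R *: divpow (p - j) (v - s))); last first.
  by apply/funext => y; rewrite steer_blk.
have pj : (p - j = (p - j.+1).+1)%N by have := ltn_ord j; lia.
have := is_deriveZ (i == a)%:R (divpow_is_derive (p - j.+1) s v).
rewrite -pj => h; apply: (is_derive_eq h).
rewrite mxE [X in _ = _ + X]mxE.
have Bw : \sum_l B (blk j i) l * control v l ord0 = (j.+1 == p)%:R * control v i ord0.
  rewrite (bigD1 i) //= mcarB_blk eqxx andbT big1 ?addr0 // => l li.
  by rewrite mcarB_blk [i == l]eq_sym (negbTE li) andbF mul0r.
rewrite Bw; have [jp|jp] := eqVneq j.+1 p.
  have -> : j = jlast by apply/val_inj/succn_inj; rewrite jlastE.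
  rewrite [X in _ = _ + _ * X]mxE mul1r [RHS]addrC [RHS]subrK jlastE subnn.
  by rewrite /divpow expr0 fact0 divr1 /GRing.scale /= mulr1.
have hj : (j.+1 < p)%N by rewrite ltn_neqAle jp ltn_ord.
rewrite mul0r addr0 [RHS]mxE sum_blk (bigD1 (Ordinal hj)) //= (bigD1 i) //=.
rewrite mcarA_blk hj eqxx mxE eqxx mul1r steer_blk.
rewrite [X in _ = _ + X + _]big1 ?addr0 => [|i' ii]; last first.
  by rewrite mcarA_blk hj eqxx mxE [i == i']eq_sym (negbTE ii) mul0r.
rewrite [X in _ = _ + X]big1 ?addr0 // => j' jj; apply: big1 => i' _.
by rewrite mcarA_blk hj -[j' == j.+1 :> nat]/(j' == Ordinal hj) (negbTE jj) mxE mul0r.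
Qed.

Let steer_continuous q : continuous (fun v => steer v q ord0).
Proof. by move=> v; apply: is_derive_continuous; exact: steer_is_derive. Qed.

Lemma control_continuous i : continuous (fun v => control v i ord0).
Proof.
rewrite (_ : (fun v => _) = (fun v => (i == a)%:R - \sum_q A (blk jlast i) q * steer v q ord0)); last first.
  by apply/funext => v; rewrite !mxE.
move=> v; apply: cvgB; first exact: cvg_cst.
by apply: cvg_sumr => q; apply: cvgMr; exact: steer_continuous.
Qed.

(** The derivative of v |-> e^{A(u-v)} x(v) along the trajectory; integrating it gives the
    variation of constants formula. *)
Let drive (u v : R) r := \sum_i (E (u - v) *m B) r i * control v i ord0.

Let drive_continuous u r : continuous (fun v => drive u v r).
Proof.
rewrite /drive => v.
apply: cvg_sumr => i; apply: cvgM; last exact: control_continuous.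
apply: (@continuous_comp _ _ _ (fun v : R => u - v) (fun x : R => (E x *m B) r i)).
  by apply: cvgB; [exact: cvg_cst|exact: cvg_id].
exact: kernel_continuous.
Qed.

Let expmx_back_is_derive (u v : R) r q :
  is_derive v 1 (fun v => E (u - v) r q) (- (A *m E (u - v)) r q).
Proof.
have := @is_derive1_comp _ (fun x => E x r q) (fun x => u - x) v
  ((A *m E (u - v)) r q) (-1) (expmx_is_derive _ _ _ _).
rewrite mulrN1; apply.
have := is_deriveB (is_derive_cst u v (1 : R)) (is_derive_id v (1 : R)).
by rewrite sub0r.
Qed.

Let steer_ode (u v : R) r :
  is_derive v 1 (fun v => (E (u - v) *m steer v) r ord0) (drive u v r).
Proof.
have Ef : (fun v => (E (u - v) *m steer v) r ord0) =
    \sum_q (fun v => E (u - v) r q * steer v q ord0).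
  by apply/funext => y; rewrite mxE fct_sumE.
rewrite Ef.
have h : is_derive v 1 (\sum_q (fun v => E (u - v) r q * steer v q ord0)) _ :=
  is_derive_sum (fun q => is_deriveM (expmx_back_is_derive u v r q) (steer_is_derive v q)).
apply: (is_derive_eq h).
rewrite big_split /=.
have -> : \sum_q E (u - v) r q *: (A *m steer v + B *m control v) q ord0 =
   (E (u - v) *m (A *m steer v + B *m control v)) r ord0 by rewrite [RHS]mxE.
have -> : \sum_q steer v q ord0 *: (- (A *m E (u - v)) r q) =
   - (A *m E (u - v) *m steer v) r ord0.
  rewrite [in RHS]mxE -sumrN; apply: eq_bigr => q _.
  by rewrite scalerN [_ *: _]mulrC.
rewrite mulmx_expmxC mulmxDr !mulmxA mxE addrAC subrr add0r.
by rewrite mxE.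
Qed.

Let steer_s r : steer s r ord0 = 0.
Proof.
have [j [i ->]] := blkP r; rewrite steer_blk subrr /divpow.
have -> : (p - j = (p - j.+1).+1)%N by have := ltn_ord j; lia.
by rewrite expr0n /= mul0r mulr0.
Qed.

Let steer_integral u r : s < u ->
  \int[leb]_(v in `]s, u]%classic) drive u v r = steer u r ord0.
Proof.
move=> su; rewrite Rintegral_itv_obnd_cbnd; last first.
  have iD : leb.-integrable `[s, u]%classic (EFin \o (fun v => drive u v r)).
    apply: continuous_compact_integrable; first exact: segment_compact.
    by apply: continuous_subspaceT; exact: drive_continuous.
  apply: integrableS iD => //.
  by apply: subset_itvr; rewrite bnd_simp.
rewrite /Rintegral (@continuous_FTC2 _ _ (fun v => (E (u - v) *m steer v) r ord0)) //=.
- rewrite subrr expmx0 mul1mx [X in _ - X]mxE [X in _ - X]big1 ?subr0 // => q _.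
  by rewrite steer_s mulr0.
- by apply: continuous_subspaceT; exact: drive_continuous.
- have cE : continuous (fun v => (E (u - v) *m steer v) r ord0).
    by move=> v; apply: is_derive_continuous; exact: steer_ode.
  split.
  + by move=> v _; have [] := steer_ode u v r.
  + by apply: cvg_at_right_filter; exact: cE.
  + by apply: cvg_at_left_filter; exact: cE.
- move=> v _; rewrite derive1E; exact: derive_val.
Qed.

(** Applying the inverse of [S] cancels the weight of the form, so pairing with a state
    kernel returns the integral of e^{A(u-v)} B w(v). *)
Definition test_fun (i : 'I_k) (v : R) : R :=
  (s < v <= t)%R%:R * (invmx S *m control v) i ord0.

Lemma test_fun_sqi i : square_integrable leb (test_fun i).
Proof.
apply: continuous_itv_sqi.
rewrite (_ : (fun v => _) = (fun v => \sum_j invmx S i j * control v j ord0)); last first.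
  by apply/funext => v; rewrite mxE.
by move=> v; apply: cvg_sumr => j; apply: cvgMr; exact: control_continuous.
Qed.

(** Variation of constants: the pairing is the state to which the control has brought the
    system at time [u], and the system is at rest before [s]. *)
Lemma bform_test_fun u r : u <= t ->
  bform S (state_kernel A B u r) test_fun = (s < u)%R%:R * steer u r ord0.
Proof.
move=> ut; have [sk _ _] := state_levy_int HL HC HX u r.
rewrite bform_integral //; last exact: test_fun_sqi.
transitivity (\int[leb]_(v in `]s, u]%classic) drive u v r); last first.
  have [su|us] := ltP s u; first by rewrite steer_integral // mul1r.
  by rewrite set_itv_ge ?Rintegral_set0 ?mul0r // bnd_simp -leNgt.
rewrite [RHS]Rintegral_mkcond; apply: eq_Rintegral => v _; rewrite patchE.
have Sw : S *m (invmx S *m control v) = control v.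
  by rewrite mulmxA mulmxV ?mul1mx // (posdef_unitmx HS).
transitivity ((v <= u)%R%:R * (s < v <= t)%R%:R * drive u v r).
  rewrite /drive -[in RHS]Sw mulr_sumr; apply: eq_bigr => i _.
  rewrite [X in _ = _ * (_ * X)]mxE !mulr_sumr; apply: eq_bigr => j _.
  by rewrite /state_kernel /test_fun; ring.
case: ifPn => [|vt].
  by rewrite inE /= in_itv /= => /andP[-> vu]; rewrite vu (le_trans vu ut) !mul1r.
move: vt; rewrite notin_setE /= in_itv /= => /negP; rewrite negb_and => /orP[|] /negbTE ->.
  by rewrite mulr0 mul0r.
by rewrite !mul0r.
Qed.

(** Pairing integrands with the test function is a bounded functional on integrals, by the
    isometry and Cauchy-Schwarz. It kills the past of every coordinate other than [a],
    since the trajectory has no such coordinates; hence it kills the whole closed span, while on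
    the combination of the blocks of coordinate [a] it is a combination of the steered
    values. *)
Lemma rspan_past_steer (D : set 'I_k) (c : 'I_p -> R) : ~ D a ->
  rspan P (past D t) (fun w => \sum_j c j * X t (blk j a) w) ->
  \sum_j c j * divpow (p - j) (t - s) = 0.
Proof.
move=> Da [_ hZ].
have hF := levy_int_sum HL HC (index_enum 'I_p) c (fun j => state_levy_int HL HC HX t (blk j a)).
set F0 := (X in levy_int _ _ X) in hF; set Z0 := (X in levy_int _ _ _ X) in hF.
have [sF0 sZ0 _] := hF; have sT := test_fun_sqi.
pose b := \sum_j c j * divpow (p - j) (t - s).
have bF0 : bform S F0 test_fun = b.
  have sk j := let: And3 h _ _ := state_levy_int HL HC HX t (blk j a) in h.
  have H js : bform S (fun i v => \sum_(j <- js) c j * state_kernel A B t (blk j a) i v) test_fun =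
      \sum_(j <- js) c j * bform S (state_kernel A B t (blk j a)) test_fun.
    elim: js => [|j js ih].
      rewrite big_nil /bform big1 // => i _; apply: big1 => j _.
      under [X in l2ip _ X]eq_fun do rewrite big_nil.
      by rewrite ip0l mulr0.
    rewrite big_cons -ih -bformDl //; last first.
      by move=> i; apply: sqi_sum => j'; apply: sqiZ.
    rewrite /bform; apply: eq_bigr => i _; apply: eq_bigr => j' _; congr (_ * l2ip _ _ _).
    by apply/funext => v; rewrite big_cons.
  rewrite /F0 H.
  apply: eq_bigr => j _; rewrite bform_test_fun // st mul1r steer_blk eqxx mul1r.
  by [].
(* The functional is defined on integrands, so each element of the span carries one. *)
have hs Z : lspan (past D t) Z -> exists2 F, levy_int P L F Z & bform S F test_fun = 0.
  elim=> [|e g {}Z [i [u [Di ut ->]]] _ [F hFZ bF]].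
    exists (fun=> fun=> 0); first exact: levy_int0.
    by rewrite /bform big1 // => i _; apply: big1 => j _; rewrite ip0l mulr0.
  exists (fun i' v => e * state_kernel A B u (blk i0 i) i' v + F i' v).
    exact: (levy_intD HL HC e (state_levy_int HL HC HX u (blk i0 i)) hFZ).
  have [sF _ _] := hFZ; have [sk _ _] := state_levy_int HL HC HX u (blk i0 i).
  rewrite bformDl // bF bform_test_fun // steer_blk.
  have -> : (i == a) = false by apply/negbTE/eqP => ia; apply: Da; rewrite -ia.
  by rewrite mul0r !mulr0 addr0.
apply/eqP; rewrite -/b -sqrf_eq0 eq_le sqr_ge0 andbT; apply/ler_addgt0Pl => e e0; rewrite addr0.
have T0 := bform_ge0 HS sT.
have e1 : 0 < e / (bform S test_fun test_fun + 1) by rewrite divr_gt0 // ltr_wpDl.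
have [Z /hs[F hFZ bF] ZZ] := hZ _ e1; have [sF _ _] := hFZ.
have hD := levy_intD HL HC (-1) hFZ hF.
set FD := (X in levy_int _ _ X) in hD; set ZD := (X in levy_int _ _ _ X) in hD.
have [sFD _ _] := hD.
have EZ : ip ZD ZD = bform S FD FD by rewrite (levy_isometry HL HC hD hD).
have bFD : bform S FD test_fun = b by rewrite bformDl // bF bF0 mulr0 add0r.
rewrite -bFD; apply: (le_trans (bform_cauchy_schwarz HS sFD sT)).
rewrite -EZ; have ZDe : ip ZD ZD < e / (bform S test_fun test_fun + 1).
  apply: le_lt_trans ZZ; rewrite le_eqVlt; apply/orP; left; apply/eqP.
  by apply: eq_Rintegral => w _; rewrite /ZD /Z0; ring.
have T1 : 0 < bform S test_fun test_fun + 1 by rewrite ltr_wpDl.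
move: ZDe; rewrite ltr_pdivlMr //; have := ip_ge0 P ZD; nra.
Qed.

End steering.

(** A polynomial that vanishes on (0, oo) is zero. *)
Lemma divpow_sum_eq0 (c : 'I_p -> R) :
  (forall v : R, 0 < v -> \sum_j c j * divpow (p - j) v = 0) -> forall j, c j = 0.
Proof.
move=> h.
pose q : {poly R} := \sum_(j < p) (c j / (p - j)`!%:R) *: 'X^(p - j).
have qv (v : R) : q.[v] = \sum_j c j * divpow (p - j) v.
  rewrite horner_sum; apply: eq_bigr => j _; rewrite hornerZ hornerXn /divpow; ring.
have q0 : q = 0.
  apply: (@roots_geq_poly_eq0 _ _ [seq m.+1%:R | m <- iota 0 (size q)]).
  - by apply/allP => _ /mapP[m _ ->]; rewrite /root qv h.
  - by rewrite map_inj_uniq ?iota_uniq // => x y /eqP; rewrite eqr_nat => /eqP [].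
  - by rewrite size_map size_iota.
move=> j; have := congr1 (fun q' : {poly R} => q'`_(p - j)) q0.
rewrite coef0 coef_sum (bigD1 j) //= coefZ coefXn eqxx mulr1 big1 ?addr0.
  move/eqP; rewrite mulf_eq0 invr_eq0 pnatr_eq0 [_`! == _]eqn0Ngt fact_gt0 orbF => /eqP //.
move=> i ij; rewrite coefZ coefXn; case: eqP => [e|_]; last by rewrite mulr0.
by move: ij; rewrite -val_eqE /=; have := ltn_ord i; have := ltn_ord j; lia.
Qed.

(** The start [s] of the steering is free, so the relation is a polynomial identity in
    t - s. *)
Lemma rspan_past_indep (D : set 'I_k) (c : 'I_p -> R) a t : ~ D a ->
  rspan P (past D t) (fun w => \sum_j c j * X t (blk j a) w) -> forall j, c j = 0.
Proof.
move=> Da h; apply: divpow_sum_eq0 => v v0.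
have tv : t - v < t by rewrite ltrBlDr ltrDl.
have := rspan_past_steer tv Da h.
by have -> : t - (t - v) = v by ring.
Qed.

End mcar.

(** * Coefficient criteria for the state process *)

Lemma trmx_pow (R : realType) n (M : 'M[R]_n) m : (M^T) ^+ m = (M ^+ m)^T.
Proof.
elim: m => [|m ih]; first by rewrite !expr0 trmx1.
by rewrite mxpowS ih mxpowSr trmx_mul.
Qed.

Section two_powers.
Context (R : realType) (n : nat) (M Q : 'M[R]_n) (i j : 'I_n).
Notation E x := (expmx (x *: M)).

Let tr (U V : 'M[R]_n) : (U *m Q *m V^T) i j = (1%:M *m V *m (U *m Q)^T) j i.
Proof. by rewrite mul1mx -[V in RHS]trmxK -trmx_mul [RHS]mxE. Qed.

Let tl (U V : 'M[R]_n) : (U *m Q *m V^T) i j = (1%:M *m U *m (Q *m V^T)) i j.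
Proof. by rewrite mul1mx mulmxA. Qed.

(** Treat the two sides of [Q] in turn: with one factor fixed the entry is of the form
    handled for a single exponential. *)
Lemma two_powers_expmx_eq0 :
  (forall a b, (a <= n - 1)%N -> (b <= n - 1)%N -> (M ^+ a *m Q *m (M ^+ b)^T) i j = 0) ->
  forall x y : R, (E x *m Q *m (E y)^T) i j = 0.
Proof.
move=> h x y.
rewrite tr; apply: bilinear_expmx_pow_eq0; apply: cayley_hamilton_span => b hb.
rewrite -tr tl; apply: bilinear_expmx_pow_eq0; apply: cayley_hamilton_span => a ha.
by rewrite -tl; exact: h.
Qed.

(** The triangle 0 < x < y < 1 suffices: with y fixed, all derivatives in x at 0 vanish,
    and then those in y. *)
Lemma expmx_two_powers_eq0 :
  (forall x y : R, 0 < x -> x < y -> y < 1 -> (E x *m Q *m (E y)^T) i j = 0) ->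
  forall a b, (M ^+ a *m Q *m (M ^+ b)^T) i j = 0.
Proof.
move=> h a b; rewrite tr.
apply: (@bilinear_expmx_eq0 _ _ _ _ _ _ _ _ _ 1 ltr01) => y y0 y1.
rewrite -tr tl.
apply: (@bilinear_expmx_eq0 _ _ _ _ _ _ _ _ _ y y0) => x x0 xy.
by rewrite -tl; exact: h.
Qed.

End two_powers.

Section coefficients.
Context d (T : measurableType d) (R : realType) (P : probability T R) (k p : nat).
Variable L : R -> 'I_k -> T -> R.
Hypothesis HL : is_two_sided_levy P L.
Hypothesis HC : centered_sq_integrable P L.
Hypothesis hp : (0 < p)%N.
Variable Ac : 'I_p -> 'M[R]_k.
Notation n := (\sum_(i < p) k)%N.
Notation A := (mcarA Ac).
Notation B := (mcarB R k p).
Notation S := (SigmaL P L).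
Hypothesis HS : posdef S.
Variable X : R -> 'I_n -> T -> R.
Hypothesis HX : forall t r,
  is_integral_upto P L (fun u => row r (expmx ((t - u) *: A) *m B)) t (X t r).
Notation sqi := (square_integrable P).
Notation leb := (@lebesgue_measure R).
Notation ip := (l2ip P).
Notation E x := (expmx (x *: A)).
Notation i0 := (Ordinal hp).
Notation past := (past hp X).
Notation innov := (innovation A X).

Let sX t r : sqi (X t r) := state_sqi HL HC HX t r.
Let sN u t r : sqi (innov u t r) := innovation_sqi HL HC HX u t r.
Let sP D t : past D t `<=` sqi := @past_sqi _ _ _ _ _ _ _ HL HC hp Ac X HX D t.

Let spred t u r : sqi (fun w => \sum_q E (u - t) r q * X t q w).
Proof. by apply: sqi_sum => q; exact: sqiZ. Qed.

Lemma innovation_past_orth D u t r W : t <= u -> rspan P (past D t) W -> ip (innov u t r) W = 0.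
Proof.
move=> tu; apply: rspan_orth => //.
by move=> _ [i [s [_ st ->]]]; exact: (innovation_orth HL HC HX).
Qed.

(** The predictor e^{A(u-t)} X(t) involves only coordinates in [D], all of which lie in the
    span, and the innovation is orthogonal to it. *)
Lemma predictor_rproj (D : set 'I_k) u t r : t <= u ->
  (forall j i, ~ D i -> E (u - t) r (blk j i) = 0) ->
  rproj P (past D t) (X u r) (fun w => \sum_q E (u - t) r q * X t q w).
Proof.
move=> tu h0; split; last by move=> W; exact: innovation_past_orth.
apply: rspan_sum => // q; have [j [i ->]] := blkP q.
have [Di|nDi] := pselect (D i).
  apply: rspanZ => //; exact: (state_past HL HC hp HX).
by rewrite h0 //; under eq_fun do rewrite mul0r; exact: rspan0.
Qed.

Lemma rproj_residual (D : set 'I_k) u t r z y : t <= u -> sqi y ->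
  (forall j i, ~ D i -> E (u - t) r (blk j i) = 0) ->
  rproj P (past D t) (X u r) z -> ip (fun w => X u r w - z w) y = ip (innov u t r) y.
Proof.
move=> tu sy h0 hz; have hz' := predictor_rproj tu h0.
have [[sz _] _] := hz.
have := ip_null (sqiB sz (spred t u r)) sy (rproj_uniq (@sP D t) (sX u r) hz hz').
rewrite /innovation ipBl // ipBl // ipBl //; lra.
Qed.

Definition window (D : set 'I_k) (t : R) : set (T -> R) :=
  [set g | exists i u, [/\ D i, t <= u <= t + 1 & g = X u (blk i0 i)]].

(** The residual of Y_b(u) on the past without [a] is orthogonal to that past by
    definition and to the past of [a] by hypothesis, hence to the full past; so the
    projection on the smaller past is the full predictor. The predictor is therefore in
    the closed span of the past without [a], and so is its part on the other coordinates;
    what remains is a combination of the blocks of coordinate [a], whose coefficients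
    must vanish. *)
Lemma granger_coef_eq0 (a b : 'I_k) :
  (forall t x y z, window [set b] t x -> past [set a] t y ->
    rproj P (past [set i | i != a] t) x z -> ip (fun w => x w - z w) y = 0) ->
  forall al j, (A ^+ al) (blk i0 b) (blk j a) = 0.
Proof.
move=> h al j; rewrite -[A ^+ al]mul1mx -[1%:M *m _]mulmx1.
apply: (@bilinear_expmx_eq0 _ _ _ _ _ _ _ _ _ 1 ltr01) => x x0 x1.
rewrite mul1mx mulmx1; move: j.
pose D := [set i : 'I_k | i != a].
have nDa : ~ D a by rewrite /D /= eqxx.
apply: (rspan_past_indep HL HC HS HX (t := 0) nDa).
have [z hz] := rproj_exists (@sP D 0) (sX x (blk i0 b)).
have [Gz oz] := hz; have [sz _] := Gz.
pose pred w := \sum_q E (x - 0) (blk i0 b) q * X 0 q w.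
have spr : sqi pred by exact: spred.
have Gpr : rspan P (past setT 0) pred.
  by have [] := @predictor_rproj setT x 0 (blk i0 b) (ltW x0) (fun _ _ h => False_ind _ (h I)).
have Dsub : past D 0 `<=` past setT 0.
  by move=> _ [i [u [_ us ->]]]; exists i, u.
have W0 : ip (fun w => pred w - z w) (fun w => pred w - z w) = 0.
  have GW : rspan P (past setT 0) (fun w => pred w - z w).
    by apply: rspanB => //; exact: rspan_mono Gz.
  have [sW _] := GW.
  have o1 : ip (fun w => X x (blk i0 b) w - z w) (fun w => pred w - z w) = 0.
    apply: (rspan_orth (@sP setT 0) _ _ GW); first exact: sqiB.
    move=> _ [i [u [_ us ->]]]; have [->|ia] := eqVneq i a.
      apply: (h 0 (X x (blk i0 b)) _ z) => //.
        exists b, x; split => //; apply/andP; split; [exact: ltW|by rewrite add0r ltW].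
      by exists a, u.
    by apply: oz; apply: rspan_gen => //; exists i, u.
  have o2 := innovation_past_orth (blk i0 b) (ltW x0) GW.
  move: o1; have -> : (fun w => X x (blk i0 b) w - z w) =
      (fun w => innov x 0 (blk i0 b) w + (pred w - z w)).
    by apply/funext => w; rewrite /innovation -/(pred w); ring.
  by rewrite ipDl // o2 add0r.
have Gpred : rspan P (past D 0) pred.
  by apply: rspan_closed => // e e0; exists z => //; rewrite W0.
have Grest : rspan P (past D 0)
    (fun w => \sum_(j < p) \sum_(i < k | i != a) E x (blk i0 b) (blk j i) * X 0 (blk j i) w).
  apply: rspan_sum => // j; rewrite (_ : (fun w => _) = (fun w => \sum_(i < k)
      (if i != a then E x (blk i0 b) (blk j i) else 0) * X 0 (blk j i) w)).
    apply: rspan_sum => // i; case: ifPn => ia.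
      by apply: rspanZ => //; exact: (state_past HL HC hp HX).
    by under eq_fun do rewrite mul0r; exact: rspan0.
  apply/funext => w; rewrite big_mkcond /=; apply: eq_bigr => i _.
  by case: ifP => _; rewrite ?mul0r.
have := rspanB (@sP D 0) Gpred Grest.
rewrite (_ : (fun w => _) = (fun w => \sum_j E x (blk i0 b) (blk j a) * X 0 (blk j a) w)) //.
apply/funext => w; rewrite /pred subr0 sum_blk -sumrB; apply: eq_bigr => j _.
by rewrite (bigD1 a) //= addrK.
Qed.

(** The predictor does not involve coordinate [a], so it is already the projection on the past
    without [a] and leaves the innovation as residual. *)
Lemma coef_eq0_granger (a b : 'I_k) :
  (forall al j, (A ^+ al) (blk i0 b) (blk j a) = 0) ->
  forall t x y z, window [set b] t x -> past [set a] t y ->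
    rproj P (past [set i | i != a] t) x z -> ip (fun w => x w - z w) y = 0.
Proof.
move=> h t x y z [_ [u [-> /andP[tu _] ->]]] [_ [s [-> st ->]]] hz.
rewrite (rproj_residual tu _ _ hz) //; first exact: (innovation_orth HL HC HX).
move=> j i /= /negP; rewrite negbK => /eqP ->.
have := @bilinear_expmx_pow_eq0 R n n n A 1%:M 1%:M (blk i0 b) (blk j a) _ (u - t).
rewrite mul1mx mulmx1; apply => al.
by rewrite mul1mx mulmx1.
Qed.

Let noT t u r : forall j i, ~ (setT : set 'I_k) i -> E (u - t) r (blk j i) = 0.
Proof. by move=> j i /(_ I). Qed.

(** On the full past the residuals are the innovations. *)
Lemma contemporaneous_innovation (a b : 'I_k) :
  (forall t x y z, window [set a] t x -> window [set b] t y ->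
    rproj P (past setT t) x z -> ip (fun w => x w - z w) y = 0) <->
  (forall t u u', t <= u <= t + 1 -> t <= u' <= t + 1 ->
    ip (innov u t (blk i0 a)) (innov u' t (blk i0 b)) = 0).
Proof.
have key t u u' r r' : t <= u -> ip (innov u t r) (X u' r') = ip (innov u t r) (innov u' t r').
  move=> tu; rewrite [RHS]ipBr // ip_sumr //; last by move=> q; exact: sqiZ.
  rewrite [X in _ - X]big1 ?subr0 // => q _.
  by rewrite ipZr // (innovation_orth HL HC HX) ?mulr0.
split=> [h t u u' tu tu'|h t x y z [_ [u [-> tu ->]]] [_ [u' [-> tu' ->]]] hz].
  have [t1 _] := andP tu.
  rewrite -key //.
  have [z hz] := rproj_exists (@sP setT t) (sX u (blk i0 a)).
  rewrite -(rproj_residual t1 _ (noT t u (blk i0 a)) hz) //.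
  by apply: (h t) hz; [exists a, u|exists b, u'].
have [t1 _] := andP tu.
by rewrite (rproj_residual t1 _ (noT t u (blk i0 a)) hz) // key // h.
Qed.

Let Q := B *m S *m B^T.

Let densityE u u' v : innovation_density P L A B u u' v = E (u - v) *m Q *m (E (u' - v))^T.
Proof. by rewrite /innovation_density /Q trmx_mul !mulmxA. Qed.

Let density_continuous u u' i j : continuous (fun v => innovation_density P L A B u u' v i j).
Proof.
rewrite (_ : (fun v => _) = (fun v => \sum_l (E (u - v) *m Q) i l * (1%:M *m E (u' - v) *m 1%:M) j l)); last first.
  apply/funext => v; rewrite densityE mxE; apply: eq_bigr => l _.
  by rewrite mul1mx mulmx1 [X in _ * X = _]mxE.
move=> v; apply: cvg_sumr => l; apply: cvgM.
  apply: (@continuous_comp _ _ _ (fun v : R => u - v) (fun x : R => (E x *m Q) i l)).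
    by apply: cvgB; [exact: cvg_cst|exact: cvg_id].
  have := @bilinear_expmx_continuous R n A n n 1%:M Q i l (u - v).
  by under eq_fun do rewrite mul1mx.
apply: (@continuous_comp _ _ _ (fun v : R => u' - v) (fun x : R => (1%:M *m E x *m 1%:M) j l)).
  by apply: cvgB; [exact: cvg_cst|exact: cvg_id].
exact: bilinear_expmx_continuous.
Qed.

(** The covariance is the integral of an identically zero density. When u' < u the roles
    are exchanged, and symmetry of [Q] transposes the entry. *)
Lemma coef_eq0_innovation (i j : 'I_n) :
  (forall al be, (al <= n - 1)%N -> (be <= n - 1)%N ->
     (A ^+ al *m Q *m (A ^+ be)^T) i j = 0) ->
  forall t u u', t <= u -> t <= u' -> ip (innov u t i) (innov u' t j) = 0.
Proof.
move=> /two_powers_expmx_eq0 h t u u' tu tu'.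
have z0 (a b : R) (f : R -> R) : (forall v, f v = 0) -> \int[leb]_(v in `]a, b]%classic) f v = 0.
  by move=> f0; under eq_Rintegral do rewrite f0; rewrite /Rintegral integral0.
have [uu'|/ltW u'u] := leP u u'.
  by rewrite (innovation_cov HL HC HX) // z0 // => v; rewrite densityE.
rewrite ipC (innovation_cov HL HC HX) // z0 // => v; rewrite densityE.
have QT : Q^T = Q by rewrite /Q !trmx_mul trmxK (HS.1) mulmxA.
have -> : (E (u' - v) *m Q *m (E (u - v))^T) j i = (E (u - v) *m Q *m (E (u' - v))^T)^T j i.
  by rewrite trmx_mul trmxK [(_ *m Q)^T]trmx_mul QT mulmxA.
by rewrite mxE h.
Qed.

(** The density depends on [v] and on the end points but not on [t]: with the end points fixed at
    0 and y - x, the integrals over (t, 0] vanish for all t near -x, so the density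
    vanishes at v = -x, where it is the entry of e^{Ax} Q e^{A^T y}. *)
Lemma innovation_coef_eq0 (i j : 'I_n) :
  (forall t u u', t <= u <= t + 1 -> t <= u' <= t + 1 -> ip (innov u t i) (innov u' t j) = 0) ->
  forall al be, (A ^+ al *m Q *m (A ^+ be)^T) i j = 0.
Proof.
move=> h; apply: expmx_two_powers_eq0 => x y x0 xy y1.
(* [c] is the earliest [t] for which both end points lie between t and t + 1. *)
pose u : R := 0; pose u' : R := y - x; pose c := u' - 1.
pose psi v := innovation_density P L A B u u' v i j.
have cpsi : continuous psi by exact: density_continuous.
have h0 t : c <= t -> t <= u -> \int[leb]_(v in `]t, u]%classic) psi v = 0.
  move=> ct tu; rewrite -(innovation_cov HL HC HX) //; last by rewrite /u /u'; lra.
  by apply: h; apply/andP; move: ct tu; rewrite /c /u /u' => ct tu; split; lra.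
have cu : c <= u by rewrite /c /u' /u; lra.
have icu : leb.-integrable `[c, u]%classic (EFin \o psi).
  apply: continuous_compact_integrable; first exact: segment_compact.
  exact: continuous_subspaceT.
have iou : leb.-integrable `]c, u]%classic (EFin \o psi).
  by apply: integrableS icu => //; apply: subset_itvr; rewrite bnd_simp.
have F0 t : c <= t -> t <= u -> \int[leb]_(v in `[c, t]%classic) psi v = 0.
  move=> ct tu.
  rewrite -Rintegral_itv_obnd_cbnd; last first.
    by apply: integrableS iou => //; apply: subset_itvl; rewrite bnd_simp.
  have := Rintegral_itvB iou; rewrite (_ : \int[leb]_(t in _) psi t = 0); last exact: h0.
  move=> /(_ t); rewrite !bnd_simp ct tu => /(_ isT isT).
  by rewrite h0 // sub0r => /eqP; rewrite oppr_eq0 => /eqP.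
pose v0 := u - x.
have cv0 : c < v0 by rewrite /c /v0 /u' /u; lra.
have v0u : v0 < u by rewrite /v0 /u; lra.
have [_] := @continuous_FTC1_closed R psi c v0 u v0u icu cv0 (cpsi v0).
rewrite derive1E.
rewrite (@near_eq_derive _ _ _ _ (fun=> 0)); last first.
  near=> v; apply: F0; near: v.
  - by apply: filterS (lt_nbhsr cv0) => v /ltW.
  - by apply: filterS (lt_nbhsl v0u) => v /ltW.
rewrite derive_cst /psi densityE /v0 /u' /u => H; rewrite [RHS]H.
have -> : 0 - (0 - x) = x by ring.
by have -> : y - x - (0 - x) = y by ring.
Unshelve. all: by end_near. Qed.

End coefficients.

(** * The causality conditions in terms of the state process *)

Local Close Scope classical_set_scope.

Lemma causal_mcarY d (T : measurableType d) (R : realType) (k p : nat) (hp : (0 < p)%N)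
    (X : R -> 'I_(\sum_(i < p) k) -> T -> R) (Y : R -> 'I_k -> T -> R) :
  (forall t a w, Y t a w = \sum_r mcarC R k p a r * X t r w) ->
  forall t a, Y t a = X t (blk (Ordinal hp) a).
Proof.
move=> YX t a; apply/funext => w; rewrite YX.
transitivity ((mcarC R k p *m \col_r X t r w) a ord0).
  by rewrite [RHS]mxE; apply: eq_bigr => r _; rewrite [X in _ = _ * X]mxE.
by rewrite (mulmx_mcarC hp) mxE.
Qed.

Lemma process_span_past d (T : measurableType d) (R : realType) (P : probability T R)
    (k p : nat) (hp : (0 < p)%N) (X : R -> 'I_(\sum_(i < p) k) -> T -> R)
    (Y : R -> 'I_k -> T -> R) (A : {set 'I_k}) (D : set 'I_k) (t : R) :
  (forall t a, Y t a = X t (blk (Ordinal hp) a)) -> (forall i, i \in A <-> D i) ->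
  process_span P Y A -oo%E t%:E = closed_span P (complexified (past hp X D t)).
Proof.
move=> YX AD; congr (closed_span P _); apply/seteqP; split => f /=.
  move=> [a [u [aA /andP[_ ut] ->]]]; exists (Y u a) => //.
  by exists a, u; split; [exact/AD|rewrite lee_fin in ut|].
move=> [_ [a [u [Da ut ->]]] ->]; exists a, u; split; [exact/AD| |by rewrite YX].
by rewrite leNye lee_fin.
Qed.

Lemma process_span_window d (T : measurableType d) (R : realType) (P : probability T R)
    (k p : nat) (hp : (0 < p)%N) (X : R -> 'I_(\sum_(i < p) k) -> T -> R)
    (Y : R -> 'I_k -> T -> R) (A : {set 'I_k}) (D : set 'I_k) (t : R) :
  (forall t a, Y t a = X t (blk (Ordinal hp) a)) -> (forall i, i \in A <-> D i) ->
  process_span P Y A t%:E (t + 1)%R%:E = closed_span P (complexified (window hp X D t)).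
Proof.
move=> YX AD; congr (closed_span P _); apply/seteqP; split => f /=.
  move=> [a [u [aA tu ->]]]; exists (Y u a) => //.
  by exists a, u; split; [exact/AD|rewrite !lee_fin in tu|].
move=> [_ [a [u [Da ut ->]]] ->]; exists a, u; split; [exact/AD| |by rewrite YX].
by rewrite !lee_fin.
Qed.

Section criteria.
Context d (T : measurableType d) (R : realType) (P : probability T R) (k p : nat).
Variables (hp : (0 < p)%N) (X : R -> 'I_(\sum_(i < p) k) -> T -> R) (Y : R -> 'I_k -> T -> R).
Hypothesis YX : forall t a, Y t a = X t (blk (Ordinal hp) a).
Hypothesis sX : forall t r, square_integrable P (X t r).

Let sP D t : (past hp X D t `<=` square_integrable P)%classic.
Proof. by move=> _ [i [u [_ _ ->]]]. Qed.

Let sW D t : (window hp X D t `<=` square_integrable P)%classic.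
Proof. by move=> _ [i [u [_ _ ->]]]. Qed.

Let in_sing (a i : 'I_k) : i \in [set a]%SET <-> [set a]%classic i.
Proof. by rewrite inE; split => /eqP. Qed.

Lemma granger_noncausalP (a b : 'I_k) : granger_noncausal P Y a b <->
  forall t x y z, window hp X [set b]%classic t x -> past hp X [set a]%classic t y ->
    rproj P (past hp X [set i | i != a]%classic t) x z -> l2ip P (fun w => x w - z w) y = 0.
Proof.
have inC i : i \in [set~ a]%SET <-> [set i | i != a]%classic i by rewrite !inE.
by split=> h t; have := h t; rewrite (process_span_window _ _ YX (in_sing b))
  (process_span_past _ _ YX (in_sing a)) (process_span_past _ _ YX inC) cond_orth_complexified.
Qed.

Lemma contemp_uncorrelatedP (a b : 'I_k) : contemp_uncorrelated P Y a b <->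
  forall t x y z, window hp X [set a]%classic t x -> window hp X [set b]%classic t y ->
    rproj P (past hp X [set: _]%classic t) x z -> l2ip P (fun w => x w - z w) y = 0.
Proof.
have inT (i : 'I_k) : i \in [set: 'I_k]%SET <-> [set: 'I_k]%classic i by rewrite inE.
by split=> h t; have := h t; rewrite (process_span_window _ _ YX (in_sing a))
  (process_span_window _ _ YX (in_sing b)) (process_span_past _ _ YX inT) cond_orth_complexified.
Qed.

End criteria.

Lemma mcar_covariance_coefE (R : realType) (k p : nat) (hp : (0 < p)%N) (Ac : 'I_p -> 'M[R]_k)
    (S : 'M[R]_k) (a b : 'I_k) al be :
  (mcarC R k p *m mcarA Ac ^+ al *m mcarB R k p *m S
     *m (mcarB R k p)^T *m ((mcarA Ac)^T) ^+ be *m (mcarC R k p)^T) a b =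
  (mcarA Ac ^+ al *m (mcarB R k p *m S *m (mcarB R k p)^T) *m (mcarA Ac ^+ be)^T)
    (blk (Ordinal hp) a) (blk (Ordinal hp) b).
Proof.
rewrite trmx_pow; set M := mcarA Ac ^+ al; set N := mcarA Ac ^+ be.
set C := mcarC R k p; set B := mcarB R k p.
have -> : C *m M *m B *m S *m B^T *m N^T *m C^T =
    C *m (C *m (M *m (B *m S *m B^T) *m N^T)^T)^T.
  by rewrite trmx_mul trmxK !mulmxA.
by rewrite (mulmx_mcarC hp) mxE (mulmx_mcarC hp) mxE.
Qed.

Theorem theorem6p19 (d : measure_display) (T : measurableType d) (R : realType)
    (P : probability T R) (k p : nat) (hp : (0 < p)%N)
    (Ac : 'I_p -> 'M[R]_k) (L Y : R -> 'I_k -> T -> R)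
    (hY : causal_mcar P Ac L Y) (hSigma : posdef (SigmaL P L))
    (a b : 'I_k) (hab : a != b) :
  (granger_noncausal P Y a b <->
   (forall (alpha : nat) (j : 'I_p), (1 <= alpha <= k * p - 1)%N ->
      (mcarC R k p *m mcarA Ac ^+ alpha *m mcarE R k j) b a
        = (mcarA Ac ^+ alpha) (blk (Ordinal hp) b) (blk j a) /\
      (mcarA Ac ^+ alpha) (blk (Ordinal hp) b) (blk j a) = 0)) /\
  (contemp_uncorrelated P Y a b <->
   (forall alpha beta : nat,
      (alpha <= k * p - 1)%N -> (beta <= k * p - 1)%N ->
      (mcarC R k p *m mcarA Ac ^+ alpha *m mcarB R k p *m SigmaL P L
         *m (mcarB R k p)^T *m ((mcarA Ac)^T) ^+ beta *m (mcarC R k p)^T) a b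
        = 0)).
Proof.
have [HL HC _ [X [HX YX0]]] := hY.
have YX := causal_mcarY hp YX0.
have nE : (\sum_(i < p) k = k * p)%N by rewrite sum_nat_const card_ord mulnC.
have sX t r := state_sqi HL HC HX t r.
split.
  rewrite (granger_noncausalP YX sX); split=> [h al j _|h].
    rewrite mulmx_mcarE (mulmx_mcarC hp); split => //.
    exact: (granger_coef_eq0 HL HC hSigma HX h).
  apply: (coef_eq0_granger HL HC HX) => al j.
  rewrite -[mcarA Ac ^+ al]mul1mx -[(1%:M *m _)]mulmx1.
  apply: cayley_hamilton_span => {}al hal; rewrite mul1mx mulmx1.
  (* The hypotheses start at the first power; the zeroth is the identity matrix, and its
     entry is off the diagonal as a <> b. *)
  have [->|al0] := posnP al.
    by rewrite expr0 mxE blk_eq [b == a]eq_sym (negbTE hab) andbF.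
  by have [] := h al j _; first by rewrite al0 -nE.
rewrite (contemp_uncorrelatedP YX sX) (contemporaneous_innovation HL HC hp HX).
split=> [h al be _ _|h t u u' /andP[tu _] /andP[tu' _]].
  by rewrite (mcar_covariance_coefE hp); exact: (innovation_coef_eq0 HL HC HX h).
apply: (coef_eq0_innovation HL HC hSigma HX) => // al be hal hbe.
by rewrite -mcar_covariance_coefE h // -nE.
Qed.
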